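(* Let $\ell$ and $k$ be two NMC intensities. Then $\mathfrak{R}(\ell)=\mathfrak{R}(k)$ if and only if $\Xi_\ell=\Xi_k$ (as functions on $[0,1]\times\mathbb{Z}$).
   Context: Path space: $\Omega$ is the set of all càdlàg step functions $\omega:[0,1]\to\mathbb{Z}$ with initial value in $\mathbb{Z}$ and finitely many jumps, all of amplitude $+1$, occurring at instants $0<t_1<\cdots<t_n<1$. $X=(X_t)_{0\le t\le 1}$ is the canonical process, $\Omega$ carries the $\sigma$-field generated by $X$, and $\mathcal{P}(\Omega)$ is the set of probability measures on $\Omega$. For $Q\in\mathcal{P}(\Omega)$, $Q_{01}:=Q\circ(X_0,X_1)^{-1}$ is its endpoint marginal; it is concentrated on $\{(x,y)\in\mathbb{Z}^2: x\le y\}$. NMC (nice Markov counting) intensity: a function $\ell:[0,1]\times\mathbb{Z}\to(0,\infty)$ such that for some $\bar\lambda>0$, $0<\ell(t,z)\le\bar\lambda$ for all $(t,z)$, and such that $t\mapsto\ell(t,z)$ is in $\mathcal{C}^1([0,1])$ for each $z\in\mathbb{Z}$. For $x\in\mathbb{Z}$, $R^x_\ell\in\mathcal{P}(\Omega)$ is the law of the counting process starting from $x$ with intensity $\ell$, i.e. $X_0=x$ a.s. and $X_t-X_0-\int_0^t\ell(s,X_{s^-})\,ds$ is a local martingale. For integers $x\le y$, the bridge is $R^{xy}_\ell:=R^x_\ell(\cdot\mid X_1=y)$. Reciprocal class: $\mathfrak{R}(\ell):=\big\{Q\in\mathcal{P}(\Omega): Q(\cdot)=\int_{\mathbb{Z}^2}R^{xy}_\ell(\cdot)\,Q_{01}(dx\,dy)\big\}$.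 Reciprocal invariant: $\Xi_\ell(t,z):=\partial_t\log\ell(t,z)+\ell(t,z+1)-\ell(t,z)$, for $(t,z)\in[0,1]\times\mathbb{Z}$. *)

(* Defs.v *)
From HB Require Import structures.
From mathcomp Require Import all_boot all_order all_algebra.
From mathcomp Require Import all_classical all_reals all_analysis.

Set Implicit Arguments.
Unset Strict Implicit.
Unset Printing Implicit Defensive.

Import Order.TTheory GRing.Theory Num.Theory.
Import numFieldNormedType.Exports.

Local Open Scope classical_set_scope.
Local Open Scope ring_scope.

HB.instance Definition _ := isPointed.Build int 0.
HB.instance Definition _ := @isMeasurable.Build default_measure_display
  int (@discrete_measurable int) (@discrete_measurable0 int)
  (@discrete_measurableC int) (@discrete_measurableU int).

(* A path is encoded by its initial value and the increasing list of its jump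
   times; [X_inj] below shows that distinct codes give distinct functions
   on [0,1]. *)
Definition path_code (R : realType) (c : int * seq R) : bool :=
  sorted <%R c.2 && all (fun s => 0 < s < 1) c.2.

Record counting_path (R : realType) := CountingPath {
  code : int * seq R;
  codeP : path_code code }.

HB.instance Definition _ (R : realType) := [isSub for @code R].
HB.instance Definition _ (R : realType) := [Choice of counting_path R by <:].
HB.instance Definition _ (R : realType) :=
  isPointed.Build (counting_path R) (@CountingPath R (0, [::]) isT).

Definition init (R : realType) (w : counting_path R) : int := (code w).1.
Definition jumps (R : realType) (w : counting_path R) : seq R := (code w).2.

Definition X (R : realType) (t : R) (w : counting_path R) : int :=
  init w + (count (fun s => s <= t) (jumps w))%:Z.

(* The left limit X_{t-}, see [Xleft_lim]; it equals X_0 at t = 0. *)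
Definition Xleft (R : realType) (t : R) (w : counting_path R) : int :=
  init w + (count (fun s => s < t) (jumps w))%:Z.

Definition canonical_filtration (R : realType) (t : R) :
    set (set (counting_path R)) :=
  <<s \bigcup_(s in `[0, t]) preimage_set_system setT (@X R s) measurable >>.

HB.instance Definition _ (R : realType) :=
  @isMeasurable.Build default_measure_display (counting_path R)
    (@canonical_filtration R 1) (@sigma_algebra0 _ setT _)
    (@sigma_algebraC (counting_path R) _) (@sigma_algebra_bigcup _ setT _).

Section path_facts.
Context (R : realType).
Implicit Types (w : counting_path R) (s t : R).

Lemma Xleft_lim t w : \forall s \near t^'-, X s w = Xleft t w.
Proof.
rewrite /X /Xleft; suff : \forall s \near t^'-,
    count (fun x => x <= s) (jumps w) = count (fun x => x < t) (jumps w).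
  by apply: filterS => s ->.
elim: (jumps w) => [|x js IH] /=; first exact: nearW.
have xE : \forall s \near t^'-, (x <= s) = (x < t).
  have [xt|tx] := ltP x t.
    by near=> s; apply: ltW; near: s; exact: nbhs_left_gt.
  by near=> s; apply/negbTE; rewrite -ltNge (lt_le_trans _ tx).
by near=> s; congr (nat_of_bool _ + _)%N; near: s.
Unshelve. all: by end_near. Qed.

Lemma X_rcont t w : \forall s \near t^'+, X s w = X t w.
Proof.
rewrite /X; suff : \forall s \near t^'+,
    count (fun x => x <= s) (jumps w) = count (fun x => x <= t) (jumps w).
  by apply: filterS => s ->.
elim: (jumps w) => [|x js IH] /=; first exact: nearW.
have xE : \forall s \near t^'+, (x <= s) = (x <= t).
  have [xt|tx] := leP x t.
    by near=> s; rewrite (le_trans xt)// ltW.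
  by near=> s; apply/negbTE; rewrite -ltNge; near: s; exact: nbhs_right_lt.
by near=> s; congr (nat_of_bool _ + _)%N; near: s.
Unshelve. all: by end_near. Qed.

Lemma X0_init w : X 0 w = init w.
Proof.
have /andP[_ /allP w01] := codeP w.
rewrite /X (@eq_in_count _ _ pred0) ?count_pred0 ?addr0// => s /w01 /andP[s0 _].
by rewrite leNgt s0.
Qed.

Lemma X_inj w1 w2 :
  (forall t, t \in `[0, 1] -> X t w1 = X t w2) -> w1 = w2.
Proof.
move=> X12.
have init12 : init w1 = init w2.
  by rewrite -!X0_init X12// in_itv /= lexx ler01.
have Xleft12 t : 0 < t < 1 -> Xleft t w1 = Xleft t w2.
  move=> /andP[t0 t1]; near (t^'-) => s.
  rewrite -(near (Xleft_lim t w1) s)// -(near (Xleft_lim t w2) s)//.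
  apply: X12; rewrite in_itv /=; apply/andP; split.
    by apply: ltW; near: s; exact: nbhs_left_gt.
  by rewrite ltW// (lt_trans _ t1).
have countE (w : counting_path R) t : count (fun s => s <= t) (jumps w) =
    ((t \in jumps w) + count (fun s => (s < t)%R) (jumps w))%N.
  have /andP[/lt_sorted_uniq u _] := codeP w.
  rewrite -count_uniq_mem// -count_predUI -[LHS]addn0; congr (_ + _)%N.
    by apply: eq_count => s /=; rewrite le_eqVlt.
  by rewrite (@eq_count _ _ pred0) ?count_pred0// => s /=; case: ltgtP.
have mem12 t : 0 < t < 1 -> (t \in jumps w1) = (t \in jumps w2).
  move=> t01; have := Xleft12 t t01.
  rewrite /Xleft init12 => /addrI[ltE].
  have := X12 t; rewrite in_itv /= !ltW; [|by case/andP: t01..].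
  move=> /(_ isT); rewrite /X init12 !countE ltE => /addrI[/addIn].
  by case: (t \in jumps w1); case: (t \in jumps w2).
have jumps12 : jumps w1 = jumps w2.
  have /andP[s1 /allP j1] := codeP w1; have /andP[s2 /allP j2] := codeP w2.
  apply: lt_sorted_eq => // t; apply/idP/idP => tj.
    by rewrite -mem12//; exact: j1.
  by rewrite mem12//; exact: j2.
apply: val_inj; rewrite /= [code w1]surjective_pairing.
rewrite [code w2]surjective_pairing.
by congr (_, _).
Unshelve. all: by end_near. Qed.

End path_facts.

Section processes.
Context d (T : measurableType d) (R : realType) (P : probability T R).
Variable F : R -> set (set T).

(* Time runs over [0, 1].  The third clause says that M_s is the conditional
   expectation of M_t given F_s. *)
Definition martingale (M : R -> T -> R) : Prop :=
  [/\ forall t, t \in `[0, 1] ->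
        forall B : set R, measurable B -> F t (M t @^-1` B),
      forall t, t \in `[0, 1] -> P.-integrable setT (EFin \o M t)
    & forall s t, 0 <= s -> s <= t -> t <= 1 -> forall A, F s A ->
        (\int[P]_(w in A) (M t w)%:E = \int[P]_(w in A) (M s w)%:E)%E].

Definition stopping_time (tau : T -> \bar R) : Prop :=
  (forall w, 0 <= tau w)%E /\
  forall t, t \in `[0, 1] -> F t [set w | (tau w <= t%:E)%E].

Definition stopped (M : R -> T -> R) (tau : T -> \bar R) (t : R) (w : T) : R :=
  M (fine (mine t%:E (tau w))) w.

(* As stopping times may take the value +oo, converging to +oo means here
   that the stopped process eventually coincides with M on all of [0, 1]. *)
Definition local_martingale (M : R -> T -> R) : Prop :=
  exists tau : nat -> T -> \bar R,
    [/\ forall n, stopping_time (tau n),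
        {ae P, forall w, nondecreasing_seq (tau^~ w) /\
                         tau n w @[n --> \oo] --> +oo%E}
      & forall n, martingale (stopped M (tau n))].

End processes.

Section intensities.
Context (R : realType).
Implicit Types (l : R -> int -> R) (f : R -> R).

Definition diff_quotient f (t s : R) : R := (f s - f t) / (s - t).

(* The derivative on [0,1], one-sided at 0 and at 1: intensities are only
   meaningful for times in [0,1]. *)
Definition derive01 f (t : R) : R :=
  lim (diff_quotient f t @ within `[0, 1] t^').

Definition C1_01 f : Prop :=
  (forall t, t \in `[0, 1] -> cvg (diff_quotient f t @ within `[0, 1] t^')) /\
  {within `[0, 1], continuous (derive01 f)}.

Definition NMC l : Prop :=
  (exists2 lbar : R, 0 < lbar &
     forall t z, t \in `[0, 1] -> 0 < l t z /\ l t z <= lbar) /\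
  (forall z, C1_01 (l^~ z)).

Definition compensated l (t : R) (w : counting_path R) : R :=
  (X t w)%:~R - (X 0 w)%:~R
  - \int[lebesgue_measure]_(s in `[0, t]) l s (Xleft s w).

Definition is_counting_law l (x : int)
    (P : probability (counting_path R) R) : Prop :=
  P [set w | X 0 w = x] = 1%E /\
  local_martingale P (@canonical_filtration R) (compensated l).

(* For an NMC intensity the martingale problem has exactly one solution;
   [get] names it. *)
Definition counting_law l (x : int) : probability (counting_path R) R :=
  get (is_counting_law l x).

Definition bridge l (x y : int) (A : set (counting_path R)) : \bar R :=
  let B := [set w | X 1 w = y] in
  (fine (counting_law l x (A `&` B)) / fine (counting_law l x B))%:E.

Definition endpoints (w : counting_path R) : int * int := (X 0 w, X 1 w).

Definition endpoint_marginal (Q : probability (counting_path R) R) :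
    set (int * int) -> \bar R :=
  pushforward Q endpoints.

Definition reciprocal_class l : set (probability (counting_path R) R) :=
  [set Q : probability (counting_path R) R |
     forall A : set (counting_path R), measurable A ->
     Q A = (\int[endpoint_marginal Q]_(p in [set p | (p.1 <= p.2)%R])
              bridge l p.1 p.2 A)%E].

Definition Xi l (t : R) (z : int) : R :=
  derive01 (fun s => ln (l s z)) t + l t (z + 1) - l t z.

End intensities.

(* Main.v *)
From HB Require Import structures.
From mathcomp Require Import all_boot all_order all_algebra.
From mathcomp Require Import all_classical all_reals all_analysis.
From mathcomp Require Import measurable_realfun.
From mathcomp Require Import zify ring lra.
Require Import Defs.

Set Implicit Arguments.
Unset Strict Implicit.
Unset Printing Implicit Defensive.

Import Order.TTheory GRing.Theory Num.Theory.
Import numFieldNormedType.Exports.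

Local Open Scope classical_set_scope.
Local Open Scope ring_scope.

(** The idea is to compare both counting laws with one reference measure.
    Write [mu x] for the (unnormalised) Poisson measure on the paths issued
    from [x].  With respect to it the counting process with intensity [l] has
    the density

      z l 1 w = prod_(u jump of w) l(u, w_(u-)) * exp (1 - int_0^1 l(s, w_(s-)) ds),

    so the bridges of [l] and [k] agree as soon as [z l 1 / z k 1] is a
    function of the end points.  Put d_z = log l(., z) - log k(., z) and
    e_z = l(., z) - k(., z).  The logarithm of the ratio is
    sum_u d_(w_(u-))(u) - int_0^1 e_(w_(s-))(s) ds, while the equality of the
    invariants at [z] reads d_z' = e_z - e_(z+1), that is
    d_z(t) = d_z(0) + E_z(t) - E_(z+1)(t) with E_z(t) = int_0^t e_z
    ([Xi_eq_integral]).  Following t |-> E_(w_t)(t) along the path, its smooth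
    variation is the integral of e and its jump at [u] is
    d_z(0) - d_z(u), z = w_(u-); summing up, only boundary terms and a sum of
    the numbers d_z(0) over the levels crossed remain ([sum_log_ratio],
    [density_ratio]).  Hence equal invariants give equal bridges and equal
    classes ([eq_bridge], [Xi_reciprocal_class]).

    For the converse, the counting law of [l] conditioned on the end points
    [(x, x + 1)] belongs to the class of [l] and its end point marginal is a
    Dirac mass, so if the classes are equal the bridges of [l] and [k] from
    [x] to [x + 1] are the same ([bridge_of_class]).  Such a bridge has a
    single jump, at a time whose density is proportional to

      l(u, x) * exp (- int_0^u l(s, x) ds - int_u^1 l(s, x + 1) ds).

    Proportionality of these functions for [l] and [k] is, after taking
    logarithms, the integral identity of [Xi_eq_integral]
    ([reciprocal_class_Xi]).

    Counting laws are defined through a local martingale problem, whose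
    unique solution has to be identified with the density above.

    Existence: the Mecke formula of the Poisson measure ([mecke]) turns the
    pathwise evolution of [z] into the forward equation [forward_equation];
    it shows that [z] is a martingale and that the intensity compensates [X]
    ([law_compensator]).

    From the local martingale to the compensator: Fatou's lemma bounds the
    expected number of jumps, and dominated convergence removes the stopping
    times ([local_martingale_compensator]).

    Uniqueness: the compensator identity extends from boxes ]a, b] x A to the
    predictable sigma-field, hence to the sets where the left limit has a
    given value.  This yields a closed integral equation for the occupation
    probabilities P(A, X_t = z) ([level_crossing], [occ_evolution]), which is
    solved level by level, upwards from the starting point, with Gronwall's
    lemma ([occ_unique], [counting_law_unique]).

    Intensities are given on the unit interval only; they are continued by
    constants, which changes neither the martingale problem nor the invariant
    on the unit interval ([counting_lawE]). *)

(** * Integer-valued measurable maps *)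

Section int_valued.
Context d (T : measurableType d).

Lemma bigcup_int_measurable (F : int -> set T) :
  (forall z, measurable (F z)) -> measurable (\bigcup_z F z).
Proof. by move=> mF; apply: countable_bigcupT_measurable => //; exact: countableP. Qed.

(** All sets of integers are measurable, so a map chosen among countably many
    measurable ones by an integer-valued measurable index is measurable. *)
Lemma measurable_fun_switch d' (U : measurableType d') (f : T -> int)
    (g : int -> T -> U) :
  measurable_fun setT f -> (forall z, measurable_fun setT (g z)) ->
  measurable_fun setT (fun x => g (f x) x).
Proof.
move=> mf mg _ Y mY; rewrite setTI.
rewrite (_ : _ @^-1` _ = \bigcup_z ((f @^-1` [set z]) `&` (g z @^-1` Y))).
  apply: bigcup_int_measurable => z; apply: measurableI.
    by rewrite -[X in measurable X]setTI; exact: mf.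
  by rewrite -[X in measurable X]setTI; exact: mg.
apply/seteqP; split=> [x /= Yx|x [z _ [/= <-]]//]; by exists (f x).
Qed.

Lemma measurable_fun_int_lt (f : T -> int) :
  (forall z, measurable [set x | f x < z]) -> measurable_fun setT f.
Proof.
move=> mf _ Y _; rewrite setTI.
rewrite (_ : _ @^-1` _ = \bigcup_z
   (if z \in Y then [set x | f x < z + 1] `\` [set x | f x < z] else set0)).
  apply: bigcup_int_measurable => z; case: ifP => // _; exact: measurableD.
apply/seteqP; split=> [x /= Yx|x [z _]].
  exists (f x) => //; rewrite mem_set//=; split => /=; first by rewrite ltzD1.
  by rewrite ltxx.
case: ifPn => //; rewrite inE => Yz [/=]; rewrite ltzD1 => fz /negP.
rewrite -leNgt => zf; suff -> : f x = z by [].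
by apply/eqP; rewrite eq_le fz.
Qed.

Lemma measurable_int_fun d' (V : measurableType d') (f : T -> int)
   (g : int -> V) : measurable_fun setT f -> measurable_fun setT (g \o f).
Proof. by move=> mf; exact: (@measurable_fun_switch _ V f (fun z _ => g z)). Qed.

End int_valued.

(** * Measurability on the space of counting paths *)

Section paths.
Context {R : realType}.
Notation T := (counting_path R).
Implicit Types (w : T) (s t u : R).

Lemma jumps01 w s : s \in jumps w -> 0 < s < 1.
Proof. by have /andP[_ /allP w01] := codeP w; exact: w01. Qed.

Lemma jumps_sorted w : sorted <%R (jumps w).
Proof. by have /andP[] := codeP w. Qed.

Lemma jumps_uniq w : uniq (jumps w).
Proof. exact/lt_sorted_uniq/jumps_sorted. Qed.

Lemma X1E w : X 1 w = init w + (size (jumps w))%:Z.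
Proof.
rewrite /X; congr (_ + Posz _); rewrite -(count_predT (jumps w)).
by apply: eq_in_count => s /jumps01/andP[_ /ltW ->].
Qed.

Lemma X_ge1 t w : 1 <= t -> X t w = X 1 w.
Proof.
move=> t1; rewrite /X; congr (_ + Posz _); apply: eq_in_count => s.
by move=> /jumps01/andP[_ s1]; rewrite (ltW s1) (le_trans (ltW s1) t1).
Qed.

Lemma X_le0 t w : t <= 0 -> X t w = X 0 w.
Proof.
move=> t0; rewrite /X; congr (_ + Posz _); apply: eq_in_count => s.
by move=> /jumps01/andP[s0 _]; rewrite !leNgt s0 (le_lt_trans t0 s0).
Qed.

Lemma X_homo w : {homo (@X R)^~ w : s t / s <= t >-> s <= t}.
Proof.
move=> s t st; rewrite lerD2l lez_nat; apply: sub_count => u /= us.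
exact: le_trans us st.
Qed.

Lemma filtration_gen t s (B : set int) : s \in `[0, t] ->
  canonical_filtration t (X s @^-1` B).
Proof.
move=> st; apply: sub_sigma_algebra; exists s; first by [].
by exists B => //; rewrite setTI.
Qed.

Lemma filtration_homo s t : s <= t ->
  @canonical_filtration R s `<=` @canonical_filtration R t.
Proof.
move=> st; apply: sub_sigma_algebra2 => A [r rs [B _ <-]].
exists r; last by exists B.
by move: rs; rewrite /= !in_itv/= => /andP[-> /le_trans ->].
Qed.

Lemma filtration_measurable t A : t <= 1 ->
  canonical_filtration t A -> measurable (A : set T).
Proof. by move=> t1; exact: filtration_homo. Qed.

Lemma measurable_X t : measurable_fun setT (@X R t).
Proof.
wlog t01 : t / t \in `[0, 1].
  move=> H; have [t0|t0] := leP t 0.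
    rewrite (_ : X t = X 0); first by apply: H; rewrite in_itv/= lexx ler01.
    by apply/funext => w; exact: X_le0.
  have [t1|t1] := leP 1 t.
    rewrite (_ : X t = X 1); first by apply: H; rewrite in_itv/= lexx ler01.
    by apply/funext => w; exact: X_ge1.
  by apply: H; rewrite in_itv/= !ltW.
by move=> _ B _; rewrite setTI; exact: filtration_gen.
Qed.

Lemma measurable_X_preimage t (B : set int) : measurable (@X R t @^-1` B).
Proof. by rewrite -[X in measurable X]setTI; exact: measurable_X. Qed.

(** The sigma-field of the path space is generated by the coordinates. *)
Lemma measurable_to_path d (U : measurableType d) (f : U -> T) :
  (forall t, t \in `[0, 1] -> measurable_fun setT (X t \o f)) ->
  measurable_fun setT f.
Proof.
move=> mf; apply: (measurability (\bigcup_(s in `[0, 1])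
  preimage_set_system setT (@X R s) measurable)) => //.
move=> _ [_ [s s01 [B _ <-]] <-]; rewrite !setTI.
by rewrite -[X in measurable X]setTI -comp_preimage; exact: (mf s).
Qed.

(** Right continuity lets rational times detect [X s w < z], whence the joint
    measurability of [X]. *)
Lemma X_lt_rat s w (z : int) : X s w < z <->
  exists q : rat, s < ratr q /\ X (ratr q) w < z.
Proof.
split=> [sz|[q [/ltW /(X_homo w)]]]; last exact: le_lt_trans.
have : \forall r \near s^'+, X r w < z.
  by apply: filterS (X_rcont s w) => r ->.
move=> /nbhs_ballP[e /= e0 H].
have /rat_in_itvoo[q] : s < s + e by rewrite ltrDl.
rewrite in_itv/= => /andP[sq qe]; exists q; split => //.
apply: H => //; rewrite /ball/= ltr_distlC; apply/andP; split => //.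
by rewrite (lt_trans _ sq)// ltrBlDr ltrDl.
Qed.

(** The counterpart of [X_lt_rat] for left limits: only values at rational
    times strictly before [s] occur, which also makes these sets predictable. *)
Lemma Xleft_ge_rat s w (z : int) : z <= Xleft s w <->
  exists q : rat, ratr q < s /\ z <= X (ratr q) w.
Proof.
split=> [sz|[q [qs zq]]]; last first.
  apply: (le_trans zq); rewrite lerD2l lez_nat; apply: sub_count => u /= uq.
  exact: le_lt_trans qs.
have : \forall r \near s^'-, z <= X r w.
  by apply: filterS (Xleft_lim s w) => r ->.
move=> /nbhs_ballP[e /= e0 H].
have /rat_in_itvoo[q] : s - e < s by rewrite ltrBlDr ltrDl.
rewrite in_itv/= => /andP[eq qs]; exists q; split => //.
apply: H => //; rewrite /ball/= ltr_distlC; apply/andP; split => //.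
by rewrite (lt_trans qs)// ltrDl.
Qed.

Lemma measurable_X_joint : measurable_fun setT (fun p : R * T => X p.1 p.2).
Proof.
apply: measurable_fun_int_lt => z.
rewrite (_ : [set _ | _] = \bigcup_(q : rat)
    ([set s : R | s < ratr q] `*` [set w | X (ratr q) w < z])).
  apply: bigcupT_measurable_rat => q; apply: measurableX.
    by rewrite -set_itvNyo; exact: measurable_itv.
  exact: (@measurable_X_preimage _ [set y | y < z]).
apply/seteqP; split=> [[s w] /= /X_lt_rat[q [sq qz]]|[s w] [q _ [/= sq qz]]].
  by exists q.
by apply/X_lt_rat; exists q.
Qed.

Lemma measurable_Xleft_joint :
  measurable_fun setT (fun p : R * T => Xleft p.1 p.2).
Proof.
apply: measurable_fun_int_lt => z.
rewrite (_ : [set _ | _] = ~` \bigcup_(q : rat)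
    ([set s : R | ratr q < s] `*` [set w | z <= X (ratr q) w])).
  apply: measurableC; apply: bigcupT_measurable_rat => q; apply: measurableX.
    by rewrite -set_itvoy; exact: measurable_itv.
  exact: (@measurable_X_preimage _ [set y | z <= y]).
apply/seteqP; split=> [[s w] /= sz [q _ [/= qs zq]]|[s w] /= H].
  have /Xleft_ge_rat : exists q : rat, ratr q < s /\ z <= X (ratr q) w.
    by exists q.
  by rewrite leNgt sz.
rewrite ltNge; apply/negP => /Xleft_ge_rat[q [qs zq]]; apply: H.
by exists q.
Qed.

(** The default value [1] plays the role of infinity: it lies beyond every time
    [t < 1]. *)
Lemma nth_sorted_count (js : seq R) i t : sorted <%R js -> t < 1 ->
  (nth 1 js i <= t) = (i < count (fun s => (s <= t)%R) js)%N.
Proof.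
move=> + t1; elim: js i => [i _|a js IH i /= ajs].
  by rewrite nth_nil ltn0 leNgt t1.
have {}IH j := IH j (path_sorted ajs).
have [at_|ta] := leP a t; first by case: i => [|i] //=; rewrite IH.
have -> : count (fun s => s <= t) js = 0%N.
  rewrite (@eq_in_count _ _ pred0) ?count_pred0// => s sjs /=.
  move/(order_path_min lt_trans)/allP : ajs => /(_ _ sjs) as_.
  by apply/negbTE; rewrite -ltNge (lt_trans ta).
case: i => [|i] /=; first by apply/negbTE; rewrite -ltNge.
rewrite IH (@eq_in_count _ _ pred0) ?count_pred0// => s sjs /=.
move/(order_path_min lt_trans)/allP : ajs => /(_ _ sjs) as_.
by apply/negbTE; rewrite -ltNge (lt_trans ta).
Qed.

Lemma measurable_X_incr s t (B : set int) :
  measurable [set w : T | B (X t w - X s w)].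
Proof.
have mD : measurable_fun setT (fun w : T => X t w - X s w).
  apply: (@measurable_fun_switch _ _ _ _ (X s) (fun z w => X t w - z)).
    exact: measurable_X.
  move=> z; apply: (@measurable_int_fun _ _ _ _ _ (fun y => y - z)).
  exact: measurable_X.
by rewrite -[X in measurable X]setTI; have := mD measurableT B I.
Qed.

Lemma measurable_size_preimage n : measurable [set w : T | size (jumps w) = n].
Proof.
rewrite (_ : [set _ | _] = [set w | X 1 w - X 0 w = n%:Z]); last first.
  apply/seteqP; split=> w /=; rewrite X1E X0_init addrAC subrr add0r.
    by move=> ->.
  by case.
exact: (@measurable_X_incr 0 1 [set n%:Z]).
Qed.

(** Countably many cases according to the number of jumps: quantities defined by
    recursion on the list of jumps are measurable because they are so for each
    length. *)
Lemma measurable_by_size d (U : measurableType d) d' (V : measurableType d')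
    (W : U -> T) (f : U -> V) (g : nat -> U -> V) : measurable_fun setT W ->
  (forall n, measurable_fun setT (g n)) ->
  (forall x, f x = g (size (jumps (W x))) x) -> measurable_fun setT f.
Proof.
move=> mW mg fg.
have -> : f = fun x => g `|(size (jumps (W x)))%:Z|%N x by apply/funext.
apply: (@measurable_fun_switch _ U _ _ (fun x => (size (jumps (W x)))%:Z)
  (fun z => g `|z|%N)) => [|z]; last exact: mg.
suff mS : measurable_fun setT (fun w : T => (size (jumps w))%:Z).
  exact: (measurableT_comp mS mW).
move=> _ B _; rewrite setTI.
rewrite (_ : _ @^-1` _ = \bigcup_n
    (if n%:Z \in B then [set w : T | size (jumps w) = n] else set0)).
  by apply: bigcupT_measurable => n; case: ifP => // _; exact: measurable_size_preimage.
apply/seteqP; split => [w /= Bw|w [n _]].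
  by exists (size (jumps w)) => //; rewrite mem_set.
by case: ifPn => //; rewrite inE => Bn /= ->.
Qed.

Definition jump_time i w : R := nth 1 (jumps w) i.

Lemma measurable_jump_time i : measurable_fun setT (jump_time i).
Proof.
apply: (measurability _ (measurable_realfun.RGenOInfty.measurableE R)) => _ [_ [x ->] <-].
rewrite setTI set_itvoy.
have [x1|x1] := leP 1 x.
  rewrite (_ : _ @^-1` _ = set0) //; apply/seteqP; split => // w /=.
  rewrite ltNge /jump_time; have [iw|iw] := ltnP i (size (jumps w)).
    have /andP[_ /ltW] := jumps01 (mem_nth 1 iw).
    by move=> /le_trans-/(_ _ x1) ->.
  by rewrite nth_default// x1.
rewrite (_ : _ @^-1` _ = [set w | X x w - X 0 w <= i%:Z]); last first.
  apply/seteqP; split=> w /=;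
    rewrite X0_init /X addrAC subrr add0r lez_nat leqNgt -nth_sorted_count //;
    rewrite ?jumps_sorted// ltNge //.
exact: (@measurable_X_incr 0 x [set z | z <= i%:Z]).
Qed.

End paths.

(** * Inserting a jump, stopping a path *)

Section ops.
Context {R : realType}.
Notation T := (counting_path R).
Implicit Types (w : T) (s t u : R).

Lemma sum_jumps_measurable d (U : measurableType d) (W : U -> T)
    (h : R -> U -> \bar R) : measurable_fun setT W ->
  measurable_fun setT (fun p : R * U => h p.1 p.2) ->
  measurable_fun setT (fun x => (\sum_(v <- jumps (W x)) h v x)%E).
Proof.
move=> mW mh.
apply: (@measurable_by_size _ _ _ _ _ W _
  (fun n x => (\sum_(i < n) h (jump_time i (W x)) x)%E)) => //.
  move=> n; apply: emeasurable_sum => i.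
  apply: (measurableT_comp mh (g := fun x => (jump_time i (W x), x))).
  apply: measurable_fun_pair => //.
  exact: (measurableT_comp (measurable_jump_time i) mW).
by move=> x; rewrite (big_nth 1) big_mkord.
Qed.

Lemma prod_jumps_measurable d (U : measurableType d) (W : U -> T)
    (h : R -> U -> R) : measurable_fun setT W ->
  measurable_fun setT (fun p : R * U => h p.1 p.2) ->
  measurable_fun setT (fun x => \prod_(v <- jumps (W x)) h v x).
Proof.
move=> mW mh.
apply: (@measurable_by_size _ _ _ _ _ W _
  (fun n x => \prod_(i < n) h (jump_time i (W x)) x)) => //.
  move=> n; apply: measurable_prod => i _.
  apply: (measurableT_comp mh (g := fun x => (jump_time i (W x), x))).
  apply: measurable_fun_pair => //.
  exact: (measurableT_comp (measurable_jump_time i) mW).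
by move=> x; rewrite (big_nth 1) big_mkord.
Qed.

Lemma path_ext w w' : init w = init w' -> jumps w =i jumps w' -> w = w'.
Proof.
move=> i12 j12; apply: val_inj; rewrite /= [code w]surjective_pairing.
rewrite [code w']surjective_pairing; congr (_, _) => //.
by apply: lt_sorted_eq => //; exact: jumps_sorted.
Qed.

(** Adds a jump at time [u], or leaves [w] unchanged when this is impossible, that
    is when [u] is outside ]0,1[ or already a jump time. *)
Definition ins u w : T := insubd w (init w, sort <=%R (u :: jumps w)).

Definition insertable u w := (0 < u < 1) && (u \notin jumps w).

Lemma path_code_ins u w :
  path_code (init w, sort <=%R (u :: jumps w)) = insertable u w.
Proof.
rewrite /path_code /insertable /= all_sort /= andbC lt_sorted_uniq_le sort_uniq.
rewrite sort_le_sorted andbT /= jumps_uniq andbT.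
have -> : all (fun s => 0 < s < 1) (jumps w) by apply/allP => s /jumps01.
by rewrite andbT.
Qed.

Lemma perm_ins u w : insertable u w -> perm_eq (jumps (ins u w)) (u :: jumps w).
Proof.
rewrite -path_code_ins => uw; rewrite /ins /jumps.
have := insubdK w uw; rewrite /= => ->/=.
by rewrite perm_sort.
Qed.

Lemma ins_id u w : ~~ insertable u w -> ins u w = w.
Proof. by rewrite -path_code_ins => uw; rewrite /ins /insubd insubN. Qed.

Lemma init_ins u w : init (ins u w) = init w.
Proof.
have [uw|/ins_id->//] := boolP (insertable u w).
rewrite -path_code_ins in uw; rewrite /ins /init.
by have := insubdK w uw; rewrite /= => ->.
Qed.

Lemma mem_ins u w s :
  (s \in jumps (ins u w)) = (s \in jumps w) || ((s == u) && (0 < u < 1)).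
Proof.
have [uw|uw] := boolP (insertable u w).
  rewrite (perm_mem (perm_ins uw)) inE orbC; congr orb.
  by have /andP[-> _] := uw; rewrite andbT.
rewrite ins_id//; move: uw; rewrite /insertable negb_and negbK.
case: (0 < u < 1) => /=; last by rewrite andbF orbF.
rewrite andbT => uw; have [->|] := eqVneq s u; first by rewrite uw.
by rewrite orbF.
Qed.

Lemma ins_comm u v w : ins u (ins v w) = ins v (ins u w).
Proof.
apply: path_ext => [|s]; first by rewrite !init_ins.
by rewrite !mem_ins -!orbA; congr orb; rewrite orbC.
Qed.

Lemma X_ins u w t : insertable u w -> X t (ins u w) = X t w + (u <= t)%R%:Z.
Proof.
move=> uw; rewrite /X init_ins -addrA; congr +%R.
by rewrite (permP (perm_ins uw)) /= addnC.
Qed.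

Lemma Xleft_ins u w t : insertable u w ->
  Xleft t (ins u w) = Xleft t w + (u < t)%R%:Z.
Proof.
move=> uw; rewrite /Xleft init_ins -addrA; congr +%R.
by rewrite (permP (perm_ins uw)) /= addnC.
Qed.

Lemma X_Xleft t w : X t w = Xleft t w + (t \in jumps w)%:Z.
Proof.
rewrite /X /Xleft -addrA; congr +%R; rewrite -PoszD; congr Posz.
rewrite -count_uniq_mem ?jumps_uniq// -count_predUI -[LHS]addn0; congr addn.
  by apply: eq_count => s /=; rewrite le_eqVlt orbC.
by rewrite (@eq_count _ _ pred0) ?count_pred0// => s /=; case: ltgtP.
Qed.

(** Being a jump time is the measurable condition that [X] and [Xleft] differ. *)
Lemma measurable_insertable :
  measurable_fun setT (fun p : R * T => insertable p.1 p.2).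
Proof.
apply: measurable_and.
  apply: measurable_and; first exact: measurable_fun_ltr.
  exact: measurable_fun_ltr.
rewrite (_ : (fun _ => _) = (fun p => X p.1 p.2 - Xleft p.1 p.2 == 0)).
  apply: (@measurable_fun_switch _ _ _ _ (fun p : R * T => X p.1 p.2)
    (fun z p => z - Xleft p.1 p.2 == 0)); first exact: measurable_X_joint.
  move=> z; apply: (@measurable_int_fun _ _ _ _ _ (fun y => z - y == 0)).
  exact: measurable_Xleft_joint.
apply/funext => -[u w] /=; rewrite X_Xleft addrAC subrr add0r.
by case: (u \in jumps w).
Qed.

Lemma measurable_ins : measurable_fun setT (fun p : R * T => ins p.1 p.2).
Proof.
apply: measurable_to_path => t t01.
rewrite (_ : _ \o _ = fun p : R * T => if insertable p.1 p.2
    then (if p.1 <= t then X t p.2 + 1 else X t p.2) else X t p.2).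
  have mX : measurable_fun setT (fun p : R * T => X t p.2).
    by apply: (measurableT_comp (measurable_X t)).
  apply: measurable_fun_ifT => //; first exact: measurable_insertable.
  apply: measurable_fun_ifT => //; first exact: measurable_fun_ler.
  exact: (@measurable_int_fun _ _ _ _ _ (fun y => y + 1)).
apply/funext => -[u w] /=; case: ifPn => [/X_ins->|/ins_id->//].
by case: (u <= t); rewrite ?addr0.
Qed.

Lemma path_code_stop t w : path_code (init w, [seq s <- jumps w | s <= t]).
Proof.
rewrite /path_code /= sorted_filter ?jumps_sorted//=; last exact: lt_trans.
by apply/allP => s; rewrite mem_filter => /andP[_ /jumps01].
Qed.

Definition stop t w : T := CountingPath (path_code_stop t w).

Lemma X_stop t w s : X s (stop t w) = X (Num.min s t) w.
Proof.
rewrite /X /= count_filter; congr (_ + Posz _).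
by apply: eq_count => r /=; rewrite le_min.
Qed.

Lemma Xleft_stop t w s : s <= t -> Xleft s (stop t w) = Xleft s w.
Proof.
move=> st; rewrite /Xleft /= count_filter; congr (_ + Posz _).
apply: eq_count => r /=; case: ltP => //= rs.
by rewrite (le_trans (ltW rs) st).
Qed.

(** The information up to time [t] is the information on the path stopped at [t];
    [stop_filtration] is the converse. *)
Lemma filtration_stopP t A : canonical_filtration t A ->
  forall w, A (stop t w) <-> A w.
Proof.
pose C := [set A : set T | forall w, A (stop t w) <-> A w].
suff : canonical_filtration t `<=` C by exact.
apply: smallest_sub; first split.
- by move=> w.
- move=> B CB w; split=> -[_ /= nB]; split=> // Bw; apply: nB; exact/CB.
- move=> F CF w; split=> -[n _ Fn]; exists n => //; exact/CF.
move=> _ [s + [B _ <-]] w; rewrite /= in_itv/= => /andP[s0 st].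
by rewrite /= X_stop min_l.
Qed.

Lemma stop_filtration t A : 0 <= t -> t <= 1 -> measurable A ->
  (forall w, A (stop t w) <-> A w) -> @canonical_filtration R t A.
Proof.
move=> t0 t1 mA As.
have -> : A = stop t @^-1` A by apply/seteqP; split => w /As.
pose C := [set A : set T | canonical_filtration t (stop t @^-1` A)].
suff : @canonical_filtration R 1 `<=` C by exact.
apply: smallest_sub; first split.
- by rewrite /C /= preimage_set0; exact: sigma_algebra0.
- move=> B CB; rewrite /C /= setTD preimage_setC -setTD.
  exact: sigma_algebraCD.
- move=> F CF; rewrite /C /= preimage_bigcup; exact: sigma_algebra_bigcup.
move=> _ [s + [B _ <-]]; rewrite /= in_itv/= => /andP[s0 _].
rewrite /C/= setTI -comp_preimage.
rewrite (_ : _ \o _ = X (Num.min s t)); last by apply/funext => w; exact: X_stop.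
by apply: filtration_gen; rewrite in_itv/= le_min s0 t0 ge_min lexx orbT.
Qed.

(** Jumps added in the future of [s] are invisible at time [s]; this is how
    adaptedness enters the Mecke formula. *)
Lemma filtration_ins s u w A : canonical_filtration s A -> s < u ->
  A (ins u w) <-> A w.
Proof.
move=> As su; rewrite -(filtration_stopP As (ins u w)) -(filtration_stopP As w).
suff -> : stop s (ins u w) = stop s w by [].
apply: path_ext; first exact: init_ins.
move=> r; rewrite !mem_filter mem_ins.
have [rs|//] := leP r s; have [ru|] := eqVneq r u.
  by rewrite ru leNgt su in rs.
by rewrite orbF.
Qed.

End ops.

(** * The Poisson measure and the Mecke formula *)

Section tonelli.
Context (R : realType) d1 d2 (U : measurableType d1) (V : measurableType d2).
Local Open Scope ereal_scope.

Lemma measurable_comp2 d3 d4 (W : measurableType d3) (Z : measurableType d4)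
    (h : U -> V -> Z) (a : W -> U) (b : W -> V) :
  measurable_fun setT (fun p : U * V => h p.1 p.2) ->
  measurable_fun setT a -> measurable_fun setT b ->
  measurable_fun setT (fun x => h (a x) (b x)).
Proof.
move=> mh ma mb; exact: (measurableT_comp mh (measurable_fun_pair ma mb)).
Qed.

Lemma measurable_integral (m : {sigma_finite_measure set V -> \bar R})
    (f : U -> V -> \bar R) :
  measurable_fun setT (fun p : U * V => f p.1 p.2) ->
  (forall x y, 0 <= f x y) ->
  measurable_fun setT (fun x => \int[m]_y f x y).
Proof.
by move=> mf f0; exact: (measurable_fun_fubini_tonelli_F (fun p => f p.1 p.2)).
Qed.

Lemma tonelli (m1 : {sigma_finite_measure set U -> \bar R})
    (m2 : {sigma_finite_measure set V -> \bar R}) (f : U -> V -> \bar R) :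
  measurable_fun setT (fun p : U * V => f p.1 p.2) ->
  (forall x y, 0 <= f x y) ->
  \int[m1]_x \int[m2]_y f x y = \int[m2]_y \int[m1]_x f x y.
Proof.
by move=> mf f0; exact: (@fubini_tonelli _ _ _ _ _ m1 m2 (fun p => f p.1 p.2)).
Qed.

End tonelli.

Section base_measure.
Context {R : realType}.
Notation T := (counting_path R).
Implicit Types (w : T) (s t u : R) (x : int).

Definition unif : probability (measurableTypeR R) R := uniform_prob (@ltr01 R).

Lemma integral_unif (f : R -> \bar R) : measurable_fun setT f ->
  (forall v, 0 <= f v)%E ->
  (\int[unif]_v f v = \int[lebesgue_measure]_(v in `[0%R, 1%R]) f v)%E.
Proof. by move=> mf f0; rewrite integral_uniform// subr0 invr1 mul1e. Qed.

(** In the unit interval, the times at which no jump can be inserted are finite in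
    number. *)
Lemma unif_insertable w (f g : R -> \bar R) :
  measurable_fun setT f -> measurable_fun setT g ->
  (forall v, 0 <= f v)%E -> (forall v, 0 <= g v)%E ->
  (forall u, insertable u w -> f u = g u) ->
  (\int[unif]_v f v = \int[unif]_v g v)%E.
Proof.
move=> mf mg f0 g0 fg; rewrite !integral_unif//.
apply: ge0_ae_eq_integral => //.
- exact: measurable_funTS.
- exact: measurable_funTS.
pose N := [set` [:: 0, 1 & jumps w]].
have cN : countable N by apply/finite_set_countable/finite_seqP; exists [:: 0, 1 & jumps w].
exists N; split.
- exact: countable_measurable.
- exact: countable_lebesgue_measure0.
move=> u /= /not_implyP[]; rewrite in_itv/= => /andP[u0 u1] /eqP nfg.
rewrite /N/= !inE; apply/or3P; have [->|un0] := eqVneq u 0; first by constructor.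
have [->|un1] := eqVneq u 1; first by constructor.
constructor 3; apply/negP => /negP uw; move/eqP: nfg; apply.
by apply: fg; rewrite /insertable uw !lt_neqAle eq_sym un0 u0 un1 u1.
Qed.

Definition no_jump x : T := @CountingPath R (x, [::]) isT.

Definition insp (p : measurableTypeR R * T) : T := ins p.1 p.2.
HB.instance Definition _ := isMeasurableFun.Build _ _ _ _ insp (@measurable_ins R).

(** The law of the path with [n] independent uniform jump times. *)
Fixpoint nu x n : probability T R :=
  if n is n'.+1 then distribution (unif \x nu x n')%E insp
  else \d_(no_jump x).

Lemma integral_nuS x n (f : T -> \bar R) : measurable_fun setT f ->
  (forall w, 0 <= f w)%E ->
  (\int[nu x n.+1]_w f w = \int[nu x n]_w \int[unif]_u f (ins u w))%E.
Proof.
move=> mf f0; rewrite /= /distribution ge0_integral_pushforward//.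
rewrite preimage_setT /=.
have := (@fubini_tonelli2 _ _ _ _ _ unif (nu x n) (f \o insp)).
move=> -> //.
  by apply: measurableT_comp.
by move=> p; exact: f0.
Qed.

Lemma measurable_ins1 w : measurable_fun setT (fun u : R => ins u w).
Proof.
exact: (measurable_comp2 (a := id) (b := cst w) measurable_ins).
Qed.

(** The new jump can be inserted before or after another one: this exchange is
    the induction step of the Mecke formula. *)
Lemma ins_swap_integral (h : R -> T -> \bar R) w :
  measurable_fun setT (fun p : R * T => h p.1 p.2) -> (forall v w, 0 <= h v w)%E ->
  (\int[unif]_v \int[unif]_u h v (ins u (ins v w)) =
   \int[unif]_u \int[unif]_v h v (ins v (ins u w)))%E.
Proof.
move=> mh h0.
have mf : measurable_fun setT (fun p : R * R => h p.1 (ins p.2 (ins p.1 w))).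
  apply: (measurable_comp2 (a := fst) mh) => //.
  apply: (measurable_comp2 (a := snd) measurable_ins) => //.
  exact: (measurableT_comp (measurable_ins1 w) measurable_fst).
have f0 (v u : R) : (0 <= h v (ins u (ins v w)))%E by exact: h0.
have := @tonelli _ _ _ _ _ unif unif (fun v u => h v (ins u (ins v w))) mf f0.
move=> ->; apply: eq_integral => u _; apply: eq_integral => v _.
by rewrite ins_comm.
Qed.

(** Each of the [n] exchangeable jump times may be regarded as inserted last, in
    a path with [n - 1] of them. *)
Lemma mecke_nu x n (h : R -> T -> \bar R) :
  measurable_fun setT (fun p : R * T => h p.1 p.2) -> (forall v w, 0 <= h v w)%E ->
  (\int[nu x n]_w \sum_(v <- jumps w) h v w =
   n%:R%:E * \int[nu x n.-1]_w \int[unif]_v h v (ins v w))%E.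
Proof.
elim: n h => [|n IH] h mh h0.
  rewrite mul0e /= integral_dirac// ?diracT ?mul1e ?big_nil//.
  by apply: sum_jumps_measurable.
have mS : measurable_fun setT (fun w : T => \sum_(v <- jumps w) h v w)%E.
  exact: sum_jumps_measurable.
have S0 w : (0 <= \sum_(v <- jumps w) h v w)%E by exact: sume_ge0.
pose psi w := (\int[unif]_v h v (ins v w))%E.
(* psi collects the jump inserted last, h' the earlier ones. *)
pose h' v w := (\int[unif]_u h v (ins u w))%E.
have mhins : measurable_fun setT (fun p : T * R => h p.2 (ins p.2 p.1)).
  apply: (measurable_comp2 mh) => //.
  exact: (measurable_comp2 measurable_ins).
have mpsi : measurable_fun setT psi.
  exact: (measurable_integral unif (f := fun w v => h v (ins v w))).
have psi0 w : (0 <= psi w)%E by exact: integral_ge0.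
have mh' : measurable_fun setT (fun p : R * T => h' p.1 p.2).
  apply: (measurable_integral unif (f := fun p u => h p.1 (ins u p.2))) => //.
  apply: (measurable_comp2 mh); first exact: measurableT_comp.
  apply: (measurable_comp2 measurable_ins) => //.
  exact: (measurableT_comp (measurable_snd) (measurable_fst)).
have h'0 v w : (0 <= h' v w)%E by exact: integral_ge0.
rewrite integral_nuS//.
transitivity (\int[nu x n]_w (psi w + \sum_(v <- jumps w) h' v w))%E.
  apply: eq_integral => w _.
  rewrite (unif_insertable (w := w)
    (g := fun u => h u (ins u w) + \sum_(v <- jumps w) h v (ins u w)))%E.
  - rewrite ge0_integralD//; [congr (_ + _)%E| | | ].
    + rewrite ge0_integral_sum// => v.
      exact: (measurable_comp2 (a := cst v) mh _ (measurable_ins1 w)).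
    + exact: (measurable_comp2 (a := id) mh _ (measurable_ins1 w)).
    + by move=> *; exact: sume_ge0.
    + apply: emeasurable_sum => v.
      exact: (measurable_comp2 (a := cst v) mh _ (measurable_ins1 w)).
  - exact: (measurableT_comp mS (measurable_ins1 w)).
  - apply: emeasurable_funD.
      exact: (measurable_comp2 (a := id) mh _ (measurable_ins1 w)).
    apply: emeasurable_sum => v.
    exact: (measurable_comp2 (a := cst v) mh _ (measurable_ins1 w)).
  - by move=> v.
  - by move=> v; rewrite adde_ge0//; exact: sume_ge0.
  - by move=> u uw; rewrite (perm_big _ (perm_ins uw)) big_cons.
rewrite ge0_integralD//; [|by move=> *; exact: sume_ge0|exact: sum_jumps_measurable].
rewrite IH//; case: n {IH} => [|n] in mS S0 *.
  by rewrite mul0e adde0 mul1e.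
have -> : (\int[nu x n.+1.-1]_w \int[unif]_v h' v (ins v w) =
           \int[nu x n.+1]_w psi w)%E.
  rewrite (@integral_nuS x n psi mpsi psi0); apply: eq_integral => w _.
  exact: ins_swap_integral.
rewrite -[X in (X + _)%E]mul1e -ge0_muleDl ?lee_fin// -EFinD.
Qed.

End base_measure.

Section poisson.
Context {R : realType}.
Notation T := (counting_path R).
Implicit Types (w : T) (s t u : R) (x : int).

Lemma size_ins u w : insertable u w -> size (jumps (ins u w)) = (size (jumps w)).+1.
Proof. by move=> /perm_ins/perm_size. Qed.

Lemma nu_ext x n (f g : T -> \bar R) :
  measurable_fun setT f -> measurable_fun setT g ->
  (forall w, 0 <= f w)%E -> (forall w, 0 <= g w)%E ->
  (forall w, init w = x -> size (jumps w) = n -> f w = g w) ->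
  (\int[nu x n]_w f w = \int[nu x n]_w g w)%E.
Proof.
elim: n f g => [|n IH] f g mf mg f0 g0 fg.
  by rewrite /= !integral_dirac// fg.
have mfins (h : T -> \bar R) w : measurable_fun setT h ->
    measurable_fun setT (fun u : R => h (ins u w)).
  by move=> mh; exact: (measurableT_comp mh (measurable_ins1 w)).
have mi (h : T -> \bar R) : measurable_fun setT h -> (forall w, 0 <= h w)%E ->
    measurable_fun setT (fun w => \int[unif]_u h (ins u w))%E.
  move=> mh h0; apply: (measurable_integral unif (f := fun w u => h (ins u w))) => //.
  apply: (measurableT_comp mh).
  exact: (measurable_comp2 (a := snd) (b := fst) measurable_ins).
rewrite !integral_nuS//; apply: IH.
- exact: mi.
- exact: mi.
- by move=> w; exact: integral_ge0.
- by move=> w; exact: integral_ge0.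
move=> w wx wn; apply: (unif_insertable (w := w)) => //.
- exact: mfins.
- exact: mfins.
by move=> u uw; apply: fg; rewrite ?init_ins// size_ins// wn.
Qed.

Lemma invfact_ge0 n : 0 <= (n`!%:R : R)^-1.
Proof. by []. Qed.

(** The Poisson measure of rate one on the paths issued from [x], without the
    factor exp(-1): its total mass does not matter. *)
Definition mu x : set T -> \bar R :=
  mseries (fun n => mscale (NngNum (invfact_ge0 n)) (nu x n)) 0.
HB.instance Definition _ x := Measure.on (mu x).

Lemma integral_mu x (f : T -> \bar R) : measurable_fun setT f ->
  (forall w, 0 <= f w)%E ->
  (\int[mu x]_w f w = \sum_(n <oo) (n`!%:R^-1)%:E * \int[nu x n]_w f w)%E.
Proof.
move=> mf f0; rewrite ge0_integral_measure_series//.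
by apply: eq_eseriesr => n _; rewrite ge0_integral_mscale.
Qed.

(** [mu x] is carried by the paths issued from [x]. *)
Lemma mu_ext x (f g : T -> \bar R) :
  measurable_fun setT f -> measurable_fun setT g ->
  (forall w, 0 <= f w)%E -> (forall w, 0 <= g w)%E ->
  (forall w, init w = x -> f w = g w) ->
  (\int[mu x]_w f w = \int[mu x]_w g w)%E.
Proof.
move=> mf mg f0 g0 fg; rewrite !integral_mu//; apply: eq_eseriesr => n _.
by congr *%E; apply: nu_ext => // w wx _; exact: fg.
Qed.

Lemma measurable_size_fun d (V : measurableType d) (g : nat -> V) :
  measurable_fun setT (fun w : T => g (size (jumps w))).
Proof.
exact: (@measurable_by_size _ _ T _ _ id _ (fun n _ => g n)).
Qed.

(** The sum over the number of jumps is an exponential series.  All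
    integrability with respect to [mu x] comes from geometric bounds in the
    number of jumps. *)
Lemma integral_mu_expr x (C : R) : 0 <= C ->
  (\int[mu x]_w (C ^+ size (jumps w))%:E < +oo)%E.
Proof.
move=> C0; have mC := measurable_size_fun (fun n => (C ^+ n)%:E).
have c0 w : (0 <= (C ^+ size (jumps w))%:E)%E by rewrite lee_fin exprn_ge0.
rewrite integral_mu//.
rewrite (_ : limn _ = (limn (series (exp_coeff C)))%:E) ?ltry//.
rewrite -EFin_lim; last exact: is_cvg_series_exp_coeff.
apply/congr_lim/funext => n/=; rewrite /series/= -sumEFin/=.
apply: eq_bigr => i _.
rewrite (@nu_ext _ _ _ (cst (C ^+ i)%:E))//; [|by move=> w; rewrite lee_fin exprn_ge0|].
  by rewrite integral_cst//= probability_setT mule1 -EFinM mulrC.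
by move=> w _ ->.
Qed.

Lemma mu_setT x : (mu x setT < +oo)%E.
Proof.
have := integral_mu_expr x ler01.
under eq_integral do rewrite expr1n.
by rewrite integral_cst//= mul1e.
Qed.

Lemma mu_setT_gt0 x : (0 < mu x setT)%E.
Proof.
have : (\int[mu x]_w 1 = mu x setT)%E by rewrite integral_cst//= mul1e.
move=> <-; rewrite integral_mu//.
apply: (@lt_le_trans _ _ (\sum_(0 <= n < 1) ((n`!%:R : R)^-1)%:E * \int[nu x n]_w 1)%E).
  rewrite big_nat1 integral_cst//= fact0 invr1 mul1e mul1e.
  by rewrite diracT.
by apply: nneseries_lim_ge => n _; rewrite mule_ge0 ?lee_fin//; exact: integral_ge0.
Qed.

Let mu_fin x : fin_num_fun (mu x).
Proof.
move=> A mA; rewrite ge0_fin_numE//; apply: le_lt_trans (mu_setT x).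
by apply: le_measure => //; rewrite inE.
Qed.

HB.instance Definition _ x := Measure_isFinite.Build _ _ _ (mu x) (mu_fin x).

(** The factor [n] of [mecke_nu] turns 1/n! into 1/(n-1)!: summing over a jump of
    the path amounts to inserting an independent uniform one. *)
Lemma mecke x (h : R -> T -> \bar R) :
  measurable_fun setT (fun p : R * T => h p.1 p.2) -> (forall v w, 0 <= h v w)%E ->
  (\int[mu x]_w \sum_(v <- jumps w) h v w =
   \int[mu x]_w \int[unif]_v h v (ins v w))%E.
Proof.
move=> mh h0.
have mS : measurable_fun setT (fun w : T => \sum_(v <- jumps w) h v w)%E.
  exact: sum_jumps_measurable.
have S0 w : (0 <= \sum_(v <- jumps w) h v w)%E by exact: sume_ge0.
have mhins : measurable_fun setT (fun p : T * R => h p.2 (ins p.2 p.1)).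
  apply: (measurable_comp2 (a := snd) mh) => //.
  exact: (measurable_comp2 (a := snd) (b := fst) measurable_ins).
have mpsi : measurable_fun setT (fun w : T => \int[unif]_v h v (ins v w))%E.
  exact: (measurable_integral unif (f := fun w v => h v (ins v w))).
have psi0 w : (0 <= \int[unif]_v h v (ins v w))%E by exact: integral_ge0.
rewrite !integral_mu// nneseries_recl//; last first.
  by move=> n _; rewrite mule_ge0 ?lee_fin//; exact: integral_ge0.
rewrite mecke_nu// mul0e mule0 add0e -nneseries_addn; last first.
  by move=> n; rewrite mule_ge0 ?lee_fin//; exact: integral_ge0.
apply: eq_eseriesr => n _.
rewrite mecke_nu// addn1 muleA -EFinM; congr (_%:E * _)%E.
by rewrite factS natrM invfM mulrAC mulVf ?mul1r// pnatr_eq0.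
Qed.

End poisson.

(** * Primitives, and increments along the jumps of a path *)

Section calculus.
Context {R : realType}.
Local Notation leb := (@lebesgue_measure R).

Definition int_oc (f : R -> R) (a b : R) : R := \int[leb]_(v in `]a, b]) f v.

Lemma continuous_integrable_itv (f : R -> R) (a b : R) : continuous f ->
  leb.-integrable `[a, b] (EFin \o f).
Proof.
move=> cf; apply: continuous_compact_integrable; first exact: segment_compact.
exact: continuous_subspaceT.
Qed.

(** The lower limit [-1] makes [0] an interior point, so that the primitive has a
    two-sided derivative on the whole unit interval. *)
Definition prim (c : R -> R) (t : R) : R := \int[leb]_(v in `[- 1, t]) c v.

Lemma is_derive_prim (c : R -> R) (t : R) : continuous c -> - 1 < t ->
  is_derive t 1 (prim c) (c t).
Proof.
move=> cc t1; have tt1 : t < t + 1 by rewrite ltrDl.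
have [dp dpE] := continuous_FTC1_closed tt1
  (@continuous_integrable_itv c (- 1) (t + 1) cc) t1 (cc t).
rewrite derive1E in dpE; exact: (DeriveDef dp dpE).
Qed.

Lemma is_derive_continuous (f : R -> R) (t df : R) :
  is_derive t 1 f df -> {for t, continuous f}.
Proof.
by move=> [ex _]; apply/differentiable_continuous/derivable1_diffP.
Qed.

Lemma int_oc_derive (F f : R -> R) (a b : R) : a <= b ->
  (forall t, a <= t <= b -> is_derive t 1 F (f t)) -> {within `[a, b], continuous f} ->
  int_oc f a b = F b - F a.
Proof.
rewrite le_eqVlt => /predU1P[->|ab] dF cf.
  by rewrite /int_oc set_itvoc0 Rintegral_set0 subrr.
have dF' t : t \in `[a, b] -> is_derive t 1 F (f t).
  by rewrite in_itv/=; exact: dF.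
have cF t : t \in `[a, b] -> {for t, continuous F}.
  by move=> /dF'; exact: is_derive_continuous.
rewrite /int_oc Rintegral_itv_obnd_cbnd; last first.
  have fi : leb.-integrable `[a, b] (EFin \o f).
    by apply: continuous_compact_integrable => //; exact: segment_compact.
  by apply: (integrableS _ _ _ fi) => //; exact: subset_itv_oc_cc.
rewrite /Rintegral (@continuous_FTC2 _ f F)//.
- split.
  + by move=> t /subset_itv_oo_cc/dF' [].
  + apply: cvg_at_right_filter; apply: cF; by rewrite in_itv/= lexx ltW.
  + apply: cvg_at_left_filter; apply: cF; by rewrite in_itv/= lexx ltW.
- by move=> t /subset_itv_oo_cc/dF' [_ <-]; rewrite derive1E.
Qed.

Lemma int_oc_prim (c : R -> R) (a b : R) : continuous c -> - 1 < a -> a <= b ->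
  int_oc c a b = prim c b - prim c a.
Proof.
move=> cc a1 ab; apply: int_oc_derive => //; last exact: continuous_subspaceT.
by move=> t /andP[at_ _]; apply: is_derive_prim => //; exact: lt_le_trans at_.
Qed.

Lemma int_oc_add (f : R -> R) (a b c : R) : a <= b -> b <= c ->
  leb.-integrable `]a, c] (EFin \o f) ->
  int_oc f a c = int_oc f a b + int_oc f b c.
Proof.
move=> ab bc fi; have := @Rintegral_itvB _ f (BRight a) (BRight c) b fi.
rewrite !bnd_simp => /(_ ab bc) H; rewrite /int_oc.
by rewrite -H addrC subrK.
Qed.

Lemma eq_int_oc (f g : R -> R) (a b : R) : (forall v, a < v -> v <= b -> f v = g v) ->
  int_oc f a b = int_oc g a b.
Proof.
move=> fg; apply: eq_Rintegral => v /[!inE]/=; rewrite in_itv/= => /andP[].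
exact: fg.
Qed.

End calculus.

Section pathwise.
Context {R : realType}.
Notation T := (counting_path R).
Implicit Types (w : T) (s t u : R) (x : int).

(** A fundamental theorem of calculus for functions with finitely many jumps, in
    terms of the values [Y] and the left limits [Yl]: it is enough to know the
    increment between consecutive jumps.  Induction on the list of jumps. *)
Lemma increment_along_jumps (Y Yl : R -> R) (I : R -> R -> R) t js s :
  (forall a b c, s <= a -> a <= b -> b <= c -> c <= t -> I a c = I a b + I b c) ->
  I t t = 0 -> path <%R s js -> all (<= t) js -> s <= t ->
  (forall a b, s <= a -> a < b -> b <= t ->
     (forall u, u \in js -> ~~ (a < u < b)) -> Yl b - Y a = I a b) ->
  (forall r, s < r -> r <= t -> r \notin js -> Y r = Yl r) ->
  Y t - Y s = I s t + \sum_(u <- js) (Y u - Yl u).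
Proof.
move=> + It; elim: js s => [|u js IH] s ID /= + + st Iloc Ynj.
  move=> _ _; rewrite big_nil addr0.
  move: st; rewrite le_eqVlt => /predU1P[->|st]; first by rewrite subrr It.
  by rewrite -Iloc// Ynj.
move=> /andP[su ujs] /andP[ut jst].
have ujs' v : v \in js -> u < v.
  by move: ujs; rewrite (path_sortedE lt_trans) => /andP[/allP + _]; apply.
have := IH u _ ujs jst ut => IHu.
have HI : Yl u - Y s = I s u.
  apply: Iloc => // v; rewrite inE => /predU1P[->|/ujs' uv].
    by rewrite ltxx andbF.
  by rewrite negb_and -!leNgt (ltW uv) orbT.
rewrite big_cons (ID s u t (lexx _) (ltW su) ut (lexx _)) -HI.
suff -> : I u t = Y t - Y u - \sum_(j <- js) (Y j - Yl j) by lra.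
apply/esym/eqP; rewrite subr_eq; apply/eqP.
apply: IHu.
- by move=> a b c ua; apply: ID; rewrite (le_trans (ltW su)).
- move=> a b ua ab bt nj; apply: Iloc => //; first by rewrite (le_trans (ltW su)).
  move=> v; rewrite inE => /predU1P[->|/nj//].
  by rewrite negb_and -leNgt ua.
- move=> r ur rt rjs; apply: Ynj => //; first exact: lt_trans ur.
  by rewrite inE negb_or rjs gt_eqF.
Qed.

Lemma pathwise_increment w (Y Yl : R -> R) (I : R -> R -> R) s t :
  s <= t ->
  (forall a b c, s <= a -> a <= b -> b <= c -> c <= t -> I a c = I a b + I b c) ->
  (forall a b, s <= a -> a < b -> b <= t ->
     (forall u, u \in jumps w -> ~~ (a < u < b)) -> Yl b - Y a = I a b) ->
  I t t = 0 ->
  (forall r, r \notin jumps w -> Y r = Yl r) ->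
  Y t - Y s = I s t + \sum_(u <- jumps w | s < u <= t) (Y u - Yl u).
Proof.
move=> st ID Iloc I0 Ynj; rewrite -big_filter.
apply: increment_along_jumps => //.
- rewrite (path_sortedE lt_trans) sorted_filter ?jumps_sorted ?andbT//; last exact: lt_trans.
  by apply/allP => u; rewrite mem_filter => /andP[/andP[]].
- by apply/allP => u; rewrite mem_filter => /andP[/andP[]].
- move=> a b sa ab bt nj; apply: Iloc => // u uw.
  have := nj u; rewrite mem_filter uw andbT.
  have [//|au] := boolP (~~ (a < u)); first by rewrite negb_and => ->.
  have [//|ub] := boolP (~~ (u < b)); first by rewrite negb_and => ->; rewrite orbT.
  rewrite !negbK in au ub; rewrite (le_lt_trans sa au) (le_trans (ltW ub) bt).
  exact.
- move=> r sr rt; rewrite mem_filter sr rt /= => rw; exact: Ynj.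
Qed.

End pathwise.

(** * The density process of an intensity *)

Section tonelli_in.
Context (R : realType) d1 d2 (U : measurableType d1) (V : measurableType d2).
Local Open Scope ereal_scope.
Variables (D : set V) (mD : measurable D) (f : U -> V -> \bar R).
Hypotheses (mf : measurable_fun setT (fun p : U * V => f p.1 p.2))
  (f0 : forall x y, 0 <= f x y).

Let mfD : measurable_fun setT (fun p : U * V => (f p.1 \_ D) p.2).
Proof.
rewrite (_ : (fun _ => _) = (fun p : U * V => f p.1 p.2) \_ (setT `*` D)).
  by apply/(measurable_restrictT _ _).1; [exact: measurableX|exact: measurable_funTS].
apply/funext => -[x y]; rewrite /patch /= in_setX/= in_setT /=.
by case: ifPn.
Qed.

Lemma measurable_integral_in (m : {sigma_finite_measure set V -> \bar R}) :
  measurable_fun setT (fun x => \int[m]_(y in D) f x y).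
Proof.
under eq_fun do rewrite integral_mkcond.
apply: (measurable_integral m (f := fun x => f x \_ D)) => // x y.
by rewrite /patch; case: ifP.
Qed.

Lemma tonelli_in (m1 : {sigma_finite_measure set U -> \bar R})
    (m2 : {sigma_finite_measure set V -> \bar R}) :
  \int[m1]_x \int[m2]_(y in D) f x y = \int[m2]_(y in D) \int[m1]_x f x y.
Proof.
under eq_integral do rewrite integral_mkcond.
rewrite [RHS]integral_mkcond.
rewrite (tonelli m1 m2 (f := fun x => f x \_ D) mfD); last by move=> x y; rewrite /patch; case: ifP.
apply: eq_integral => y _; rewrite /patch; case: ifPn => // _.
by rewrite integral0.
Qed.

End tonelli_in.

Section time_integral.
Context (R : realType) d (U : measurableType d).
Local Notation leb := (@lebesgue_measure R).
Variables (f : U -> R -> \bar R) (s t : R).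
Hypotheses (mf : measurable_fun setT (fun p : U * R => f p.1 p.2))
  (f0 : forall x v, (0 <= f x v)%E).

Lemma measurable_time_integral :
  measurable_fun setT (fun x => \int[leb]_(v in `]s, t]) f x v)%E.
Proof.
have mD : measurable (`]s, t]%classic : set (measurableTypeR R)) by [].
exact: (@measurable_integral_in R _ _ U (measurableTypeR R) _ mD f mf f0 leb).
Qed.

Lemma tonelli_time (m : {sigma_finite_measure set U -> \bar R}) :
  (\int[m]_x \int[leb]_(v in `]s, t]) f x v =
   \int[leb]_(v in `]s, t]) \int[m]_x f x v)%E.
Proof.
have mD : measurable (`]s, t]%classic : set (measurableTypeR R)) by [].
exact: (@tonelli_in R _ _ U (measurableTypeR R) _ mD f mf f0 m leb).
Qed.

End time_integral.

(** Intensities are used on the whole real line here; they arise by continuation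
    from the unit interval. *)
Definition regular {R : realType} (l : R -> int -> R) (L : R) : Prop :=
  (forall z, continuous (l ^~ z)) /\ (forall t z, 0 < l t z <= L).

Section density.
Context {R : realType}.
Notation T := (counting_path R).
Local Notation leb := (@lebesgue_measure R).
Implicit Types (w : T) (s t u : R) (x : int).
Variables (l : R -> int -> R) (L : R).
Hypothesis rl : regular l L.

Let l_cont z : continuous (l ^~ z). Proof. by case: rl. Qed.
Let l_gt0 t z : 0 < l t z. Proof. by case: rl => _ /(_ t z)/andP[]. Qed.
Let l_le t z : l t z <= L. Proof. by case: rl => _ /(_ t z)/andP[]. Qed.
Let L_gt0 : 0 < L. Proof. exact: lt_le_trans (l_gt0 0 0) (l_le 0 0). Qed.

Lemma measurable_intensity_at d (U : measurableType d) (a : U -> R) (b : U -> int) :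
  measurable_fun setT a -> measurable_fun setT b ->
  measurable_fun setT (fun p => l (a p) (b p)).
Proof.
move=> ma mb.
apply: (@measurable_fun_switch _ _ _ _ b (fun z p => l (a p) z)) => // z.
exact: (measurableT_comp (continuous_measurable_fun (@l_cont z)) ma).
Qed.

Lemma measurable_intensity :
  measurable_fun setT (fun p : R * T => l p.1 (Xleft p.1 p.2)).
Proof. apply: measurable_intensity_at => //; exact: measurable_Xleft_joint. Qed.

Lemma measurable_intensity_path w :
  measurable_fun setT (fun v : R => l v (Xleft v w)).
Proof.
exact: (measurableT_comp measurable_intensity (pair2_measurable w)).
Qed.

Lemma bounded_integrable (f : R -> R) (a b M : R) : measurable_fun setT f ->
  (forall v, a < v -> v <= b -> `|f v| <= M) ->
  leb.-integrable `]a, b] (EFin \o f).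
Proof.
move=> mf fM; apply: measurable_bounded_integrable => //.
- by rewrite /= lebesgue_measure_itv/=; case: ifP => // _; rewrite -EFinD ltry.
- exact: measurable_funTS.
exists M; split; first exact: num_real.
move=> r Mr v /=; rewrite in_itv/= => /andP[av vb].
by rewrite (le_trans (fM _ av vb))// ltW.
Qed.

Lemma integrable_intensity w (a b : R) :
  leb.-integrable `]a, b] (EFin \o (fun v => l v (Xleft v w))).
Proof.
apply: (bounded_integrable (M := L)); first exact: measurable_intensity_path.
by move=> v _ _; rewrite ger0_norm// ltW.
Qed.

Definition cumul t w : R := \int[leb]_(v in `[0, t]) l v (Xleft v w).

Lemma cumul_oc t w : cumul t w = int_oc (fun v => l v (Xleft v w)) 0 t.
Proof.
rewrite /cumul /int_oc -Rintegral_itv_obnd_cbnd//; exact: integrable_intensity.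
Qed.

Lemma cumul_incr a b w : 0 <= a -> a <= b ->
  cumul b w = cumul a w + int_oc (fun v => l v (Xleft v w)) a b.
Proof.
move=> a0 ab; rewrite !cumul_oc; apply: int_oc_add => //; exact: integrable_intensity.
Qed.

Lemma cumul_ge0 t w : 0 <= cumul t w.
Proof. by apply: Rintegral_ge0 => v _; exact: ltW. Qed.

Lemma cumul0 w : cumul 0 w = 0.
Proof. by rewrite cumul_oc /int_oc set_itvoc0 Rintegral_set0. Qed.

Lemma int_oc_EFin s t w :
  (int_oc (fun v => l v (Xleft v w)) s t)%:E = (\int[leb]_(v in `]s, t]) (l v (Xleft v w))%:E)%E.
Proof.
rewrite /int_oc /Rintegral fineK//; apply: integrable_fin_num => //.
exact: integrable_intensity.
Qed.

Lemma int_oc_le s t w : s <= t -> int_oc (fun v => l v (Xleft v w)) s t <= L * (t - s).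
Proof.
move=> st; have -> : L * (t - s) = int_oc (cst L) s t.
  rewrite /int_oc Rintegral_cst//= lebesgue_measure_itv/= lte_fin.
  move: st; rewrite le_eqVlt => /predU1P[->|->//].
  by rewrite ltxx /= subrr mulr0.
apply: le_Rintegral => //; first exact: integrable_intensity.
by apply: (bounded_integrable (M := L)) => // v _ _; rewrite ger0_norm// ltW.
Qed.

Lemma cumul_le t w : 0 <= t -> cumul t w <= L * t.
Proof. by move=> t0; rewrite cumul_oc (le_trans (int_oc_le _ t0))// subr0. Qed.

Lemma measurable_cumul : measurable_fun setT (fun p : R * T => cumul p.1 p.2).
Proof.
rewrite (_ : (fun _ => _) = fine \o (fun p : R * T =>
    (\int[leb]_v (if (0%R < v)%R && (v <= p.1)%R then (l v (Xleft v p.2))%:E else 0))%E)).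
  apply: measurableT_comp => //.
  apply: (measurable_integral leb (f := fun (p : R * T) v =>
    if (0 < v) && (v <= p.1) then (l v (Xleft v p.2))%:E else 0%E)); last first.
    by move=> p v; case: ifP => // _; rewrite lee_fin ltW.
  apply: measurable_fun_ifT => //.
    apply: measurable_and; first exact: measurable_fun_ltr.
    apply: measurable_fun_ler => //.
    exact: (measurableT_comp measurable_fst measurable_fst).
  apply/measurable_EFinP.
  apply: (measurable_comp2 (h := fun v w => l v (Xleft v w))).
  - exact: measurable_intensity.
  - exact: measurable_snd.
  - exact: (measurableT_comp measurable_snd measurable_fst).
apply/funext => -[t w] /=; rewrite cumul_oc /int_oc /Rintegral integral_mkcond.
congr fine; apply: eq_integral => v _; rewrite /patch mem_setE in_itv/=.
by case: ifP.
Qed.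

Lemma cumul_eq t w w' : (forall s, s <= t -> Xleft s w = Xleft s w') ->
  cumul t w = cumul t w'.
Proof.
move=> ww'; rewrite !cumul_oc; apply: eq_int_oc => v _ /ww' -> //.
Qed.

Lemma Xleft_ins_le v w s : s <= v -> insertable v w ->
  Xleft s (ins v w) = Xleft s w.
Proof. by move=> sv vw; rewrite Xleft_ins// ltNge sv addr0. Qed.

(** The left limit in time of the density process [z]. *)
Definition zl t w : R :=
  (\prod_(u <- jumps w | u < t) l u (Xleft u w)) * expR (t - cumul t w).
(** The density, on the information up to time [t], of the counting process with
    intensity [l] with respect to the Poisson process of rate one. *)
Definition z t w : R :=
  (\prod_(u <- jumps w | u <= t) l u (Xleft u w)) * expR (t - cumul t w).

Lemma zE t w : z t w =
  (\prod_(u <- jumps w | u <= t) l u (Xleft u w)) * expR (t - cumul t w).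
Proof. by []. Qed.

Lemma zl_ge0 t w : 0 <= zl t w.
Proof. by rewrite mulr_ge0 ?expR_ge0// prodr_ge0// => u _; exact: ltW. Qed.

Lemma z_gt0 t w : 0 < z t w.
Proof. by rewrite mulr_gt0 ?expR_gt0// prodr_gt0// => u _. Qed.

Lemma z0 w : z 0 w = 1.
Proof.
rewrite /z cumul0 subrr expR0 mulr1 big_seq_cond big_pred0// => u.
apply/negbTE; rewrite negb_and; case: (boolP (u \in _)) => //= /jumps01/andP[u0 _].
by rewrite -ltNge.
Qed.

(** Together with [integral_mu_expr] this makes the density integrable. *)
Lemma prod_bound (P : pred R) w :
  \prod_(u <- jumps w | P u) l u (Xleft u w) <= (1 + L) ^+ size (jumps w).
Proof.
elim: (jumps w) => [|u js IH]; first by rewrite big_nil.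
rewrite big_cons /= exprS; case: ifP => _.
  apply: ler_pM => //; first exact: ltW.
    by rewrite prodr_ge0// => v _; exact: ltW.
  by rewrite (le_trans (l_le _ _))// lerDr.
apply: (le_trans IH); have L1 : 0 <= 1 + L by rewrite addr_ge0// ltW.
by apply: ler_peMl; [exact: exprn_ge0|rewrite lerDl ltW].
Qed.

Lemma expR_bound t w : t <= 1 -> expR (t - cumul t w) <= expR 1.
Proof.
by move=> t1; rewrite ler_expR lerBlDr (le_trans t1)// lerDl cumul_ge0.
Qed.

Lemma z_bound t w : t <= 1 -> z t w <= (1 + L) ^+ size (jumps w) * expR 1.
Proof.
move=> t1; apply: ler_pM; rewrite ?expR_ge0 ?prod_bound ?expR_bound//.
by rewrite prodr_ge0// => u _; exact: ltW.
Qed.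

Lemma zl_bound t w : t <= 1 -> zl t w <= (1 + L) ^+ size (jumps w) * expR 1.
Proof.
move=> t1; apply: ler_pM; rewrite ?expR_ge0 ?prod_bound ?expR_bound//.
by rewrite prodr_ge0// => u _; exact: ltW.
Qed.

Let measurable_zP (P : R -> R -> bool) :
  measurable_fun setT (fun p : R * R => P p.1 p.2) ->
  measurable_fun setT (fun p : R * T =>
   (\prod_(u <- jumps p.2 | P u p.1) l u (Xleft u p.2)) * expR (p.1 - cumul p.1 p.2)).
Proof.
move=> mP; apply: measurable_funM.
  under eq_fun do rewrite big_mkcond/=.
  apply: (@prod_jumps_measurable _ _ _ snd
    (fun u p => if P u p.1 then l u (Xleft u p.2) else 1)) => //.
  apply: measurable_fun_ifT => //.
    apply: (measurable_comp2 mP) => //.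
    exact: (measurableT_comp measurable_fst measurable_snd).
  apply: (measurable_comp2 (h := fun v w => l v (Xleft v w))).
  - exact: measurable_intensity.
  - exact: measurable_fst.
  - exact: (measurableT_comp measurable_snd measurable_snd).
apply: (measurableT_comp (@measurable_expR _)); apply: measurable_funB => //.
exact: measurable_cumul.
Qed.

Lemma measurable_zl : measurable_fun setT (fun p : R * T => zl p.1 p.2).
Proof. by apply: (measurable_zP (P := fun u t => u < t)); exact: measurable_fun_ltr. Qed.

Lemma measurable_z : measurable_fun setT (fun p : R * T => z p.1 p.2).
Proof. by apply: (measurable_zP (P := fun u t => u <= t)); exact: measurable_fun_ler. Qed.

(** [zl] is predictable: a jump at [v] is not seen just before [v]. *)
Lemma zl_ins v w : insertable v w -> zl v (ins v w) = zl v w.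
Proof.
move=> vw; rewrite /zl (cumul_eq (w' := w)); last first.
  by move=> s sv; exact: Xleft_ins_le.
rewrite (perm_big _ (perm_ins vw)) /= big_cons ltxx; congr (_ * _).
by apply: eq_bigr => u uv; rewrite Xleft_ins_le// ltW.
Qed.

Lemma z_zl t w : t \notin jumps w -> z t w = zl t w.
Proof.
move=> tw; rewrite /z /zl; congr (_ * _).
rewrite !(big_seq_cond (fun u => _ t)); apply: eq_bigl => u.
by case: (boolP (u \in jumps w)) => //= uw; rewrite lt_neqAle; case: eqP uw tw => // -> ->.
Qed.

(** Each jump multiplies the density by the intensity. *)
Lemma z_zl_jump t w : t \in jumps w -> z t w = zl t w * l t (Xleft t w).
Proof.
move=> tw; rewrite /z /zl mulrAC; congr (_ * _).
rewrite big_mkcond (bigD1_seq t)//= ?jumps_uniq// lexx mulrC; congr (_ * _).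
rewrite big_mkcond [RHS]big_mkcond; apply: eq_bigr => u _.
by rewrite lt_neqAle; case: (u != t).
Qed.

End density.

(** * The forward equation *)

Section forward.
Context {R : realType}.
Notation T := (counting_path R).
Local Notation leb := (@lebesgue_measure R).
Implicit Types (w : T) (s t u : R) (x : int).

(** For a predictable integrand, the jump inserted by the Mecke formula is not
    seen by the integrand: the Poisson process of rate one has compensator [t]. *)
Lemma mecke_predictable x s t (k : R -> T -> R) : 0 <= s -> t <= 1 ->
  measurable_fun setT (fun p : R * T => k p.1 p.2) -> (forall v w, 0 <= k v w) ->
  (forall v w, s < v -> insertable v w -> k v (ins v w) = k v w) ->
  (\int[mu x]_w \sum_(u <- jumps w | (s < u <= t)%R) (k u w)%:E =
   \int[mu x]_w \int[leb]_(v in `]s, t]) (k v w)%:E)%E.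
Proof.
move=> s0 t1 mk k0 kp.
pose h v w := if s < v <= t then (k v w)%:E else 0%E.
have mh : measurable_fun setT (fun p : R * T => h p.1 p.2).
  apply: measurable_fun_ifT => //; last exact/measurable_EFinP.
  apply: measurable_and; first exact: measurable_fun_ltr.
  exact: measurable_fun_ler.
have h0 v w : (0 <= h v w)%E by rewrite /h; case: ifP; rewrite ?lee_fin.
under eq_integral do rewrite big_mkcond/=.
rewrite (mecke x mh h0); apply: eq_integral => w _.
have mhw : measurable_fun setT (fun v : R => h v w).
  exact: (measurableT_comp mh (pair2_measurable w)).
rewrite (unif_insertable (w := w) (g := fun v => h v w)) //; last 2 first.
  by apply: (measurable_comp2 (a := id) mh) => //; exact: measurable_ins1.
  by move=> v vw; rewrite /h; case: ifP => // /andP[sv _]; rewrite kp.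
rewrite integral_unif//.
rewrite (_ : (`]s, t]%classic : set R) = `[0, 1]%classic `&` `]s, t]%classic); last first.
  apply/seteqP; split => v /=; rewrite !in_itv/=; last by case.
  move=> /andP[sv vt]; rewrite sv vt; split => //.
  by rewrite (le_trans s0 (ltW sv)) (le_trans vt).
rewrite integral_mkcondr; apply: eq_integral => v _.
by rewrite /h /patch mem_setE in_itv.
Qed.

Variables (l : R -> int -> R) (L : R).
Hypothesis rl : regular l L.
Let l_cont z : continuous (l ^~ z). Proof. by case: rl. Qed.
Let l_gt0 t z : 0 < l t z. Proof. by case: rl => _ /(_ t z)/andP[]. Qed.
Let l_le t z : l t z <= L. Proof. by case: rl => _ /(_ t z)/andP[]. Qed.
Let L_gt0 : 0 < L. Proof. exact: lt_le_trans (l_gt0 0 0) (l_le 0 0). Qed.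
Local Notation z := (z l).
Local Notation zl := (zl l).

Lemma Xleft_between w a b v : (forall u, u \in jumps w -> ~~ (a < u < b)) ->
  a < v -> v <= b -> Xleft v w = X a w.
Proof.
move=> nj av vb; rewrite /X /Xleft; congr (_ + Posz _); apply: eq_in_count => u uw.
apply/idP/idP => [uv|ua]; last exact: le_lt_trans av.
by have := nj _ uw; rewrite (lt_le_trans uv vb) andbT -leNgt.
Qed.

Lemma zl_between w a b v : 0 <= a -> (forall u, u \in jumps w -> ~~ (a < u < b)) ->
  a < v -> v <= b -> zl v w = z a w * expR ((v - a) - (prim (l ^~ (X a w)) v - prim (l ^~ (X a w)) a)).
Proof.
move=> a0 nj av vb; rewrite /zl /z.
rewrite (cumul_incr rl w a0 (ltW av)).
rewrite (eq_int_oc (g := l ^~ (X a w))); last first.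
  by move=> u au uv; rewrite (Xleft_between nj)// (le_trans uv).
rewrite int_oc_prim ?(ltW av)//; last by rewrite (lt_le_trans _ a0).
rewrite -mulrA -expRD; congr (_ * expR _); last by lra.
rewrite big_seq_cond [RHS]big_seq_cond; apply: eq_bigl => u.
case: (boolP (u \in jumps w)) => //= uw; apply/idP/idP => [uv|ua].
  by have := nj _ uw; rewrite (lt_le_trans uv vb) andbT -leNgt.
exact: le_lt_trans av.
Qed.

Lemma is_derive_scale_expR (K : R) (g : R -> R) (t dg : R) : is_derive t 1 g dg ->
  is_derive t 1 (fun v => K * expR (g v)) (K * (expR (g t) * dg)).
Proof.
move=> dgt; have dE := is_derive1_comp (is_derive_expR (g t)) dgt.
exact: (is_deriveZ K dE).
Qed.

Lemma integrable_zl w (f : int -> R) (g : R -> R) (M s t : R) : t <= 1 ->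
  measurable_fun setT g -> (forall v, s < v -> v <= t -> `|g v| <= M) ->
  leb.-integrable `]s, t] (EFin \o (fun v => zl v w * f (Xleft v w) * g v)).
Proof.
move=> t1 mg gM.
have mD : measurable_fun setT (fun v : R => zl v w * f (Xleft v w) * g v).
  have mX : measurable_fun setT (fun v : R => Xleft v w).
    exact: (measurableT_comp measurable_Xleft_joint (pair2_measurable w)).
  apply: measurable_funM => //; apply: measurable_funM.
  - exact: (measurableT_comp (measurable_zl rl) (pair2_measurable w)).
  - exact: (@measurable_int_fun _ _ _ _ _ f).
pose B := \sum_(n < (size (jumps w)).+1) `|f (init w + n%:Z)|.
apply: (bounded_integrable (M := (1 + L) ^+ size (jumps w) * expR 1 * B * M)) => //.
move=> v sv vt; rewrite (normrM (zl v w * _)) (normrM (zl v w)).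
apply: ler_pM => //; last exact: gM.
apply: ler_pM => //.
  by rewrite ger0_norm ?(zl_ge0 rl)// (zl_bound rl)// (le_trans vt).
have vsz : (count (fun s => s < v)%R (jumps w) < (size (jumps w)).+1)%N.
  by rewrite ltnS count_size.
by rewrite /B (bigD1 (Ordinal vsz))//= lerDl sumr_ge0.
Qed.

(** Between jumps [z] solves dz = z (1 - l) dt, and at a jump the pair
    [(z, X)] becomes [(z * l, X + 1)]; apply [pathwise_increment] to [z * f(X)]. *)
Lemma pathwise_forward w (f : int -> R) s t : 0 <= s -> s <= t -> t <= 1 ->
  z t w * f (X t w) - z s w * f (X s w) =
  int_oc (fun v => zl v w * f (Xleft v w) * (1 - l v (Xleft v w))) s t +
  \sum_(u <- jumps w | s < u <= t)
    (zl u w * l u (Xleft u w) * f (Xleft u w + 1) - zl u w * f (Xleft u w)).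
Proof.
move=> s0 st t1.
rewrite (@pathwise_increment _ w (fun t => z t w * f (X t w)) (fun t => zl t w * f (Xleft t w))
  (int_oc (fun v => zl v w * f (Xleft v w) * (1 - l v (Xleft v w)))))//.
- congr (_ + _); rewrite big_seq_cond [RHS]big_seq_cond.
  apply: eq_bigr => u /andP[uw _].
  by rewrite (z_zl_jump l uw) X_Xleft uw.
- move=> a b c sa ab bc ct; apply: int_oc_add => //.
  apply: (@integrable_zl w f (fun v => 1 - l v (Xleft v w)) (1 + L)).
  + exact: le_trans ct t1.
  + by apply: measurable_funB => //; exact: measurable_intensity_path rl _.
  + move=> v _ _.
    by rewrite (le_trans (ler_normB _ _))// normr1 lerD2l ger0_norm// ltW.
- move=> a b sa ab bt nj.
  have a0 : 0 <= a by exact: le_trans sa.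
  pose c := l ^~ (X a w).
  pose g v := (v - a) - (prim c v - prim c a).
  pose K := z a w * f (X a w).
  have dg v : a <= v <= b -> is_derive v 1 g (1 - c v).
    move=> /andP[av vb]; have dp : is_derive v 1 (prim c) (c v).
      by apply: is_derive_prim; [exact: l_cont|rewrite (lt_le_trans _ av)// (lt_le_trans _ a0)].
    rewrite (_ : 1 - c v = (1 - 0) - (c v - 0)); last by rewrite !subr0.
    by apply: is_deriveB.
  rewrite (eq_int_oc (g := fun v => K * (expR (g v) * (1 - c v)))); last first.
    move=> v av vb; rewrite (Xleft_between nj av vb) (zl_between a0 nj av vb).
    by rewrite -/c -/(g v) /K (mulrAC (z a w)) -[LHS]mulrA.
  have dG v : a <= v <= b ->
      is_derive v 1 (fun v => K * expR (g v)) (K * (expR (g v) * (1 - c v))).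
    by move=> avb; apply: is_derive_scale_expR; exact: dg.
  have ceg (v : R) : a <= v <= b -> expR (g r) @[r --> v] --> expR (g v).
    move=> avb; have cg : g r @[r --> v] --> g v := is_derive_continuous (dg _ avb).
    exact: (cvg_comp _ _ cg (@continuous_expR R (g v))).
  have cG : {within `[a, b], continuous (fun v => K * (expR (g v) * (1 - c v)))}.
    apply: continuous_in_subspaceT => v; rewrite inE/= in_itv/= => avb.
    exact: cvgM (cvg_cst _) (cvgM (ceg v avb) (cvgB (cvg_cst _) (@l_cont _ v))).
  have zlb : zl b w = z a w * expR (g b) := zl_between a0 nj ab (lexx b).
  have ga : g a = 0 by rewrite /g (subrr a) (subrr (prim c a)) subr0.
  have -> := int_oc_derive (ltW ab) dG cG.
  by rewrite ga expR0 mulr1 (Xleft_between nj ab (lexx b)) zlb mulrAC.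
- by rewrite /int_oc set_itvoc0 Rintegral_set0.
- by move=> r rw; rewrite (z_zl l rw) X_Xleft (negbTE rw) addr0.
Qed.

End forward.

#[global] Opaque z zl cumul.

Lemma ge0_integralD3 (R : realType) d (U : measurableType d)
    (m : {measure set U -> \bar R}) (a b c : U -> \bar R) :
  measurable_fun setT a -> measurable_fun setT b -> measurable_fun setT c ->
  (forall x, 0 <= a x)%E -> (forall x, 0 <= b x)%E -> (forall x, 0 <= c x)%E ->
  (\int[m]_x (a x + b x + c x) =
   \int[m]_x a x + \int[m]_x b x + \int[m]_x c x)%E.
Proof.
move=> ma mb mc a0 b0 c0; rewrite ge0_integralD//.
- by rewrite ge0_integralD.
- by move=> x _; exact: adde_ge0.
- exact: emeasurable_funD.
Qed.

Lemma adde_cancel (R : realType) (b a c d e : \bar R) : b \is a fin_num ->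
  (a + b + c = d + e + b -> a + c = d + e)%E.
Proof.
move=> bfin; rewrite addeAC => /(congr1 (fun y => y - b)%E).
by rewrite !addeK.
Qed.

Section forward_expectation.
Context {R : realType}.
Notation T := (counting_path R).
Local Notation leb := (@lebesgue_measure R).
Implicit Types (w : T) (s t u : R) (x : int).

Lemma mu_le x (f g : T -> \bar R) :
  measurable_fun setT f -> measurable_fun setT g ->
  (forall w, 0 <= f w)%E -> (forall w, 0 <= g w)%E ->
  (forall w, init w = x -> f w <= g w)%E ->
  (\int[mu x]_w f w <= \int[mu x]_w g w)%E.
Proof.
move=> mf mg f0 g0 fg.
pose f' w := if X 0 w == x then f w else 0%E.
have mf' : measurable_fun setT f'.
  apply: measurable_fun_ifT => //.
  exact: (@measurable_int_fun _ _ _ _ _ (fun y => y == x) (measurable_X 0)).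
rewrite (mu_ext (g := f'))//.
- apply: ge0_le_integral => // w _; first by rewrite /f'; case: ifP.
  by rewrite /f'; case: ifP => [/eqP|_]; rewrite ?X0_init//; exact: fg.
- by move=> w; rewrite /f'; case: ifP.
- by move=> w wx; rewrite /f' X0_init wx eqxx.
Qed.

Variables (l : R -> int -> R) (L : R).
Hypothesis rl : regular l L.
Let l_gt0 t z : 0 < l t z. Proof. by case: rl => _ /(_ t z)/andP[]. Qed.
Let l_le t z : l t z <= L. Proof. by case: rl => _ /(_ t z)/andP[]. Qed.
Let L_gt0 : 0 < L. Proof. exact: lt_le_trans (l_gt0 0 0) (l_le 0 0). Qed.
Local Notation z := (z l).
Local Notation zl := (zl l).

Section weight.
Variables (x : int) (s t M : R) (H : T -> R) (f : int -> R).
Hypotheses (s0 : 0 <= s) (st : s <= t) (t1 : t <= 1).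
Hypotheses (mH : measurable_fun setT H) (H0 : forall w, 0 <= H w)
  (M0 : 0 <= M)
  (Hb : forall w, init w = x -> H w <= M * 2 ^+ size (jumps w))
  (Hins : forall v w, s < v -> insertable v w -> H (ins v w) = H w).
Hypotheses (f0 : forall y, 0 <= f y) (fb : forall n, f (x + n%:Z) <= 2 ^+ n).

Let k1 v w := H w * (zl v w * f (Xleft v w)).
Let k2 v w := H w * (zl v w * l v (Xleft v w) * f (Xleft v w + 1)).
Let k3 v w := H w * (zl v w * f (Xleft v w) * l v (Xleft v w)).

Let zl0 v w : 0 <= zl v w. Proof. exact: zl_ge0 rl _ _. Qed.
Let k1_ge0 v w : 0 <= k1 v w. Proof. by rewrite /k1 mulr_ge0// mulr_ge0. Qed.
Let k2_ge0 v w : 0 <= k2 v w. Proof. by rewrite /k2 mulr_ge0// mulr_ge0// mulr_ge0// ltW. Qed.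
Let k3_ge0 v w : 0 <= k3 v w. Proof. by apply: mulr_ge0 => //; apply: mulr_ge0; [exact: mulr_ge0|exact: ltW]. Qed.

Let mHp : measurable_fun setT (fun p : R * T => H p.2).
Proof. exact: (measurableT_comp mH measurable_snd). Qed.

Let mk1 : measurable_fun setT (fun p : R * T => k1 p.1 p.2).
Proof.
apply: measurable_funM => //; apply: measurable_funM; first exact: (measurable_zl rl).
exact: (@measurable_int_fun _ _ _ _ _ (f) measurable_Xleft_joint).
Qed.

Let mk2 : measurable_fun setT (fun p : R * T => k2 p.1 p.2).
Proof.
apply: measurable_funM => //; apply: measurable_funM.
  apply: measurable_funM; first exact: (measurable_zl rl).
  exact: measurable_intensity rl.
exact: (@measurable_int_fun _ _ _ _ _ (fun y => f (y + 1)) measurable_Xleft_joint).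
Qed.

Let mk3 : measurable_fun setT (fun p : R * T => k3 p.1 p.2).
Proof.
apply: measurable_funM => //; apply: measurable_funM.
  apply: measurable_funM; first exact: (measurable_zl rl).
  exact: (@measurable_int_fun _ _ _ _ _ (f) measurable_Xleft_joint).
exact: measurable_intensity rl.
Qed.

Let S (k : R -> T -> R) w : \bar R :=
  (\sum_(u <- jumps w | (s < u <= t)%R) (k u w)%:E)%E.
Let J (k : R -> T -> R) w : \bar R := (\int[leb]_(v in `]s, t]) (k v w)%:E)%E.

Let mS (k : R -> T -> R) : measurable_fun setT (fun p : R * T => k p.1 p.2) ->
  measurable_fun setT (S k).
Proof.
move=> mk; rewrite /S; under eq_fun do rewrite big_mkcond/=.
apply: (@sum_jumps_measurable _ _ _ id
  (fun u w => if (s < u <= t)%R then (k u w)%:E else 0%E)) => //.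
apply: measurable_fun_ifT => //; last exact/measurable_EFinP.
by apply: measurable_and; [exact: measurable_fun_ltr|exact: measurable_fun_ler].
Qed.

Let S_ge0 (k : R -> T -> R) w : (forall v w, 0 <= k v w) -> (0 <= S k w)%E.
Proof. by move=> k0; apply: sume_ge0 => u _; rewrite lee_fin. Qed.

Let mJ (k : R -> T -> R) : measurable_fun setT (fun p : R * T => k p.1 p.2) ->
  (forall v w, 0 <= k v w) -> measurable_fun setT (J k).
Proof.
move=> mk k0; apply: (@measurable_time_integral _ _ _ (fun w v => (k v w)%:E)).
- apply/measurable_EFinP.
  exact: (measurable_comp2 (a := snd) (b := fst) mk).
- by move=> w v; rewrite lee_fin.
Qed.

Let J_ge0 (k : R -> T -> R) w : (forall v w, 0 <= k v w) -> (0 <= J k w)%E.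
Proof. by move=> k0; apply: integral_ge0 => v _; rewrite lee_fin. Qed.

Let J_EFin w (g : R -> R) (N : R) : measurable_fun setT g ->
  (forall v, 0 <= g v <= N) ->
  (\int[leb]_(v in `]s, t]) (H w * (zl v w * f (Xleft v w) * g v))%:E)%E =
  (H w * int_oc (fun v => (zl v w * f (Xleft v w)) * g v) s t)%:E.
Proof.
move=> mg g0.
have gi : leb.-integrable `]s, t] (EFin \o (fun v => zl v w * f (Xleft v w) * g v)).
  apply: (@integrable_zl _ _ _ rl w f g N) => // v _ _.
  by rewrite ger0_norm; have /andP[] := g0 v.
under eq_integral do rewrite EFinM.
rewrite integralZl// /int_oc EFinM; congr *%E.
by rewrite /Rintegral fineK//; exact: integrable_fin_num.
Qed.

Let pathwise w :
  ((H w * (z t w * f (X t w)))%:E + S k1 w + J k3 w =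
   (H w * (z s w * f (X s w)))%:E + S k2 w + J k1 w)%E.
Proof.
have mi := measurable_intensity_path rl w.
have E1 : J k1 w = (H w * int_oc (fun v => (zl v w * f (Xleft v w)) * cst 1 v) s t)%:E.
  rewrite -(@J_EFin w (cst 1) 1)//; last by move=> v; rewrite ler01 lexx.
  by apply: eq_integral => v _; rewrite mulr1.
have E3 : J k3 w = (H w * int_oc (fun v => (zl v w * f (Xleft v w)) *
    l v (Xleft v w)) s t)%:E.
  by rewrite -(@J_EFin w (fun v => l v (Xleft v w)) L)// => v; rewrite l_le ltW.
rewrite E1 E3 /S !sumEFin -!EFinD; congr EFin.
have := pathwise_forward rl w f s0 st t1.
have -> : int_oc (fun v => zl v w * f (Xleft v w) * (1 - l v (Xleft v w))) s t =
   int_oc (fun v => (zl v w * f (Xleft v w)) * cst 1 v) s t -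
   int_oc (fun v => (zl v w * f (Xleft v w)) * l v (Xleft v w)) s t.
  rewrite /int_oc -RintegralB//.
  - by apply: eq_Rintegral => v _; rewrite mulrBr.
  - by apply: (@integrable_zl _ _ _ rl w f (cst 1) 1) => // v _ _; rewrite normr1.
  - by apply: (@integrable_zl _ _ _ rl w f (fun v => l v (Xleft v w)) L) => // v _ _; rewrite ger0_norm// ltW.
rewrite sumrB -!mulr_sumr.
suff alg (h a b i1 i3 s1 s2 : R) : a - b = i1 - i3 + (s2 - s1) ->
    h * a + h * s1 + h * i3 = h * b + h * s2 + h * i1 by exact: alg.
by move=> E; have -> : a = b + (i1 - i3 + (s2 - s1)); [rewrite -E addrC subrK|ring].
Qed.

Let fin_J1 : (\int[mu x]_w J k1 w < +oo)%E.
Proof.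
pose C := 2 * (1 + L) * 2.
have C0 : 0 <= C by rewrite !mulr_ge0// addr_ge0// ltW.
apply: (@le_lt_trans _ _ (\int[mu x]_w (M * expR 1 * C ^+ size (jumps w))%:E)%E); last first.
  under eq_integral do rewrite EFinM.
  rewrite ge0_integralZl_EFin ?mulr_ge0 ?expR_ge0//.
  - by rewrite lte_mul_pinfty ?lee_fin ?mulr_ge0 ?expR_ge0// integral_mu_expr.
  - by move=> w _; rewrite lee_fin exprn_ge0.
  - exact: (measurable_size_fun (fun n => (C ^+ n)%:E)).
apply: mu_le.
- exact: mJ.
- exact: (measurable_size_fun (fun n => (M * expR 1 * C ^+ n)%:E)).
- by move=> w; exact: J_ge0.
- by move=> w; rewrite lee_fin mulr_ge0 ?mulr_ge0 ?expR_ge0// exprn_ge0.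
move=> w wx; rewrite /J.
apply: (@le_trans _ _ (\int[leb]_(v in `]s, t]) (M * expR 1 * C ^+ size (jumps w))%:E)%E).
  apply: ge0_le_integral => //.
  - by move=> v _; rewrite lee_fin.
  - apply/measurable_EFinP/measurable_funTS.
    exact: (measurableT_comp mk1 (pair2_measurable w)).
  move=> v /=; rewrite in_itv/= lee_fin => /andP[sv vt].
  rewrite /C !exprMn (mulrC M) -!mulrA (mulrC (expR 1)) -!mulrA.
  rewrite (mulrA M); apply: ler_pM => //; first exact: mulr_ge0.
    exact: Hb.
  rewrite (mulrC (2 ^+ _) (expR 1)) mulrA; apply: ler_pM => //.
    by rewrite (zl_bound rl)// (le_trans vt).
  by rewrite /Xleft wx (le_trans (fb _))// ler_weXn2l// ?ler1n// count_size.
rewrite integral_cst//= lebesgue_measure_itv/=.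
rewrite -[leRHS]mule1; apply: lee_pmul => //.
- by rewrite lee_fin mulr_ge0 ?mulr_ge0 ?expR_ge0// exprn_ge0.
- by case: ifP => // _; rewrite -EFinD lee_fin subr_ge0.
by case: ifP => // _; rewrite -EFinD lee_fin lerBlDr (le_trans t1)// lerDl.
Qed.

Lemma forward_finite :
  (\int[mu x]_w \int[leb]_(v in `]s, t])
     (H w * (zl v w * f (Xleft v w) * l v (Xleft v w)))%:E < +oo)%E.
Proof.
apply: (@le_lt_trans _ _ (L%:E * \int[mu x]_w J k1 w)%E); last first.
  by rewrite lte_mul_pinfty// lee_fin ltW.
rewrite -ge0_integralZl_EFin//; last 3 first.
- by move=> w _; exact: J_ge0.
- exact: mJ.
- exact: ltW.
apply: ge0_le_integral => //.
- by move=> w _; exact: (J_ge0 w k3_ge0).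
- exact: (mJ mk3 k3_ge0).
- by apply: measurable_funeM; exact: mJ.
move=> w _; have mw (k : R -> T -> R) : measurable_fun setT (fun p : R * T => k p.1 p.2) ->
    measurable_fun (`]s, t]%classic : set (measurableTypeR R)) (fun v => (k v w)%:E).
  move=> mk; apply/measurable_EFinP/measurable_funTS.
  exact: (measurableT_comp mk (pair2_measurable w)).
rewrite /J -ge0_integralZl_EFin//; last 3 first.
- by move=> v _; rewrite lee_fin.
- exact: mw.
- exact: ltW.
apply: ge0_le_integral => //.
- by move=> v _; rewrite lee_fin; exact: k3_ge0.
- exact: (mw _ mk3).
- by apply: measurable_funeM; exact: mw.
move=> v _; rewrite -EFinM lee_fin.
have -> : L * k1 v w = H w * (zl v w * f (Xleft v w) * L).
  by rewrite /k1 mulrC -[LHS]mulrA.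
apply: ler_wpM2l => //.
by apply: ler_wpM2l => //; exact: mulr_ge0.
Qed.

(** Taking expectations in [pathwise_forward], the sums over jumps become time
    integrals by [mecke_predictable] and the terms without the factor [l]
    cancel.  The remaining negative term is moved to the left, so that only
    nonnegative integrals occur. *)
Lemma forward_equation :
  (\int[mu x]_w (H w * (z t w * f (X t w)))%:E +
   \int[mu x]_w \int[leb]_(v in `]s, t])
     (H w * (zl v w * f (Xleft v w) * l v (Xleft v w)))%:E =
   \int[mu x]_w (H w * (z s w * f (X s w)))%:E +
   \int[mu x]_w \int[leb]_(v in `]s, t])
     (H w * (zl v w * l v (Xleft v w) * f (Xleft v w + 1)))%:E)%E.
Proof.
have mHz r : measurable_fun setT (fun w => (H w * (z r w * f (X r w)))%:E).
  apply/measurable_EFinP; apply: measurable_funM => //; apply: measurable_funM.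
    exact: (measurableT_comp (measurable_z rl) (pair1_measurable r)).
  exact: (@measurable_int_fun _ _ _ _ _ (f) (measurable_X r)).
have Hz0 r w : (0 <= (H w * (z r w * f (X r w)))%:E)%E.
  by rewrite lee_fin mulr_ge0// mulr_ge0// ltW// (z_gt0 rl).
have : (\int[mu x]_w ((H w * (z t w * f (X t w)))%:E + S k1 w + J k3 w) =
    \int[mu x]_w ((H w * (z s w * f (X s w)))%:E + S k2 w + J k1 w))%E.
  by apply: eq_integral => w _; exact: pathwise.
have -> := ge0_integralD3 (mu x) (mHz t) (mS mk1) (mJ mk3 k3_ge0) (Hz0 t)
  (fun w => S_ge0 w k1_ge0) (fun w => J_ge0 w k3_ge0).
have -> := ge0_integralD3 (mu x) (mHz s) (mS mk2) (mJ mk1 k1_ge0) (Hz0 s)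
  (fun w => S_ge0 w k2_ge0) (fun w => J_ge0 w k1_ge0).
rewrite (mecke_predictable x s0 t1 mk1 k1_ge0); last first.
  by move=> v w sv vw; rewrite /k1 Hins// (zl_ins rl)// Xleft_ins_le.
rewrite (mecke_predictable x s0 t1 mk2 k2_ge0); last first.
  by move=> v w sv vw; rewrite /k2 Hins// (zl_ins rl)// Xleft_ins_le.
have J1fin : (\int[mu x]_w J k1 w)%E \is a fin_num.
  by rewrite ge0_fin_numE//; apply: integral_ge0 => w _; exact: J_ge0.
exact: (adde_cancel J1fin).
Qed.

End weight.

End forward_expectation.

(** * Existence: the Poisson measure with density solves the compensator problem *)

Section weighted_measure.
Local Open Scope ereal_scope.
Context d (T : measurableType d) (R : realType) (m : {measure set T -> \bar R}).
Variable f : T -> R.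
Hypotheses (mf : measurable_fun setT f) (f0 : forall x, (0 <= f x)%R).

(** The measure of density [f] with respect to [m]. *)
Definition weighted (mf : measurable_fun setT f) (f0 : forall x, (0 <= f x)%R) :
  set T -> \bar R := fun A => \int[m]_(x in A) (f x)%:E.

Let weighted0 : weighted mf f0 set0 = 0.
Proof. by rewrite /weighted integral_set0. Qed.

Let weighted_ge0 A : 0 <= weighted mf f0 A.
Proof. by apply: integral_ge0 => x _; rewrite lee_fin. Qed.

Let weighted_sigma_additive : semi_sigma_additive (weighted mf f0).
Proof.
move=> /= F mF tF mUF; rewrite /weighted; apply: cvg_toP.
  apply: ereal_nondecreasing_is_cvgn => i j ij.
  by apply: lee_sum_nneg_natr => // k _ _; exact: weighted_ge0.
rewrite ge0_integral_bigcup//=.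
- by apply: measurable_funTS; exact/measurable_EFinP.
- by move=> x _; rewrite lee_fin.
Qed.

HB.instance Definition _ := isMeasure.Build _ _ _ (weighted mf f0)
  weighted0 weighted_ge0 weighted_sigma_additive.

Local Notation wm := (weighted mf f0).

Let integral_weighted_indic E : measurable E ->
  \int[wm]_x (\1_E x)%:E = \int[m]_x ((\1_E x)%:E * (f x)%:E).
Proof.
move=> mE; rewrite integral_indic//= setIT /weighted [LHS]integral_mkcond.
apply: eq_integral => x _; rewrite patchE indicE.
by case: ifP; rewrite ?mul1e ?mul0e.
Qed.

Import HBNNSimple.

Let integral_weighted_nnsfun (h : {nnsfun T >-> R}) :
  \int[wm]_x (h x)%:E = \int[m]_x ((h x)%:E * (f x)%:E).
Proof.
under [LHS]eq_integral do rewrite fimfunE -fsumEFin//.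
rewrite [LHS]ge0_integral_fsum//; last 2 first.
  - by move=> r; exact/measurable_EFinP/measurableT_comp.
  - by move=> n x _; rewrite EFinM nnfun_muleindic_ge0.
under [RHS]eq_integral.
  move=> x xD; rewrite fimfunE -fsumEFin// muleC ge0_mule_fsumr; last first.
    by move=> r; rewrite EFinM nnfun_muleindic_ge0.
  over.
rewrite [RHS]ge0_integral_fsum//; last 2 first.
  - move=> r; apply: emeasurable_funM; first exact/measurable_EFinP.
    by apply/measurable_EFinP; apply/measurableT_comp => //.
  - by move=> n x _; apply: mule_ge0; [rewrite lee_fin|rewrite EFinM nnfun_muleindic_ge0].
apply: eq_fsbigr => r _.
under [RHS]eq_integral do rewrite EFinM muleCA (muleC (f _)%:E).
have mpre : measurable (h @^-1` [set r]) by exact: measurable_funPTI.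
have [r0|r0] := leP 0%R r; last first.
  rewrite (_ : h @^-1` [set r] = set0); last exact: preimage_nnfun0.
  by rewrite !integral0_eq// => x _; rewrite indic0 ?mulr0 ?mul0e ?mule0.
rewrite ge0_integralZl_EFin//; last 2 first.
- by move=> x _; rewrite mule_ge0// lee_fin.
- by apply: emeasurable_funM; exact/measurable_EFinP.
rewrite -integral_weighted_indic// -ge0_integralZl_EFin//.
exact/measurable_EFinP/measurable_indic.
Qed.

Lemma integral_weighted (g : T -> \bar R) : measurable_fun setT g ->
  (forall x, 0 <= g x) ->
  \int[wm]_x g x = \int[m]_x (g x * (f x)%:E).
Proof.
move=> mg g0; pose g_ := nnsfun_approx measurableT mg.
have gE x : limn (EFin \o g_^~ x) = g x.
  by apply/cvg_lim => //; exact: cvg_nnsfun_approx.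
transitivity (limn (fun n => \int[wm]_x (g_ n x)%:E)).
  rewrite -monotone_convergence//=.
  - by apply: eq_integral => x _; rewrite -gE.
  - by move=> n; exact/measurable_EFinP/measurable_funTS.
  - by move=> n x _; rewrite lee_fin.
  - by move=> x _ i j ij; rewrite lee_fin; exact/lefP/nd_nnsfun_approx.
transitivity (limn (fun n => \int[m]_x ((g_ n x)%:E * (f x)%:E))).
  by apply: congr_lim; apply/funext => n; exact: integral_weighted_nnsfun.
rewrite -monotone_convergence//=.
- apply: eq_integral => x _; apply/cvg_lim => //.
  by apply: cvgeZr => //; exact: cvg_nnsfun_approx.
- by move=> n; apply: emeasurable_funM; exact/measurable_EFinP.
- by move=> n x _; rewrite mule_ge0// lee_fin.
- move=> x _ i j ij; apply: lee_wpmul2r; rewrite ?lee_fin//.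
  exact/lefP/nd_nnsfun_approx.
Qed.

End weighted_measure.

Lemma adde_cancelr (R : realType) (a b c : \bar R) :
  (0 <= c -> c < +oo -> a + c = b + c -> a = b)%E.
Proof.
move=> c0 coo; have cfin : c \is a fin_num by rewrite ge0_fin_numE.
by move=> /(congr1 (fun y => y - c)%E); rewrite !addeK.
Qed.

Section existence.
Context {R : realType}.
Notation T := (counting_path R).
Local Notation leb := (@lebesgue_measure R).
Implicit Types (w : T) (s t u : R) (x : int).
Variables (l : R -> int -> R) (L : R).
Hypothesis rl : regular l L.
Let l_gt0 t z : 0 < l t z. Proof. by case: rl => _ /(_ t z)/andP[]. Qed.
Let l_le t z : l t z <= L. Proof. by case: rl => _ /(_ t z)/andP[]. Qed.
Let L_gt0 : 0 < L. Proof. exact: lt_le_trans (l_gt0 0 0) (l_le 0 0). Qed.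
Local Notation z := (z l).
Local Notation zl := (zl l).

(** Nonnegative functions of the path up to time [s], seen as the functions which
    ignore later insertions, with a growth that [mu x] integrates. *)
Definition weight x s (H : T -> R) : Prop :=
  [/\ measurable_fun setT H, forall w, 0 <= H w,
      exists2 M, 0 <= M & forall w, init w = x -> H w <= M * 2 ^+ size (jumps w)
    & forall v w, s < v -> insertable v w -> H (ins v w) = H w].

Lemma weight_homo x s t H : s <= t -> weight x s H -> weight x t H.
Proof.
move=> st [mH H0 Hb Hins]; split => // v w tv; apply: Hins; exact: le_lt_trans tv.
Qed.

Lemma weight_indic x s A : s <= 1 -> canonical_filtration s A -> weight x s (\1_A).
Proof.
move=> s1 sA; split.
- exact: measurable_indic (filtration_measurable s1 sA).
- by move=> w; rewrite indicE.
- exists 1 => // w _; apply: (@le_trans _ _ 1).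
    by rewrite indicE; case: (w \in A).
  by rewrite mul1r exprn_ege1// ler1n.
- move=> v w sv vw; rewrite !indicE; congr (nat_of_bool _)%:R.
  by apply/idP/idP; rewrite !inE => /(filtration_ins w sA sv).
Qed.

Lemma weightM x s H (K : T -> R) : weight x s H -> measurable_fun setT K ->
  (forall w, 0 <= K w) ->
  (exists2 M, 0 <= M & forall w, init w = x -> H w * K w <= M * 2 ^+ size (jumps w)) ->
  (forall v w, s < v -> insertable v w -> K (ins v w) = K w) ->
  weight x s (fun w => H w * K w).
Proof.
move=> [mH H0 Hb Hins] mK K0 HKb Kins; split => //.
- exact: measurable_funM.
- by move=> w; exact: mulr_ge0.
- by move=> v w sv vw; rewrite Hins// Kins.
Qed.

Lemma measurable_z_at t : measurable_fun setT (z t).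
Proof. exact: (measurableT_comp (measurable_z rl) (pair1_measurable t)). Qed.

(** The forward equation for the constant function one: gain and loss terms
    coincide and are finite. *)
Lemma z_martingale x s H : 0 <= s -> s <= 1 -> weight x s H ->
  (\int[mu x]_w (H w * z 1 w)%:E = \int[mu x]_w (H w * z s w)%:E)%E.
Proof.
move=> s0 s1 [mH H0 [M M0 Hb] Hins].
have f0 y : 0 <= (cst 1 : int -> R) y by [].
have fb n : (cst 1 : int -> R) (x + n%:Z) <= 2 ^+ n by rewrite exprn_ege1// ler1n.
have E := @forward_equation R l L rl x s 1 M H (cst 1) s0 s1 (lexx 1) mH H0 M0 Hb Hins f0 fb.
have F := @forward_finite R l L rl x s 1 M H (cst 1) s0 s1 (lexx 1) mH H0 M0 Hb f0 fb.
have E' : (\int[mu x]_w \int[leb]_(v in `]s, 1%R])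
     (H w * (zl v w * l v (Xleft v w) * cst 1 (Xleft v w + 1)))%:E =
   \int[mu x]_w \int[leb]_(v in `]s, 1%R])
     (H w * (zl v w * cst 1 (Xleft v w) * l v (Xleft v w)))%:E)%E.
  apply: eq_integral => w _; apply: eq_integral => v _.
  by congr (_ * _)%:E; rewrite mulrAC.
rewrite E' in E.
have toz r : (\int[mu x]_w (H w * (z r w * cst 1 (X r w)))%:E =
    \int[mu x]_w (H w * z r w)%:E)%E.
  by apply: eq_integral => w _; congr (_ * _)%:E; exact: mulr1.
apply: (etrans (esym (toz 1))); apply: (etrans _ (toz s)).
apply: (adde_cancelr _ F E).
apply: integral_ge0 => w _; apply: integral_ge0 => v _.
rewrite lee_fin; apply: mulr_ge0; first exact: H0.
apply: mulr_ge0; last exact: (ltW (l_gt0 _ _)).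
by apply: mulr_ge0; [exact: (zl_ge0 rl)|exact: ler01].
Qed.

Definition incr r w : R := (X r w - init w)%:~R.

Lemma incr_count r w : incr r w = (count (fun s => s <= r) (jumps w))%:R.
Proof. by rewrite /incr /X addrAC subrr add0r. Qed.

Lemma measurable_X_diff s t :
  measurable_fun setT (fun w : T => (X t w - X s w)%:~R : R).
Proof.
by move=> _ B _; rewrite setTI; exact: (measurable_X_incr s t [set y | B y%:~R]).
Qed.

Lemma measurable_incr r : measurable_fun setT (incr r).
Proof.
rewrite (_ : incr r = fun w => (X r w - X 0 w)%:~R).
  exact: measurable_X_diff.
by apply/funext => w; rewrite X0_init.
Qed.

Lemma natr_le_expr2 n : n%:R <= 2 ^+ n :> R.
Proof. by rewrite -natrX ler_nat ltnW// ltn_expl. Qed.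

Lemma incr_ge0 r w : 0 <= incr r w. Proof. by rewrite incr_count. Qed.

Lemma incr_le r w : incr r w <= 2 ^+ size (jumps w).
Proof.
by rewrite incr_count (le_trans _ (natr_le_expr2 _))// ler_nat count_size.
Qed.

Lemma weight_incr x s r A : s <= r -> r <= 1 -> canonical_filtration s A ->
  weight x r (fun w => \1_A w * incr r w).
Proof.
move=> sr r1 sA; have s1 := le_trans sr r1.
apply: weightM.
- exact: weight_homo sr (weight_indic x s1 sA).
- exact: measurable_incr.
- exact: incr_ge0.
- exists 1 => // w _; rewrite mul1r (le_trans _ (incr_le r w))//.
  by rewrite ler_piMl ?incr_ge0// indicE; case: (_ \in _).
- by move=> v w rv vw; rewrite /incr init_ins X_ins// leNgt rv addr0.
Qed.

(** Equal to the number of jumps made, on paths issued from [x], and defined on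
    all integers so as to serve as a test function of the forward equation. *)
Definition dist x (y : int) : R := `|(y - x)%:~R|.

Lemma dist_incr x r w : init w = x -> dist x (X r w) = incr r w.
Proof. by move=> <-; rewrite /dist -/(incr r w) ger0_norm// incr_ge0. Qed.

Lemma dist_Xleft1 x v w : init w = x -> dist x (Xleft v w + 1) = dist x (Xleft v w) + 1.
Proof.
move=> <-; rewrite /dist; pose n := count (fun s => s < v)%R (jumps w).
have -> : Xleft v w + 1 - init w = n.+1%:Z.
  by rewrite /Xleft -/n addrAC (addrAC (init w)) subrr add0r -addn1 PoszD.
have -> : Xleft v w - init w = n%:Z by rewrite /Xleft addrAC subrr add0r.
by rewrite -!pmulrn !ger0_norm ?ler0n// -natr1.
Qed.

Lemma measurable_wzl s A : canonical_filtration s A -> s <= 1 ->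
  measurable_fun setT (fun p : R * T => \1_A p.2 * (zl p.1 p.2 * l p.1 (Xleft p.1 p.2))).
Proof.
move=> sA s1; apply: measurable_funM.
  have mA : measurable_fun setT (\1_A : T -> R).
    exact: measurable_indic (filtration_measurable s1 sA).
  exact: (measurableT_comp mA measurable_snd).
apply: measurable_funM; first exact: measurable_zl rl.
exact: measurable_intensity rl.
Qed.

(** The forward equation for the number of jumps: the gain term exceeds the loss
    term by exactly one unit of intensity. *)
Lemma forward_incr x s t A : 0 <= s -> s <= t -> t <= 1 ->
  canonical_filtration s A ->
  (\int[mu x]_w (\1_A w * incr t w * z t w)%:E =
   \int[mu x]_w (\1_A w * incr s w * z s w)%:E +
   \int[mu x]_w \int[leb]_(v in `]s, t])
     (\1_A w * (zl v w * l v (Xleft v w)))%:E)%E.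
Proof.
move=> s0 st t1 sA; have s1 := le_trans st t1.
have [mH H0 [M M0 Hb] Hins] := weight_indic x s1 sA.
have f0 y : 0 <= dist x y by exact: normr_ge0.
have fb n : dist x (x + n%:Z) <= 2 ^+ n.
  by rewrite /dist addrAC subrr add0r ger0_norm ?ler0n// natr_le_expr2.
have E := forward_equation rl s0 st t1 mH H0 M0 Hb Hins f0 fb.
have F := forward_finite rl s0 st t1 mH H0 M0 Hb f0 fb.
have toH r : (\int[mu x]_w (\1_A w * (z r w * dist x (X r w)))%:E =
    \int[mu x]_w (\1_A w * incr r w * z r w)%:E)%E.
  apply: mu_ext.
  - apply/measurable_EFinP; apply: measurable_funM => //; apply: measurable_funM.
      exact: measurable_z_at.
    exact: (@measurable_int_fun _ _ _ _ _ (dist x) (measurable_X r)).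
  - apply/measurable_EFinP; apply: measurable_funM; last exact: measurable_z_at.
    by apply: measurable_funM => //; exact: measurable_incr.
  - move=> w; rewrite lee_fin; apply: mulr_ge0; first exact: H0.
    by apply: mulr_ge0; [exact: ltW (z_gt0 rl _ _)|exact: f0].
  - move=> w; rewrite lee_fin; apply: mulr_ge0; last exact: ltW (z_gt0 rl _ _).
    by apply: mulr_ge0; [exact: H0|exact: incr_ge0].
  by move=> w wx; rewrite dist_incr// (mulrC (z r w)) mulrA.
rewrite !toH in E; apply: (adde_cancelr _ F).
  apply: integral_ge0 => w _; apply: integral_ge0 => v _.
  rewrite lee_fin; apply: mulr_ge0; first exact: H0.
  apply: mulr_ge0; last exact: (ltW (l_gt0 _ _)).
  by apply: mulr_ge0; [exact: (zl_ge0 rl)|exact: f0].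
apply: (etrans E); apply: (etrans _ (addeA _ _ _)).
apply: (congr1 (fun y => _ + y)%E).
have mD : measurable_fun setT (fun v : R * T => dist x (Xleft v.1 v.2)).
  exact: (@measurable_int_fun _ _ _ _ _ (dist x) measurable_Xleft_joint).
have mD1 : measurable_fun setT (fun v : R * T => dist x (Xleft v.1 v.2 + 1)).
  exact: (@measurable_int_fun _ _ _ _ _ (fun y => dist x (y + 1)) measurable_Xleft_joint).
have mA : measurable_fun setT (fun p : R * T => \1_A p.2 : R).
  exact: (measurableT_comp mH measurable_snd).
pose g1 v w := \1_A w * (zl v w * l v (Xleft v w) * dist x (Xleft v w + 1)).
pose g2 v w := \1_A w * (zl v w * l v (Xleft v w)).
pose g3 v w := \1_A w * (zl v w * dist x (Xleft v w) * l v (Xleft v w)).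
have mg1 : measurable_fun setT (fun p : R * T => g1 p.1 p.2).
  apply: measurable_funM => //; apply: measurable_funM => //; apply: measurable_funM.
    exact: measurable_zl rl.
  exact: measurable_intensity rl.
have mg2 : measurable_fun setT (fun p : R * T => g2 p.1 p.2).
  apply: measurable_funM => //; apply: measurable_funM; first exact: measurable_zl rl.
  exact: measurable_intensity rl.
have mg3 : measurable_fun setT (fun p : R * T => g3 p.1 p.2).
  apply: measurable_funM => //; apply: measurable_funM; last exact: measurable_intensity rl.
  by apply: measurable_funM => //; exact: measurable_zl rl.
have zlp v w : 0 <= zl v w * l v (Xleft v w).
  by apply: mulr_ge0; [exact: (zl_ge0 rl)|exact: ltW (l_gt0 _ _)].
have g10 v w : 0 <= g1 v w.
  by apply: mulr_ge0; [exact: H0|apply: mulr_ge0; [exact: zlp|exact: f0]].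
have g20 v w : 0 <= g2 v w by apply: mulr_ge0; [exact: H0|exact: zlp].
have g30 v w : 0 <= g3 v w.
  apply: mulr_ge0; first exact: H0.
  apply: mulr_ge0; last exact: ltW (l_gt0 _ _).
  by apply: mulr_ge0; [exact: (zl_ge0 rl)|exact: f0].
have mJ (g : R -> T -> R) : measurable_fun setT (fun p : R * T => g p.1 p.2) ->
    (forall v w, 0 <= g v w) ->
    measurable_fun setT (fun w => \int[leb]_(v in `]s, t]) (g v w)%:E)%E.
  move=> mg g0; apply: (@measurable_time_integral _ _ _ (fun w v => (g v w)%:E)).
    by apply/measurable_EFinP; exact: (measurable_comp2 (a := snd) (b := fst) mg).
  by move=> w v; rewrite lee_fin.
have J0 (g : R -> T -> R) w : (forall v w, 0 <= g v w) ->
    (0 <= \int[leb]_(v in `]s, t]) (g v w)%:E)%E.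
  by move=> g0; apply: integral_ge0 => v _; rewrite lee_fin.
have mgw (g : R -> T -> R) w : measurable_fun setT (fun p : R * T => g p.1 p.2) ->
    measurable_fun (`]s, t]%classic : set (measurableTypeR R)) (fun v => (g v w)%:E).
  move=> mg; apply/measurable_EFinP/measurable_funTS.
  exact: (measurableT_comp mg (pair2_measurable w)).
transitivity (\int[mu x]_w (\int[leb]_(v in `]s, t]) (g2 v w)%:E +
    \int[leb]_(v in `]s, t]) (g3 v w)%:E))%E; last first.
  apply: ge0_integralD.
  - exact: measurableT.
  - by move=> w _; exact: (J0 g2 w g20).
  - exact: (mJ g2 mg2 g20).
  - by move=> w _; exact: (J0 g3 w g30).
  - exact: (mJ g3 mg3 g30).
apply: mu_ext.
- exact: (mJ g1 mg1 g10).
- by apply: emeasurable_funD; [exact: (mJ g2 mg2 g20)|exact: (mJ g3 mg3 g30)].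
- by move=> w; exact: (J0 g1 w g10).
- by move=> w; apply: adde_ge0; [exact: (J0 g2 w g20)|exact: (J0 g3 w g30)].
move=> w wx; apply: (etrans _ (ge0_integralD leb _ _ (mgw g2 w mg2) _ (mgw g3 w mg3))); last 3 first.
- by [].
- by move=> v _; rewrite lee_fin; exact: g20.
- by move=> v _; rewrite lee_fin; exact: g30.
apply: eq_integral => v _; rewrite -EFinD; congr EFin.
rewrite /g1 /g2 /g3 dist_Xleft1//.
suff alg (h a b c : R) : h * (a * b * (c + 1)) = h * (a * b) + h * (a * c * b) by exact: alg.
by ring.
Qed.

End existence.

Section law.
Context {R : realType}.
Notation T := (counting_path R).
Local Notation leb := (@lebesgue_measure R).
Implicit Types (w : T) (s t u : R) (x : int).

Lemma integral_indicM d (U : measurableType d) (m : {measure set U -> \bar R}) (A : set U) (g : U -> R) :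
  (\int[m]_(w in A) (g w)%:E = \int[m]_w (\1_A w * g w)%:E)%E.
Proof.
rewrite integral_mkcond; apply: eq_integral => w _; rewrite patchE indicE.
by case: ifP => _; rewrite ?mul1r ?mul0r.
Qed.

(** A path has finitely many jumps, so left limits may replace values under a
    time integral. *)
Lemma ae_eq_off_jumps w (f g : R -> \bar R) a b :
  measurable_fun setT f -> measurable_fun setT g ->
  (forall v, 0 <= f v)%E -> (forall v, 0 <= g v)%E ->
  (forall u, u \notin jumps w -> f u = g u) ->
  (\int[leb]_(v in `]a, b]) f v = \int[leb]_(v in `]a, b]) g v)%E.
Proof.
move=> mf mg f0 g0 fg.
apply: ge0_ae_eq_integral => //.
- exact: measurable_funTS.
- exact: measurable_funTS.
have cN : countable [set` jumps w] by apply/finite_set_countable/finite_seqP; exists (jumps w).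
exists [set` jumps w]; split.
- exact: countable_measurable.
- exact: countable_lebesgue_measure0.
move=> u /= /not_implyP[_ nfg]; apply/negPn/negP => uw; apply: nfg; exact: fg.
Qed.

Lemma mnormalizeE d (U : measurableType d) (m : {measure set U -> \bar R})
    (P : probability U R) A : (0 < m setT)%E -> (m setT < +oo)%E ->
  mnormalize m P A = (m A * (fine (m setT))^-1%:E)%E.
Proof. by move=> m0 moo; rewrite /mnormalize gt_eqF// lt_eqF. Qed.

Variables (l : R -> int -> R) (L : R).
Hypothesis rl : regular l L.
Let l_gt0 t z : 0 < l t z. Proof. by case: rl => _ /(_ t z)/andP[]. Qed.
Let l_le t z : l t z <= L. Proof. by case: rl => _ /(_ t z)/andP[]. Qed.
Let L_gt0 : 0 < L. Proof. exact: lt_le_trans (l_gt0 0 0) (l_le 0 0). Qed.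
Local Notation z := (z l).
Local Notation zl := (zl l).

Let mz t : measurable_fun setT (z t). Proof. exact: measurable_z_at rl t. Qed.
Lemma z_ge0 t w : 0 <= z t w. Proof. exact: ltW (z_gt0 rl t w). Qed.

(** The law of the counting process; the Dirac mass is the value of a degenerate
    normalisation, which does not occur here. *)
Definition law x : probability T R :=
  mnormalize (weighted (mu x) (mz 1) (z_ge0 1)) \d_point.

Lemma weight_cst1 x s : weight x s (cst 1).
Proof.
split => //; exists 1 => // w _; by rewrite mul1r exprn_ege1// ler1n.
Qed.

Lemma weighted_setT x : weighted (mu x) (mz 1) (z_ge0 1) setT = mu x setT.
Proof.
rewrite /weighted.
have toz r : (\int[mu x]_w (cst 1 w * z r w)%:E = \int[mu x]_w (z r w)%:E)%E.
  by apply: eq_integral => w _; congr EFin; exact: mul1r.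
apply: (etrans (esym (toz 1))).
apply: (etrans (z_martingale rl (lexx 0) ler01 (weight_cst1 x 0))).
apply: (etrans (toz 0)).
under eq_integral do rewrite (z0 rl).
by rewrite integral_cst//= mul1e.
Qed.

(** The density process is a martingale, so the normalisation constant is the mass
    of [mu x] and does not depend on the intensity. *)
Definition mass x : R := fine (mu x setT).

Lemma mass_gt0 x : 0 < mass x.
Proof. by rewrite /mass fine_gt0// mu_setT_gt0 mu_setT. Qed.

Lemma lawE x A : law x A =
  ((\int[mu x]_(w in A) (z 1 w)%:E) * (mass x)^-1%:E)%E.
Proof.
have E : weighted (mu x) (mz 1) (z_ge0 1) (@setT T) = mu x setT := weighted_setT x.
have W0 : (0 < weighted (mu x) (mz 1) (z_ge0 1) (@setT T))%E.
  by rewrite E mu_setT_gt0.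
have Woo : (weighted (mu x) (mz 1) (z_ge0 1) (@setT T) < +oo)%E.
  by rewrite E mu_setT.
rewrite /mass -E.
exact: (@mnormalizeE _ T (weighted (mu x) (mz 1) (z_ge0 1)) \d_point A W0 Woo).
Qed.

Lemma integral_law x (g : T -> \bar R) : measurable_fun setT g ->
  (forall w, 0 <= g w)%E ->
  (\int[law x]_w g w = (mass x)^-1%:E * \int[mu x]_w (g w * (z 1 w)%:E))%E.
Proof.
move=> mg g0.
have c0 : 0 <= (mass x)^-1 by rewrite invr_ge0 ltW// mass_gt0.
rewrite (@eq_measure_integral _ _ _ _ (mscale (NngNum c0) (weighted (mu x) (mz 1) (z_ge0 1)))).
  by rewrite ge0_integral_mscale// integral_weighted.
by move=> A mA _; exact: (etrans (lawE x A) (muleC _ _)).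
Qed.

Lemma integral_law_indic x A (g : T -> R) : measurable A -> measurable_fun setT g ->
  (forall w, 0 <= g w) ->
  (\int[law x]_(w in A) (g w)%:E =
   (mass x)^-1%:E * \int[mu x]_w (\1_A w * g w * z 1 w)%:E)%E.
Proof.
move=> mA mg g0; rewrite integral_indicM integral_law.
- by congr (_ * _)%E.
- by apply/measurable_EFinP; apply: measurable_funM => //; exact: measurable_indic.
- by move=> w; rewrite lee_fin mulr_ge0.
Qed.

(** The martingale property of the compensated process, written without
    subtraction: both sides are integrals of nonnegative functions. *)
Definition compensator_of (P : probability T R) : Prop :=
  forall s t A, 0 <= s -> s <= t -> t <= 1 -> canonical_filtration s A ->
  (\int[P]_(w in A) ((X t w - X s w)%:~R)%:E =
   \int[P]_(w in A) (int_oc (fun v => l v (Xleft v w)) s t)%:E)%E.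

Lemma int_oc_ge0 s t w : 0 <= int_oc (fun v => l v (Xleft v w)) s t.
Proof. by apply: Rintegral_ge0 => v _; exact: ltW. Qed.

Lemma measurable_int_oc s t :
  measurable_fun setT (fun w => int_oc (fun v => l v (Xleft v w)) s t).
Proof.
apply/measurable_EFinP.
rewrite (_ : EFin \o _ = fun w => (\int[leb]_(v in `]s, t]) (l v (Xleft v w))%:E)%E).
  apply: (@measurable_time_integral _ _ _ (fun w v => (l v (Xleft v w))%:E)).
    apply/measurable_EFinP.
    exact: (measurable_comp2 (h := fun v w => l v (Xleft v w)) (a := snd) (b := fst) (measurable_intensity rl)).
  by move=> w v; rewrite lee_fin ltW.
by apply/funext => w; rewrite /= (int_oc_EFin rl).
Qed.

Lemma X_diff_ge0 s t w : s <= t -> 0 <= ((X t w - X s w)%:~R : R).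
Proof. by move=> st; rewrite ler0z subr_ge0; exact: X_homo. Qed.

(** The density at the running time [v] is replaced by the final density,
    using the martingale property with the weight [1_A * l v (X_(v-))]. *)
Lemma integral_intensity_z x s t A : 0 <= s -> s <= t -> t <= 1 ->
  canonical_filtration s A ->
  (\int[mu x]_w \int[leb]_(v in `]s, t]) (\1_A w * (zl v w * l v (Xleft v w)))%:E =
   \int[mu x]_w (\1_A w * int_oc (fun v => l v (Xleft v w)) s t * z 1 w)%:E)%E.
Proof.
move=> s0 st t1 sA; have s1 := le_trans st t1.
have [mH H0 _ _] := weight_indic x s1 sA.
have mA : measurable_fun setT (fun p : R * T => \1_A p.2 : R).
  exact: (measurableT_comp mH measurable_snd).
have ml := measurable_intensity rl.
pose h (y : R -> T -> R) v w := \1_A w * l v (Xleft v w) * y v w.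
have mh (y : R -> T -> R) : measurable_fun setT (fun p : R * T => y p.1 p.2) ->
    measurable_fun setT (fun p : R * T => h y p.1 p.2).
  by move=> my; apply: measurable_funM => //; exact: measurable_funM.
have h0 (y : R -> T -> R) v w : (0 <= y v w) -> 0 <= h y v w.
  by move=> y0; apply: mulr_ge0 => //; apply: mulr_ge0; [exact: H0|exact: ltW (l_gt0 _ _)].
have mz1 : measurable_fun setT (fun p : R * T => z 1 p.2).
  exact: (measurableT_comp (mz 1) measurable_snd).
have mzz := measurable_z rl.
have E1 w : (\int[leb]_(v in `]s, t]) (\1_A w * (zl v w * l v (Xleft v w)))%:E =
    \int[leb]_(v in `]s, t]) (h z v w)%:E)%E.
  apply: (ae_eq_off_jumps (w := w)).
  - apply/measurable_EFinP.
    exact: (measurableT_comp (measurable_wzl rl sA s1) (pair2_measurable w)).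
  - by apply/measurable_EFinP; exact: (measurableT_comp (mh z mzz) (pair2_measurable w)).
  - move=> v; rewrite lee_fin; apply: mulr_ge0; first exact: H0.
    by apply: mulr_ge0; [exact: zl_ge0 rl _ _|exact: ltW (l_gt0 _ _)].
  - by move=> v; rewrite lee_fin; apply: h0; exact: z_ge0.
  by move=> u uw; congr EFin; rewrite /h (z_zl l uw) -mulrA (mulrC (zl u w)).
rewrite (eq_integral _ _ (fun w _ => E1 w)).
have mhE (y : R -> T -> R) : measurable_fun setT (fun p : R * T => y p.1 p.2) ->
   measurable_fun setT (fun p : T * R => (h y p.2 p.1)%:E).
  move=> my; apply/measurable_EFinP.
  exact: (measurable_comp2 (a := snd) (b := fst) (mh y my)).
rewrite (@tonelli_time _ _ _ (fun w v => (h z v w)%:E) s t (mhE z mzz)); last first.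
  by move=> w v; rewrite lee_fin; apply: h0; exact: z_ge0.
have E2 v : v \in (`]s, t]%classic : set (measurableTypeR R)) ->
    (\int[mu x]_w (h z v w)%:E = \int[mu x]_w (h (fun _ => z 1) v w)%:E)%E.
  rewrite inE/= in_itv/= => /andP[sv vt].
  apply/esym; apply: (@z_martingale _ _ _ rl x v (fun w => \1_A w * l v (Xleft v w))).
  - exact: le_trans s0 (ltW sv).
  - exact: le_trans vt t1.
  apply: weightM.
  - exact: weight_homo (ltW sv) (weight_indic x s1 sA).
  - exact: (measurableT_comp ml (pair1_measurable v)).
  - by move=> w; exact: ltW.
  - exists L; first exact: ltW.
    move=> w _; apply: (@le_trans _ _ L).
      rewrite -[leRHS]mul1r; apply: ler_pM => //; exact: ltW.
    by rewrite ler_peMr ?exprn_ege1 ?ler1n// ltW.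
  - by move=> u w vu uw; rewrite Xleft_ins_le// ltW.
rewrite (eq_integral _ _ E2).
have mzc : measurable_fun setT (fun p : R * T => (fun=> z 1) p.1 p.2) by exact: mz1.
have := @tonelli_time _ _ _ (fun w v => (h (fun _ => z 1) v w)%:E) s t (mhE _ mzc) _ (mu x).
move=> <-; last by move=> w v; rewrite lee_fin; apply: h0; exact: z_ge0.
apply: eq_integral => w _.
transitivity (\int[leb]_(v in `]s, t]) ((\1_A w * z 1 w)%:E * (l v (Xleft v w))%:E))%E.
  by apply: eq_integral => v _; rewrite -EFinM /h mulrAC.
rewrite ge0_integralZl_EFin//.
- by rewrite -(int_oc_EFin rl) -EFinM mulrAC.
- by move=> v _; rewrite lee_fin ltW.
- apply/measurable_EFinP/measurable_funTS; exact: (measurable_intensity_path rl w).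
- by apply: mulr_ge0; [exact: H0|exact: z_ge0].
Qed.

Lemma integral_incr_z_fin x s A : measurable A ->
  (\int[mu x]_w (\1_A w * incr s w * z 1 w)%:E < +oo)%E.
Proof.
move=> mA; pose C := 2 * (1 + L).
have C0 : 0 <= C by apply: mulr_ge0 => //; apply: addr_ge0 => //; exact: ltW.
have mC := @measurable_size_fun R _ _ (fun n => (C ^+ n)%:E).
have Cn0 w : (0 <= (C ^+ size (jumps w))%:E)%E by rewrite lee_fin exprn_ge0.
have I0 w : 0 <= \1_A w :> R by rewrite indicE.
have I1 w : \1_A w <= 1 :> R by rewrite indicE; case: (w \in A).
apply: (@le_lt_trans _ _ (\int[mu x]_w ((expR 1)%:E * (C ^+ size (jumps w))%:E))%E).
  apply: ge0_le_integral.
  - exact: measurableT.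
  - move=> w _; rewrite lee_fin; apply: mulr_ge0; last exact: z_ge0.
    by apply: mulr_ge0; [exact: I0|exact: incr_ge0].
  - apply/measurable_EFinP; apply: measurable_funM; last exact: mz.
    by apply: measurable_funM; [exact: measurable_indic|exact: measurable_incr].
  - by apply: measurable_funeM; exact: mC.
  move=> w _; rewrite -EFinM lee_fin /C exprMn (mulrCA (expR 1)).
  apply: ler_pM.
  - by apply: mulr_ge0; [exact: I0|exact: incr_ge0].
  - exact: z_ge0.
  - apply: (le_trans _ (incr_le s w)).
    by apply: ler_piMl; [exact: incr_ge0|exact: I1].
  - by rewrite mulrC; exact: (z_bound rl).
rewrite (ge0_integralZl_EFin _ measurableT (fun w _ => Cn0 w) mC (expR_ge0 1)).
by rewrite lte_mul_pinfty ?lee_fin ?expR_ge0// integral_mu_expr.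
Qed.

(** [forward_incr] under the density: the densities at times [s] and [t] are both
    replaced by the final one by [z_martingale]. *)
Lemma law_compensator x : compensator_of (law x).
Proof.
move=> s t A s0 st t1 sA; have s1 := le_trans st t1.
have mA := filtration_measurable s1 sA.
have [mH H0 _ _] := weight_indic x s1 sA.
apply: (etrans (integral_law_indic x mA (measurable_X_diff s t)
  (fun w => X_diff_ge0 w st))).
apply: (etrans _ (esym (integral_law_indic x mA (measurable_int_oc s t)
  (int_oc_ge0 s t)))).
congr (_ * _)%E; rewrite -(integral_intensity_z x s0 st t1 sA).
have E := forward_incr rl x s0 st t1 sA.
have Et := z_martingale rl (le_trans s0 st) t1 (weight_incr x st t1 sA).
have Es := z_martingale rl s0 s1 (weight_incr x (lexx s) s1 sA).
have mi r : measurable_fun setT (fun w => (\1_A w * incr r w * z 1 w)%:E).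
  apply/measurable_EFinP; apply: measurable_funM; last exact: mz.
  by apply: measurable_funM; [exact: mH|exact: measurable_incr].
have i0 r w : (0 <= (\1_A w * incr r w * z 1 w)%:E)%E.
  rewrite lee_fin; apply: mulr_ge0; last exact: z_ge0.
  by apply: mulr_ge0; [exact: H0|exact: incr_ge0].
have Fs := integral_incr_z_fin x s mA.
apply: (adde_cancelr _ Fs); first by apply: integral_ge0 => w _; exact: i0.
apply: (etrans _ (addeC _ _)).
apply: (etrans _ (congr1 (fun y => y + _)%E (esym Es))).
apply: (etrans _ E); apply: (etrans _ Et).
apply: (etrans (esym (ge0_integralD (mu x) measurableT _ _ _ _))).
- move=> w _; rewrite lee_fin; apply: mulr_ge0; last exact: z_ge0.
  by apply: mulr_ge0; [exact: H0|exact: X_diff_ge0].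
- apply/measurable_EFinP; apply: measurable_funM; last exact: mz.
  by apply: measurable_funM; [exact: mH|exact: measurable_X_diff].
- by move=> w _; exact: i0.
- exact: mi.
apply: eq_integral => w _; rewrite -EFinD; congr EFin.
rewrite -mulrDl -mulrDr; congr (_ * _ * _).
by rewrite /incr -intrD; congr (_%:~R); rewrite addrA subrK.
Qed.

End law.

(** * Compensators and the local martingale problem *)

Lemma filtrationT (R : realType) (t : R) : @canonical_filtration R t setT.
Proof. by rewrite -(setD0 setT); apply: sigma_algebraCD; exact: sigma_algebra0. Qed.

Section compensator_to_law.
Context {R : realType}.
Notation T := (counting_path R).
Local Notation leb := (@lebesgue_measure R).
Implicit Types (w : T) (s t u : R) (x : int).
Variables (l : R -> int -> R) (L : R).
Hypothesis rl : regular l L.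
Let l_gt0 t z : 0 < l t z. Proof. by case: rl => _ /(_ t z)/andP[]. Qed.
Let l_le t z : l t z <= L. Proof. by case: rl => _ /(_ t z)/andP[]. Qed.
Let L_gt0 : 0 < L. Proof. exact: lt_le_trans (l_gt0 0 0) (l_le 0 0). Qed.

Lemma compensatedE t w : compensated l t w = (X t w - X 0 w)%:~R - cumul l t w.
Proof. by rewrite /compensated intrB. Qed.

Lemma measurable_cumul_at t : measurable_fun setT (cumul l t).
Proof. exact: (measurableT_comp (measurable_cumul rl) (pair1_measurable t)). Qed.

Lemma measurable_compensated t : measurable_fun setT (compensated l t).
Proof.
rewrite (_ : compensated l t = fun w => (X t w - X 0 w)%:~R - cumul l t w).
  by apply: measurable_funB; [exact: measurable_X_diff|exact: measurable_cumul_at].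
by apply/funext => w; exact: compensatedE.
Qed.

Lemma compensated_stop t w : 0 <= t -> compensated l t (stop t w) = compensated l t w.
Proof.
move=> t0; rewrite !compensatedE !X_stop minxx min_l//; congr (_ - _).
by apply: (cumul_eq rl) => s st; exact: Xleft_stop.
Qed.

(** The compensated process at time [t] depends on the path stopped at [t]. *)
Lemma compensated_adapted t B : 0 <= t -> t <= 1 -> measurable B ->
  canonical_filtration t (compensated l t @^-1` B).
Proof.
move=> t0 t1 mB; apply: stop_filtration => //.
  by rewrite -[X in measurable X]setTI; exact: measurable_compensated.
by move=> w; rewrite /= compensated_stop.
Qed.

Variable (P : probability T R).

Lemma integrable_X_diff s t : s <= t ->
  (\int[P]_w ((X t w - X s w)%:~R)%:E < +oo)%E ->
  P.-integrable setT (fun w => ((X t w - X s w)%:~R)%:E).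
Proof.
move=> st fin; apply/integrableP; split.
  by apply/measurable_EFinP; exact: measurable_X_diff.
under eq_integral do rewrite gee0_abs ?lee_fin ?X_diff_ge0//.
exact: fin.
Qed.

Lemma integrable_bounded_fun (f : T -> R) (M : R) : measurable_fun setT f ->
  (forall w, `|f w| <= M) -> P.-integrable setT (EFin \o f).
Proof.
move=> mf fM; apply: measurable_bounded_integrable => //.
  by rewrite /= probability_setT ltry.
exists M; split; first exact: num_real.
by move=> r Mr w _; rewrite /= (le_trans (fM w))// ltW.
Qed.

Lemma integrable_int_oc s t : s <= t ->
  P.-integrable setT (EFin \o (fun w => int_oc (fun v => l v (Xleft v w)) s t)).
Proof.
move=> st; apply: (@integrable_bounded_fun _ (L * (t - s))).
  exact: (measurable_int_oc rl).
by move=> w; rewrite ger0_norm ?(int_oc_ge0 rl)// (int_oc_le rl).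
Qed.

Lemma integrable_cumul t : 0 <= t -> P.-integrable setT (EFin \o cumul l t).
Proof.
move=> t0; apply: (@integrable_bounded_fun _ (L * t)); first exact: measurable_cumul_at.
by move=> w; rewrite ger0_norm ?(cumul_ge0 rl)// (cumul_le rl).
Qed.

Lemma compensated_diff s t w : 0 <= s -> s <= t ->
  compensated l t w = compensated l s w +
    ((X t w - X s w)%:~R - int_oc (fun v => l v (Xleft v w)) s t).
Proof.
move=> s0 st; rewrite !compensatedE (cumul_incr rl w s0 st) !intrB; ring.
Qed.

Lemma integral_compensated s t A : 0 <= s -> s <= t -> t <= 1 -> measurable A ->
  (\int[P]_w ((X 1 w - X 0 w)%:~R)%:E < +oo)%E ->
  (\int[P]_(w in A) (compensated l t w)%:E =
   \int[P]_(w in A) (compensated l s w)%:E +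
   (\int[P]_(w in A) ((X t w - X s w)%:~R)%:E -
    \int[P]_(w in A) (int_oc (fun v => l v (Xleft v w)) s t)%:E))%E /\
  P.-integrable setT (EFin \o compensated l t).
Proof.
move=> s0 st t1 mA fin; have t0 := le_trans s0 st; have s1 := le_trans st t1.
have fin' a b : 0 <= a -> a <= b -> b <= 1 ->
    P.-integrable setT (fun w => ((X b w - X a w)%:~R)%:E).
  move=> a0 ab b1; apply: integrable_X_diff => //; apply: le_lt_trans fin.
  apply: ge0_le_integral => //.
  - by move=> w _; rewrite lee_fin X_diff_ge0.
  - by apply/measurable_EFinP; exact: measurable_X_diff.
  - by apply/measurable_EFinP; exact: measurable_X_diff.
  move=> w _; rewrite lee_fin ler_int; apply: lerB; exact: X_homo.
have ic a : 0 <= a -> a <= 1 -> P.-integrable setT (EFin \o compensated l a).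
  move=> a0 a1; rewrite (_ : EFin \o _ =
      (fun w => ((X a w - X 0 w)%:~R)%:E - (cumul l a w)%:E)%E).
    by apply: integrableB => //; [exact: fin'|exact: integrable_cumul].
  by apply/funext => w; rewrite /= compensatedE.
split; last exact: ic.
have iA (f : T -> \bar R) : P.-integrable setT f -> P.-integrable A f.
  by apply: integrableS.
rewrite -integralB//; last 2 first.
- by apply: iA; exact: fin'.
- by apply: iA; exact: integrable_int_oc.
rewrite -integralD//.
- by apply: eq_integral => w _; rewrite (compensated_diff w s0 st).
- by apply: iA; exact: ic.
- by apply: iA; apply: integrableB => //; [exact: fin'|exact: integrable_int_oc].
Qed.

Lemma integral_int_oc_le s t A : s <= t -> t - s <= 1 -> measurable A ->
  (\int[P]_(w in A) (int_oc (fun v => l v (Xleft v w)) s t)%:E <= L%:E)%E.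
Proof.
move=> st ts mA; apply: (@le_trans _ _ (\int[P]_(w in A) cst L%:E w)%E).
  apply: ge0_le_integral => //.
  - by move=> w _; rewrite lee_fin (int_oc_ge0 rl).
  - by apply/measurable_EFinP/measurable_funTS; exact: (measurable_int_oc rl).
  move=> w _; rewrite lee_fin (le_trans (int_oc_le rl w st))//.
  by rewrite -[leRHS]mulr1 ler_wpM2l// ltW.
rewrite integral_cst//= -[leRHS]mule1; apply: lee_wpmul2l.
  by rewrite lee_fin ltW.
exact: probability_le1.
Qed.

(** The compensated process is a true martingale, so that constant infinite
    stopping times localise it. *)
Lemma compensator_is_counting_law x : P [set w | X 0 w = x] = 1%E ->
  compensator_of l P -> is_counting_law l x P.
Proof.
move=> P0 Pc; split => //.
have fin : (\int[P]_w ((X 1 w - X 0 w)%:~R)%:E < +oo)%E.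
  rewrite Pc//; last exact: filtrationT.
  by apply: (le_lt_trans (integral_int_oc_le _ _ _)); rewrite ?subr0// ltry.
exists (fun _ _ => +oo%E); split.
- move=> n; split => // t t01.
  rewrite (_ : [set _ | _] = set0); first exact: sigma_algebra0.
  by apply/seteqP; split.
- apply: aeW => w; split; last exact: cvg_cst.
  by move=> m n _.
move=> n.
have -> : stopped (compensated l) (fun=> +oo%E) = compensated l.
  by apply/funext => t; apply/funext => w; rewrite /stopped min_l ?leey.
split.
- move=> t; rewrite in_itv/= => /andP[t0 t1] B mB; exact: compensated_adapted.
- move=> t; rewrite in_itv/= => /andP[t0 t1].
  by have [] := integral_compensated (lexx 0) t0 t1 measurableT fin.
move=> s t s0 st t1 A sA.
have mA := filtration_measurable (le_trans st t1) sA.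
have [-> _] := integral_compensated s0 st t1 mA fin.
rewrite Pc// subee ?adde0//.
rewrite ge0_fin_numE; last by apply: integral_ge0 => w _; rewrite lee_fin (int_oc_ge0 rl).
apply: (le_lt_trans (integral_int_oc_le st _ mA)); rewrite ?ltry//.
by rewrite lerBlDr (le_trans t1)// lerDl.
Qed.

End compensator_to_law.

Section law_is_counting_law.
Context {R : realType}.
Notation T := (counting_path R).
Variables (l : R -> int -> R) (L : R).
Hypothesis rl : regular l L.

Lemma law_X0 x : law rl x [set w | X 0 w = x] = 1%E.
Proof.
rewrite -(probability_setT (law rl x)).
have mX0 : measurable [set w : T | X 0 w = x] := measurable_X_preimage 0 [set x].
apply: (etrans (lawE rl x _)); apply: (etrans _ (esym (lawE rl x _))).
congr (_ * _)%E; rewrite (integral_indicM (mu x)) .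
apply: mu_ext.
- apply/measurable_EFinP; apply: measurable_funM; first exact: measurable_indic.
  exact: (measurable_z_at rl).
- by apply/measurable_EFinP; exact: (measurable_z_at rl).
- move=> w; rewrite lee_fin; apply: mulr_ge0; first by rewrite indicE.
  exact: (z_ge0 rl).
- by move=> w; rewrite lee_fin; exact: (z_ge0 rl).
by move=> w wx; rewrite indicE mem_set ?mul1r//= X0_init.
Qed.

Lemma law_is_counting_law x : is_counting_law l x (law rl x).
Proof.
apply: (compensator_is_counting_law rl); first exact: law_X0.
exact: law_compensator.
Qed.

End law_is_counting_law.

Lemma adde_fin_cancel {R : realType} (a b c : \bar R) : a \is a fin_num -> b \is a fin_num ->
  a = (a + (c - b))%E -> c = b.
Proof.
move: a b c => [a| |] [b| |] [c| |] //= _ _ [E].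
by congr EFin; lra.
Qed.

Section from_local_martingale.
Context {R : realType}.
Notation T := (counting_path R).
Local Notation leb := (@lebesgue_measure R).
Implicit Types (w : T) (s t u : R) (x : int).
Variables (l : R -> int -> R) (L : R).
Hypothesis rl : regular l L.
Let l_gt0 t z : 0 < l t z. Proof. by case: rl => _ /(_ t z)/andP[]. Qed.
Let l_le t z : l t z <= L. Proof. by case: rl => _ /(_ t z)/andP[]. Qed.
Let L_gt0 : 0 < L. Proof. exact: lt_le_trans (l_gt0 0 0) (l_le 0 0). Qed.

(** The running time stopped at [tau]. *)
Definition clock t (tau : T -> \bar R) w : R := fine (mine t%:E (tau w)).

Lemma clock_bounds t tau w : 0 <= t -> (0 <= tau w)%E -> 0 <= clock t tau w <= t.
Proof.
move=> t0; rewrite /clock; case: (tau w) => [r| |] //=.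
  by rewrite lee_fin => r0; rewrite -EFin_min /= le_min t0 r0 ge_min lexx.
by move=> _; rewrite min_l ?leey//= t0 lexx.
Qed.

Lemma clock_late t tau w : (t%:E <= tau w)%E -> clock t tau w = t.
Proof. by move=> tt; rewrite /clock min_l. Qed.

Lemma clock_le t tau w r : 0 <= t -> (0 <= tau w)%E -> r < t ->
  (clock t tau w <= r) = (tau w <= r%:E)%E.
Proof.
move=> t0; rewrite /clock; case: (tau w) => [q| |] //=.
  by move=> _ rt; rewrite -EFin_min /= ge_min leNgt rt /= lee_fin.
by move=> _ rt; rewrite min_l ?leey//= leNgt rt.
Qed.

Lemma measurable_clock t tau : 0 <= t -> t <= 1 ->
  stopping_time (@canonical_filtration R) tau -> measurable_fun setT (clock t tau).
Proof.
move=> t0 t1 [tau0 tauF].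
apply: (measurability _ (measurable_realfun.RGenOInfty.measurableE R)) => _ [_ [r ->] <-].
rewrite setTI set_itvoy.
have [tr|rt] := leP t r.
  rewrite (_ : _ @^-1` _ = set0) //; apply/seteqP; split => // w /=.
  have /andP[_ ct] := clock_bounds t0 (tau0 w).
  by move=> /lt_le_trans-/(_ _ ct); rewrite ltNge tr.
have [r0|r0] := ltP r 0.
  rewrite (_ : _ @^-1` _ = setT) //; apply/seteqP; split => // w _ /=.
  have /andP[c0 _] := clock_bounds t0 (tau0 w); exact: lt_le_trans c0.
rewrite (_ : _ @^-1` _ = ~` [set w | (tau w <= r%:E)%E]).
  apply: measurableC; apply: (@filtration_measurable _ r).
    exact: le_trans (ltW rt) t1.
  by apply: tauF; rewrite in_itv/= r0 (le_trans (ltW rt)).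
by apply/seteqP; split => w /=; rewrite ltNge clock_le// => /negP.
Qed.

Variable (P : probability T R).
Hypothesis Ploc : local_martingale P (@canonical_filtration R) (compensated l).

Lemma compensated0 w : compensated l 0 w = 0.
Proof. by rewrite compensatedE (cumul0 rl) !subrr. Qed.

Lemma compensated_bounds t w : 0 <= t -> t <= 1 ->
  (X t w - X 0 w)%:~R <= compensated l t w + L /\
  `|compensated l t w| <= (X 1 w - X 0 w)%:~R + L.
Proof.
move=> t0 t1; rewrite compensatedE.
have c0 := cumul_ge0 rl t w.
have cL : cumul l t w <= L.
  by rewrite (le_trans (cumul_le rl w t0))// -[leRHS]mulr1 ler_wpM2l// ltW.
have X0t := X_diff_ge0 w t0.
have Xt1 : ((X t w - X 0 w)%:~R : R) <= (X 1 w - X 0 w)%:~R.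
  by rewrite ler_int lerD2r; exact: X_homo.
move: c0 cL X0t Xt1; move: (cumul l t w) ((X t w - X 0 w)%:~R : R)
  ((X 1 w - X 0 w)%:~R : R) => c a b c0 cL a0 ab.
by split; [lra|rewrite ler_norml; apply/andP; split; lra].
Qed.

Lemma measurable_X_at (f : T -> R) : measurable_fun setT f ->
  measurable_fun setT (fun w => (X (f w) w - X 0 w)%:~R : R).
Proof.
move=> mf.
have mXf : measurable_fun setT (fun w => X (f w) w).
  exact: (measurable_comp2 (h := fun t w => X t w) (b := id) measurable_X_joint mf).
apply: (measurable_fun_switch (g := fun y w => (y - X 0 w)%:~R : R) mXf) => y.
exact: (@measurable_int_fun _ _ _ _ _ (fun k => (y - k)%:~R : R) (measurable_X 0)).
Qed.

(** The intensity is at most [L], so the expected number of jumps before each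
    stopping time is at most [L]; Fatou's lemma removes the stopping times. *)
Lemma integral_jumps_fin : (\int[P]_w ((X 1 w - X 0 w)%:~R)%:E <= L%:E)%E.
Proof.
have [tau [tauS tauC tauM]] := Ploc.
pose Y n w := ((X (clock 1 (tau n) w) w - X 0 w)%:~R : R)%:E.
have tau0 n w : (0 <= tau n w)%E by case: (tauS n).
have cb n w := clock_bounds ler01 (tau0 n w).
have Y0 n w : (0 <= Y n w)%E.
  by rewrite lee_fin X_diff_ge0//; case/andP: (cb n w).
have mY n : measurable_fun setT (Y n).
  by apply/measurable_EFinP; apply: measurable_X_at; exact: measurable_clock.
have YL n : (\int[P]_w Y n w <= L%:E)%E.
  have [Mad Mi Mm] := tauM n.
  have i1 := Mi 1; rewrite in_itv/= ler01 lexx in i1; move/(_ isT) in i1.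
  have iL : P.-integrable setT (EFin \o cst L).
    by apply: (@integrable_bounded_fun _ _ _ L) => // w; rewrite /= ger0_norm// ltW.
  have mM : measurable_fun setT (fun w => (stopped (compensated l) (tau n) 1 w)%:E).
    by have /integrableP[] := i1.
  apply: (@le_trans _ _ (\int[P]_w ((stopped (compensated l) (tau n) 1 w)%:E + L%:E))%E).
    apply: ge0_le_integral => //.
      by apply: emeasurable_funD.
    move=> w _; rewrite lee_fin; have /andP[a b] := cb n w.
    by have [] := compensated_bounds w a b.
  rewrite integralD//.
  have -> := Mm 0 1 (lexx 0) ler01 (lexx 1) setT (@filtrationT R 0).
  have E0 : (\int[P]_w (stopped (compensated l) (tau n) 0 w)%:E = 0)%E.
    apply: integral0_eq => w _; rewrite /stopped /= -/(clock 0 (tau n) w).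
    by have := clock_bounds (lexx 0) (tau0 n w) => /le_anti <-; rewrite compensated0.
  rewrite E0 add0e.
  by rewrite integral_cst//= probability_setT mule1.
have mlim : measurable_fun setT (fun w => limn_einf (Y^~ w)).
  by rewrite /limn_einf; apply: measurableT_comp => //; apply: measurable_fun_limn_esup => n; apply: measurableT_comp.
have -> : (\int[P]_w ((X 1 w - X 0 w)%:~R)%:E = \int[P]_w limn_einf (Y^~ w))%E.
  apply: ge0_ae_eq_integral => //.
  - by apply/measurable_EFinP; exact: measurable_X_diff.
  - by move=> w _; rewrite lee_fin X_diff_ge0.
  - move=> w _; rewrite limn_einf_lim; apply: lime_ge; first exact: is_cvg_einfs.
    by apply: nearW => n; apply: le_ereal_inf_tmp => _ [k _ <-]; exact: Y0.
  apply: filterS tauC => w [_ /cvgeyPge/(_ 1) near1] _.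
  have Yc : Y^~ w @ \oo --> ((X 1 w - X 0 w)%:~R : R)%:E.
    apply: cvg_near_cst; apply: filterS near1 => n /clock_late cE.
    by rewrite /Y cE.
  by have [-> _] := cvg_limn_einf_sup Yc.
apply: le_trans (fatou _ _ _ _) _ => //.
rewrite limn_einf_lim.
apply: lime_le; first exact: is_cvg_einfs.
apply: nearW => n; apply: le_trans (YL n); apply: ereal_inf_lbound.
by exists n => //=.
Qed.

(** The stopped processes are dominated by the number of jumps plus [L],
    integrable by [integral_jumps_fin]; so the martingale property passes to the
    limit. *)
Lemma local_martingale_compensator : compensator_of l P.
Proof.
move=> s t A s0 st t1 sA.
have [tau [tauS tauC tauM]] := Ploc.
have tau0 n w : (0 <= tau n w)%E by case: (tauS n).
have t0 := le_trans s0 st; have s1 := le_trans st t1.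
have mA := filtration_measurable s1 sA.
have fin : (\int[P]_w ((X 1 w - X 0 w)%:~R)%:E < +oo)%E.
  exact: le_lt_trans integral_jumps_fin (ltry L).
have [E _] := integral_compensated rl (P := P) s0 st t1 mA fin.
have lims r : 0 <= r -> r <= 1 ->
    (\int[P]_(w in A) (stopped (compensated l) (tau n) r w)%:E)%E @[n --> \oo] -->
    (\int[P]_(w in A) (compensated l r w)%:E)%E.
  move=> r0 r1.
  have m1 : forall n, measurable_fun A (fun w => (stopped (compensated l) (tau n) r w)%:E).
    move=> n; apply: measurable_funTS; have [_ /(_ r) + _] := tauM n.
    by rewrite in_itv/= r0 r1 => /(_ isT)/integrableP[].
  have m2 : measurable_fun A (fun w => (compensated l r w)%:E).
    by apply: measurable_funTS; apply/measurable_EFinP; exact: (measurable_compensated rl).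
  have cv : {ae P, forall w, A w -> (stopped (compensated l) (tau n) r w)%:E @[n --> \oo] -->
      (compensated l r w)%:E}.
    apply: filterS tauC => w [_ /cvgeyPge/(_ 1) near1] _.
    apply: cvg_near_cst; apply: filterS near1 => n tn.
    rewrite /stopped -/(clock r (tau n) w) clock_late//.
    by rewrite (le_trans _ tn)// lee_fin.
  have ig : P.-integrable A (fun w => ((X 1 w - X 0 w)%:~R + L)%:E).
    apply: (@integrableS _ _ _ P setT) => //.
    apply: (@integrableD _ _ _ P setT _ (fun w => ((X 1 w - X 0 w)%:~R)%:E) (cst L%:E)) => //.
      by apply: integrable_X_diff.
    by apply: (@integrable_bounded_fun _ _ (cst L) L) => // w; rewrite /= ger0_norm// ltW.
  have dom : {ae P, forall w n, A w -> (`|(stopped (compensated l) (tau n) r w)%:E| <=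
      ((X 1 w - X 0 w)%:~R + L)%:E)%E}.
    apply: aeW => w n _; rewrite /stopped -/(clock r (tau n) w) abse_EFin lee_fin.
    have /andP[a b] := clock_bounds r0 (tau0 n w).
    by have [] := compensated_bounds w a (le_trans b r1).
  by have [_ _ H] := dominated_convergence mA m1 m2 cv ig dom.
have EM : (\int[P]_(w in A) (compensated l t w)%:E = \int[P]_(w in A) (compensated l s w)%:E)%E.
  apply: (cvg_unique _ (lims t t0 t1)) => //.
  rewrite (_ : (fun n => _) = (fun n => \int[P]_(w in A) (stopped (compensated l) (tau n) s w)%:E)%E).
    exact: lims.
  by apply/funext => n; have [_ _ Mm] := tauM n; exact: Mm.
have [_ Is] := integral_compensated rl (P := P) s0 (le_trans st (lexx t)) t1 mA fin.
have Ifin : (\int[P]_(w in A) (compensated l t w)%:E)%E \is a fin_num.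
  apply: (@integrable_fin_num _ _ _ P A mA (EFin \o compensated l t)).
  exact: (integrableS measurableT mA (@subsetT _ A) Is).
have cfin : (\int[P]_(w in A) (int_oc (fun v => l v (Xleft v w)) s t)%:E)%E \is a fin_num.
  apply: (@integrable_fin_num _ _ _ P A mA
    (EFin \o (fun w => int_oc (fun v => l v (Xleft v w)) s t))).
  exact: (integrableS measurableT mA (@subsetT _ A) (integrable_int_oc rl P st)).
move: E; rewrite -EM; move: Ifin cfin.
exact: adde_fin_cancel.
Qed.

End from_local_martingale.

(** * The predictable sigma-field and level crossings *)

Lemma level_index (z : int) (i p q : nat) : (p <= i)%N -> (i < q)%N ->
  (z - i%:Z + p%:Z <= z) && (z < z - i%:Z + q%:Z).
Proof. lia. Qed.

Lemma sigma_algebraI (T : pointedType) (G : set (set T)) A B :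
  <<s G >> A -> <<s G >> B -> <<s G >> (A `&` B).
Proof. exact: (@measurableI _ (g_sigma_algebraType G)). Qed.

Lemma index_level (x : int) (i p q : nat) : x + p%:Z <= x + i%:Z ->
  x + i%:Z < x + q%:Z -> (p <= i < q)%N.
Proof. lia. Qed.

Section predictable.
Context {R : realType}.
Notation T := (counting_path R).
Local Notation leb := (@lebesgue_measure R).
Implicit Types (w : T) (s t u : R) (x : int).

Lemma jump_time_le i t w : (i < size (jumps w))%N && (jump_time i w <= t) =
  (i < count (fun s => (s <= t)%R) (jumps w))%N.
Proof.
have [t1|t1] := ltP t 1.
  rewrite /jump_time nth_sorted_count ?jumps_sorted//.
  have [/leq_trans le|//] := ltnP i (count _ _).
    by rewrite le// count_size.
  by rewrite andbF.
have -> : count (fun s => (s <= t)%R) (jumps w) = size (jumps w).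
  apply/eqP; rewrite -all_count; apply/allP => u /jumps01/andP[_ u1].
  by rewrite (le_trans (ltW u1)).
have [iw|//] := ltnP i (size _).
by have /andP[_ u1] := jumps01 (mem_nth 1 iw); rewrite /jump_time (le_trans (ltW u1)).
Qed.

Lemma jump_time_oc i s t w : (i < size (jumps w))%N && (s < jump_time i w <= t) =
  (count (fun u => (u <= s)%R) (jumps w) <= i < count (fun u => (u <= t)%R) (jumps w))%N.
Proof.
rewrite [X in _ = X && _]leqNgt -(jump_time_le i t) -(jump_time_le i s) negb_and -ltNge.
by case: (i < _)%N => //=.
Qed.

Lemma Xleft_jump_time i w : (i < size (jumps w))%N ->
  Xleft (jump_time i w) w = init w + i%:Z.
Proof.
by move=> iw; rewrite /Xleft /jump_time count_lt_nth// jumps_sorted.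
Qed.

Definition jump_point i w : measurableTypeR R * T := (jump_time i w, w).

Lemma measurable_jump_point i : measurable_fun setT (jump_point i).
Proof. by apply: measurable_fun_pair => //; exact: measurable_jump_time. Qed.

HB.instance Definition _ i :=
  isMeasurableFun.Build _ _ _ _ (jump_point i) (@measurable_jump_point i).

Definition has_jump i : set T := [set w | (i < size (jumps w))%N].

Lemma measurable_has_jump i : measurable (has_jump i).
Proof.
rewrite (_ : has_jump i = [set w | i%:Z < X 1 w - X 0 w]).
  exact: (@measurable_X_incr _ 0 1 [set z | i%:Z < z]).
by apply/seteqP; split=> w /=; rewrite X1E X0_init addrAC subrr add0r ltz_nat.
Qed.

Variable P : probability T R.

(** The mean of the measure charging each point (jump time, path), written as a
    sum over the rank of the jump. *)
Definition jump_measure : {measure set (measurableTypeR R * T) -> \bar R} :=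
  mseries (fun i => measure_function_pushforward__canonical__measure_function_Measure
    (mrestr P (measurable_has_jump i)) (measurable_jump_point i)) 0.

Lemma sum_between (p q : nat) : (p <= q)%N ->
  (\sum_(i <oo) ((p <= i < q)%N%:R : R)%:E = (q%:R - p%:R : R)%:E)%E.
Proof.
move=> pq; apply/cvg_lim => //; apply: cvg_near_cst.
exists q => // n /= qn.
rewrite -natrB// sumEFin -natr_sum; congr ((_ %:R)%:E).
rewrite (_ : (q - p = minn n q - minn n p)%N); last by lia.
elim: n {qn} => [|n IH]; first by rewrite big_geq//; lia.
by rewrite big_nat_recr//= IH; case: (ltnP n q); case: (leqP p n) => /=; lia.
Qed.

Lemma jump_measure_oc (a b : R) (A : set T) : a <= b -> measurable A ->
  jump_measure ([set p | a < p.1 <= b /\ A p.2]) =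
  (\int[P]_(w in A) ((X b w - X a w)%:~R)%:E)%E.
Proof.
move=> ab mA; rewrite /jump_measure /= /mseries.
pose h i w : R := (count (fun u => (u <= a)%R) (jumps w) <= i <
  count (fun u => (u <= b)%R) (jumps w))%N%:R.
have hE i w : h i w = \1_([set w | has_jump i w /\ a < jump_time i w <= b]) w.
  rewrite indicE /h -jump_time_oc; congr (nat_of_bool _)%:R; apply/andP/idP.
    by move=> [? ?]; rewrite inE.
  by rewrite inE.
have mS i : measurable [set w | has_jump i w /\ a < jump_time i w <= b].
  apply: measurableI; first exact: measurable_has_jump.
  have : measurable (jump_time i @^-1` `]a, b]).
    by rewrite -[X in measurable X]setTI; apply: measurable_jump_time.
  have -> // : jump_time i @^-1` `]a, b] = [set w | a < jump_time i w <= b].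
  by apply/seteqP; split => w /=; rewrite in_itv.
transitivity (\sum_(i <oo) \int[P]_(w in A) (h i w)%:E)%E.
  apply: eq_eseriesr => i _; rewrite /pushforward /mrestr.
  rewrite (eq_integral (fun w => (\1_[set w | has_jump i w /\ a < jump_time i w <= b] w)%:E)).
    rewrite integral_indic//; congr (P _); apply/seteqP; split => w /=.
      by move=> [[]]; split.
    by move=> [[]]; split.
  by move=> w _; rewrite hE.
rewrite -integral_nneseries//; last 2 first.
- move=> i; apply/measurable_EFinP/measurable_funTS.
  rewrite (_ : h i = \1_([set w | has_jump i w /\ a < jump_time i w <= b])); last exact/funext.
  exact: measurable_indic.
- by move=> i w _; rewrite lee_fin ler0n.
apply: eq_integral => w _; rewrite sum_between.
  by rewrite /X opprD addrACA subrr add0r intrB -!pmulrn.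
by apply: sub_count => u /= /le_trans->.
Qed.

(** A path makes at most one jump from level [z], and it makes it in ]s,t]
    exactly when [X s <= z < X t]. *)
Lemma jump_measure_level (s t : R) (z : int) (A : set T) : s <= t -> measurable A ->
  jump_measure [set p | s < p.1 <= t /\ (A p.2 /\ Xleft p.1 p.2 = z)] =
  P (A `&` [set w | X s w <= z < X t w]).
Proof.
move=> st mA; rewrite /jump_measure /= /mseries.
pose E i := has_jump i `&` [set w | s < jump_time i w <= t] `&` [set w | X 0 w = z - i%:Z] `&` A.
have mE i : measurable (E i).
  apply: measurableI => //; apply: measurableI; last exact: (@measurable_X_preimage R 0 [set z - i%:Z]).
  apply: measurableI; first exact: measurable_has_jump.
  have : measurable (jump_time i @^-1` `]s, t]).
    by rewrite -[X in measurable X]setTI; apply: measurable_jump_time.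
  have -> // : jump_time i @^-1` `]s, t] = [set w | s < jump_time i w <= t].
  by apply/seteqP; split => w /=; rewrite in_itv.
transitivity (\sum_(i <oo) P (E i))%E.
  apply: eq_eseriesr => i _; rewrite /pushforward /mrestr; congr (P _).
  apply/seteqP; split => w; rewrite /E /jump_point /= X0_init.
    move=> [[sti [Aw Xz]] iw]; split => //; split => //.
    by rewrite -Xz Xleft_jump_time// addrK.
  move=> [[[iw sti] Xz] Aw]; split => //; split => //; split => //.
  by rewrite Xleft_jump_time// Xz subrK.
rewrite -measure_semi_bigcup //; last 2 first.
- apply/trivIsetP => i j _ _ ij; apply/seteqP; split => // w [[[_ Xi] _] [[_ Xj] _]].
  move: ij => /eqP; apply.
  have /eqP := etrans (esym Xi) Xj.
  by rewrite (inj_eq (addrI _)) eqr_opp eqz_nat => /eqP.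
- by apply: bigcup_measurable.
congr (P _); apply/seteqP; split => w /=.
  move=> [i _ [[[iw sti] Xz] Aw]]; split => //.
  move: iw sti Xz; rewrite /has_jump /= X0_init => iw sti Xz.
  have := jump_time_oc i s t w; rewrite iw sti /= => /esym/andP[a b].
  by rewrite /X Xz; exact: level_index a b.
move=> [Aw /andP[]]; rewrite /X => a b.
have [i iE] : exists i : nat, z = init w + i%:Z.
  by exists `|z - init w|%N; lia.
exists i => //; rewrite /E; split => //.
have : (i < size (jumps w))%N && (s < jump_time i w <= t).
  by rewrite iE in a b; rewrite jump_time_oc; exact: index_level a b.
by move=> /andP[? ?]; split; [split|rewrite /= X0_init iE addrK].
Qed.

Variables (l : R -> int -> R) (L : R).
Hypothesis rl : regular l L.
Let l_gt0 t z : 0 < l t z. Proof. by case: rl => _ /(_ t z)/andP[]. Qed.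

(** The compensator as a measure: it will agree with [jump_measure] on the
    predictable sets. *)
Definition intensity_measure :
    {measure set (measurableTypeR R * T) -> \bar R} :=
  weighted (leb \x P)%E (measurable_intensity rl) (fun p => ltW (l_gt0 p.1 (Xleft p.1 p.2))).

Lemma intensity_measureE (s t : R) (B : set (measurableTypeR R * T)) : measurable B ->
  intensity_measure [set p | s < p.1 <= t /\ B p] =
  (\int[P]_w \int[leb]_(v in `]s, t]) (\1_B (v, w) * l v (Xleft v w))%:E)%E.
Proof.
move=> mB; rewrite /intensity_measure /= /weighted.
pose E : set (measurableTypeR R * T) := [set p | s < p.1 <= t].
have mE : measurable E.
  have : measurable (@fst (measurableTypeR R) T @^-1` `]s, t]).
    by rewrite -[X in measurable X]setTI; apply: measurable_fst.
  have -> // : fst @^-1` `]s, t] = E.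
  by apply/seteqP; split => w /=; rewrite in_itv.
have mf : measurable_fun setT (fun p : measurableTypeR R * T => (\1_B p * l p.1 (Xleft p.1 p.2))).
  by apply: measurable_funM; [exact: measurable_indic|exact: (measurable_intensity rl)].
have f0 (p : measurableTypeR R * T) : 0 <= \1_B p * l p.1 (Xleft p.1 p.2).
  by apply: mulr_ge0; [rewrite indicE ler0n|exact: ltW].
have mg : measurable_fun setT (fun p : measurableTypeR R * T =>
    (\1_E p * (\1_B p * l p.1 (Xleft p.1 p.2)))%:E).
  by apply/measurable_EFinP; apply: measurable_funM => //; exact: measurable_indic.
rewrite integral_indicM.
rewrite (eq_integral (fun p : measurableTypeR R * T =>
    (\1_E p * (\1_B p * l p.1 (Xleft p.1 p.2)))%:E)); last first.
  by move=> p _; rewrite mulrA [X in (X * _)%:E](_ : _ = \1_E p * \1_B p)//; exact: (congr1 (@^~ p) (indicI R E B)).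
rewrite (@fubini_tonelli2 _ _ _ _ _ leb P _ mg); last first.
  by move=> p; rewrite lee_fin; apply: mulr_ge0 => //; rewrite indicE ler0n.
apply: eq_integral => w _; rewrite /fubini_G [RHS]integral_mkcond.
apply: eq_integral => v _; rewrite /= patchE.
case: ifPn => [|]; rewrite /= indicE.
  rewrite inE/= in_itv/= => vE; rewrite mem_set ?mul1r//.
rewrite notin_setE/= in_itv/= => vE; rewrite memNset ?mul0r//.
Qed.

(** The boxes ]a,b] x A with [A] known at time [a] generate the predictable
    sigma-field; the whole space is added to have a cover. *)
Definition predictable_box : set (set (measurableTypeR R * T)) :=
  [set E | E = setT \/ exists (a b : R) (A : set T),
    [/\ 0 <= a, a <= b, b <= 1, canonical_filtration a A &
        E = [set p | a < p.1 <= b /\ A p.2]]].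

Lemma predictable_box_measurable : predictable_box `<=` measurable.
Proof.
move=> E [->|[a [b [A [a0 ab b1 aA ->]]]]]; first exact: measurableT.
have mA := filtration_measurable (le_trans ab b1) aA.
have -> : [set p : measurableTypeR R * T | a < p.1 <= b /\ A p.2] = `]a, b]%classic `*` A.
  by apply/seteqP; split => -[v w] /=; rewrite in_itv.
exact: measurableX.
Qed.

Lemma predictable_boxI : setI_closed predictable_box.
Proof.
move=> E E' [->|[a [b [A [a0 ab b1 aA ->]]]]].
  by rewrite setTI.
move=> [->|[a' [b' [A' [a'0 ab' b'1 aA' ->]]]]].
  by rewrite setIT; right; exists a, b, A.
(* The outer maximum keeps the end point above the origin when the
   two intervals are disjoint. *)
right; exists (Num.max a a'), (Num.max (Num.max a a') (Num.min b b')), (A `&` A'); split.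
- by rewrite le_max a0.
- by rewrite le_max lexx.
- by rewrite !ge_max ge_min b1 (le_trans ab b1) (le_trans ab' b'1).
- apply: sigma_algebraI; [apply: filtration_homo aA|apply: filtration_homo aA'].
    by rewrite le_max lexx.
  by rewrite le_max lexx orbT.
apply/seteqP; split => -[v w] /=.
  move=> [[/andP[av vb] Aw] [/andP[av' vb'] Aw']]; split => //.
  by rewrite gt_max av av' le_max le_min vb vb' orbT.
rewrite gt_max le_max !le_min leNgt gt_max -andbA => -[/and3P[-> -> /=]].
by move=> /andP[-> ->] [].
Qed.

(** By [Xleft_ge_rat] the set is a countable union, over rational times [q] in
    ]s,t[, of boxes ]q,t] x (A and [z <= X q]). *)
Lemma level_predictable (s t : R) (z : int) (A : set T) : 0 <= s -> s <= t -> t <= 1 ->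
  canonical_filtration s A ->
  <<s predictable_box >> [set p | s < p.1 <= t /\ (A p.2 /\ z <= Xleft p.1 p.2)].
Proof.
move=> s0 st t1 sA.
pose B (q : rat) : set (measurableTypeR R * T) := if s < ratr q < t then
  [set p | ratr q < p.1 <= t /\ (A `&` [set w | z <= X (ratr q) w]) p.2] else set0.
have -> : [set p | s < p.1 <= t /\ (A p.2 /\ z <= Xleft p.1 p.2)] = \bigcup_q B q.
  apply/seteqP; split => -[v w] /=.
    move=> [/andP[sv vt] [Aw /Xleft_ge_rat[q [qv zq]]]].
    have : Num.max s (ratr q) < v by rewrite gt_max sv.
    move=> /rat_in_itvoo[r]; rewrite in_itv/= gt_max => /andP[/andP[sr qr] rv].
    exists r => //; rewrite /B sr (lt_le_trans rv vt) /= rv vt; split => //; split => //.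
    exact: le_trans zq (X_homo _ (ltW qr)).
  move=> [q _]; rewrite /B; case: ifPn => // /andP[sq qt] /= [/andP[qv vt] [Aw zq]].
  by rewrite (lt_trans sq qv) vt; split => //; split => //; apply/Xleft_ge_rat; exists q.
apply: (@bigcupT_measurable_rat _ (g_sigma_algebraType predictable_box)) => q.
rewrite /B; case: ifPn => [/andP[sq qt]|_]; last exact: sigma_algebra0.
apply: sub_sigma_algebra; right; exists (ratr q), t, (A `&` [set w | z <= X (ratr q) w]).
split => //; [exact: le_trans s0 (ltW sq)|exact: ltW|].
apply: sigma_algebraI; first exact: filtration_homo (ltW sq) _ sA.
apply: (@filtration_gen _ _ _ [set y | z <= y]).
by rewrite in_itv/= lexx andbT (le_trans s0 (ltW sq)).
Qed.

Lemma level_eq_predictable (s t : R) (z : int) (A : set T) : 0 <= s -> s <= t -> t <= 1 ->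
  canonical_filtration s A ->
  <<s predictable_box >> [set p | s < p.1 <= t /\ (A p.2 /\ Xleft p.1 p.2 = z)].
Proof.
move=> s0 st t1 sA.
have E1 := level_predictable z s0 st t1 sA.
have E2 := level_predictable (z + 1) s0 st t1 sA.
have := sigma_algebraI E1 (sigma_algebraC E2).
congr (<<s _ >> _); apply/seteqP; split => -[v w] /=.
  move=> [[svt [Aw zX]] n]; split => //; split => //.
  apply/eqP; rewrite eq_le zX andbT -ltzD1 ltNge; apply/negP => zX1.
  by apply: n; split => //; split.
move=> [svt [Aw ->]]; split => // -[_ [_]].
by rewrite leNgt ltzD1 lexx.
Qed.

Hypothesis Pc : compensator_of l P.

Let D : set (measurableTypeR R * T) := [set p | 0 < p.1 <= 1 /\ setT p.2].

Let mD : measurable D.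
Proof.
apply: predictable_box_measurable; right; exists 0, 1, setT; split => //.
exact: filtrationT.
Qed.

(** The compensator identity, read on a box. *)
Lemma jump_intensity_box (a b : R) (A : set T) :
  0 <= a -> a <= b -> b <= 1 -> canonical_filtration a A ->
  jump_measure [set p | a < p.1 <= b /\ A p.2] =
  intensity_measure [set p | a < p.1 <= b /\ A p.2].
Proof.
move=> a0 ab b1 aA; have mA := filtration_measurable (le_trans ab b1) aA.
rewrite jump_measure_oc// Pc//.
rewrite (@intensity_measureE a b (snd @^-1` A)); last first.
  by rewrite -[X in measurable X]setTI; apply: measurable_snd.
rewrite integral_indicM; apply: eq_integral => w _.
rewrite EFinM (int_oc_EFin rl) -ge0_integralZl//.
- by apply/measurable_EFinP/measurable_funTS; exact: (measurable_intensity_path rl).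
- by move=> v _; rewrite lee_fin ltW.
Qed.

(** The boxes are stable by intersection, so equality extends to the sigma-field
    they generate; both measures are restricted to the unit time interval. *)
Lemma jump_intensity_predictable E : <<s predictable_box >> E -> E `<=` D ->
  jump_measure E = intensity_measure E.
Proof.
move=> GE ED.
have : mrestr jump_measure mD E = mrestr intensity_measure mD E.
  apply: (@g_sigma_algebra_measure_unique _ _ _ _ predictable_box_measurable
    (fun=> setT) _ _ _ _ predictable_boxI _ _ _ GE).
  - by move=> _; left.
  - by rewrite bigcup_const//; exists 0%N.
  - move=> A' GA; suff : jump_measure (A' `&` D) = intensity_measure (A' `&` D) by [].
    case: GA => [->|[a [b [A [a0 ab b1 aA ->]]]]]; last first.
      rewrite (setIidl _); first exact: jump_intensity_box.
      by move=> [v w] /= [/andP[av vb] _]; rewrite /D /= (le_lt_trans a0 av) (le_trans vb b1).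
    rewrite setTI; exact: jump_intensity_box (lexx 0) ler01 (lexx 1) (@filtrationT R 0).
  - move=> _; suff : (jump_measure (setT `&` D) < +oo)%E by [].
    rewrite setTI jump_measure_oc//.
    rewrite Pc//; last exact: filtrationT.
    by apply: (le_lt_trans (integral_int_oc_le rl P ler01 _ measurableT)); rewrite ?subr0// ltry.
by rewrite /mrestr (setIidl ED).
Qed.

(** Equality of [jump_measure] and [intensity_measure] on the predictable set
    where the left limit equals [z]. *)
Lemma level_crossing (s t : R) (z : int) (A : set T) : 0 <= s -> s <= t -> t <= 1 ->
  canonical_filtration s A ->
  P (A `&` [set w | X s w <= z < X t w]) =
  (\int[leb]_(v in `]s, t]) ((l v z)%:E * P (A `&` [set w | X v w = z])))%E.
Proof.
move=> s0 st t1 sA; have mA := filtration_measurable (le_trans st t1) sA.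
rewrite -(jump_measure_level z st mA).
rewrite jump_intensity_predictable; [|exact: level_eq_predictable|]; last first.
  by move=> [v w] /= [/andP[sv vt] _]; rewrite /D /= (le_lt_trans s0 sv) (le_trans vt t1).
have mAs : measurable (@snd (measurableTypeR R) T @^-1` A).
  by rewrite -[X in measurable X]setTI; apply: measurable_snd.
have mBl : measurable [set p : measurableTypeR R * T | A p.2 /\ Xleft p.1 p.2 = z].
  apply: measurableI; first exact: mAs.
  by rewrite -[X in measurable X]setTI; exact: (measurable_Xleft_joint measurableT (Y := [set z])).
have mB : measurable [set p : measurableTypeR R * T | A p.2 /\ X p.1 p.2 = z].
  apply: measurableI; first exact: mAs.
  by rewrite -[X in measurable X]setTI; exact: (measurable_X_joint measurableT (Y := [set z])).
rewrite (intensity_measureE s t mBl).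
pose h (v : R) (w : T) : R := \1_[set p : measurableTypeR R * T | A p.2 /\ X p.1 p.2 = z] (v, w) * l v z.
have ml z' : measurable_fun setT (l^~ z') by exact: continuous_measurable_fun (proj1 rl z').
have mh : measurable_fun setT (fun p : measurableTypeR R * T => h p.1 p.2).
  apply: measurable_funM; last exact: (measurableT_comp (ml z) measurable_fst).
  rewrite (_ : (fun p => _) = \1_[set p : measurableTypeR R * T | A p.2 /\ X p.1 p.2 = z]).
    exact: measurable_indic.
  by apply/funext => -[].
have h0 v w : 0 <= h v w by apply: mulr_ge0; [rewrite indicE ler0n|exact: ltW].
pose hl (v : R) (w : T) : R :=
  \1_[set p : measurableTypeR R * T | A p.2 /\ Xleft p.1 p.2 = z] (v, w) * l v (Xleft v w).
have mhl : measurable_fun setT (fun p : measurableTypeR R * T => hl p.1 p.2).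
  apply: measurable_funM; last exact: (measurable_intensity rl).
  rewrite (_ : (fun p => _) =
      \1_[set p : measurableTypeR R * T | A p.2 /\ Xleft p.1 p.2 = z]).
    exact: measurable_indic.
  by apply/funext => -[].
transitivity (\int[P]_w \int[leb]_(v in `]s, t]) (h v w)%:E)%E.
  apply: eq_integral => w _; apply: (ae_eq_off_jumps (w := w)).
  - by apply/measurable_EFinP; exact: (measurableT_comp mhl (pair2_measurable w)).
  - by apply/measurable_EFinP; exact: (measurableT_comp mh (pair2_measurable w)).
  - by move=> v; rewrite lee_fin; apply: mulr_ge0; [rewrite indicE ler0n|exact: ltW].
  - by move=> v; rewrite lee_fin.
  move=> u uw; have XE : X u w = Xleft u w by rewrite X_Xleft (negbTE uw) addr0.
  rewrite /h !indicE; congr (_%:E).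
  have [Xz|Xz] := eqVneq (Xleft u w) z; first by rewrite Xz; congr (_%:R * _); congr nat_of_bool; apply/idP/idP; rewrite !inE/= XE.
  by rewrite !memNset ?mul0r//= => -[_]; rewrite ?XE; exact/eqP.
rewrite (@tonelli_time _ _ _ (fun w v => (h v w)%:E)); last 2 first.
- apply/measurable_EFinP; exact: (measurable_comp2 (a := snd) (b := fst) mh).
- by move=> w v; rewrite lee_fin.
apply: eq_integral => v _.
have mAv : measurable (A `&` [set w | X v w = z]).
  by apply: measurableI => //; exact: (@measurable_X_preimage R v [set z]).
transitivity (\int[P]_w ((l v z)%:E * (\1_(A `&` [set w | X v w = z]) w)%:E))%E.
  by apply: eq_integral => w _; rewrite /h mulrC.
rewrite ge0_integralZl//; last 2 first.
- by apply/measurable_EFinP; exact: measurable_indic.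
- by rewrite lee_fin ltW.
by rewrite integral_indic// setIT.
Qed.

End predictable.

(** * Uniqueness of the counting law *)

Section gronwall.
Context {R : realType}.
Local Notation leb := (@lebesgue_measure R).

Lemma int_ocM (f g : R -> R) (a b M : R) :
  measurable_fun setT f -> measurable_fun setT g ->
  (forall v, a < v -> v <= b -> 0 <= f v <= M) ->
  (forall v, a < v -> v <= b -> `|g v| <= f v) -> a <= b ->
  `|int_oc g a b| <= int_oc f a b.
Proof.
move=> mf mg fM gf ab.
have fi : leb.-integrable `]a, b] (EFin \o f).
  apply: (bounded_integrable mf (M := M)) => v av vb.
  by have /andP[f0 fM'] := fM v av vb; rewrite ger0_norm.
have gi : leb.-integrable `]a, b] (EFin \o g).
  apply: (bounded_integrable mg (M := M)) => v av vb.
  by have /andP[f0 fM'] := fM v av vb; rewrite (le_trans (gf v av vb)).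
apply: le_trans (le_normr_Rintegral _ gi) _ => //.
apply: le_Rintegral => //.
  have := integrable_abse gi; apply: eq_integrable => // v _ /=.
by move=> v; rewrite /= in_itv/= => /andP[]; exact: gf.
Qed.

Lemma is_derive_affine (a s v : R) : is_derive v 1 (fun r => a * (r - s)) a.
Proof.
have H : is_derive v (1:R) (fun r : R => a * (r - s)) (a *: (1 - 0)) by apply: is_deriveZ.
by apply: (is_derive_eq H); rewrite subr0 /GRing.scale /= mulr1.
Qed.

Lemma continuous_scale_exp (c a s : R) : continuous (fun v => c * expR (a * (v - s))).
Proof.
move=> v; exact: is_derive_continuous (is_derive_scale_expR c (is_derive_affine a s v)).
Qed.

Lemma int_oc_exp (c s t L : R) : 0 < L -> s <= t ->
  L * int_oc (fun v => c * expR (2 * L * (v - s))) s t =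
  c / 2 * (expR (2 * L * (t - s)) - 1).
Proof.
move=> L0 st.
pose F (v : R) := c / (2 * L) * expR (2 * L * (v - s)).
have dF (v : R) : is_derive v 1 F (c * expR (2 * L * (v - s))).
  apply: (is_derive_eq (is_derive_scale_expR (c / (2 * L)) (is_derive_affine (2 * L) s v))).
  by field; rewrite lt0r_neq0.
rewrite (int_oc_derive st (F := F)).
- by rewrite /F subrr mulr0 expR0; field; rewrite lt0r_neq0.
- exact/continuous_subspaceT/continuous_scale_exp.
Qed.

(** Iterating the inequality gives [|f t| <= 2^-n * exp (2 L (t - s))] for all [n];
    the rate [2 L] in the exponent gains a factor one half at each step. *)
Lemma gronwall_eq0 (f : R -> R) (L s u : R) : 0 < L -> measurable_fun setT f ->
  (forall t, s <= t -> t <= u -> `|f t| <= 1) ->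
  (forall t, s <= t -> t <= u -> `|f t| <= L * int_oc (fun v => `|f v|) s t) ->
  forall t, s <= t -> t <= u -> f t = 0.
Proof.
move=> L0 mf f1 fL.
have bound n t : s <= t -> t <= u -> `|f t| <= (2^-1) ^+ n * expR (2 * L * (t - s)).
  elim: n t => [|n IH] t st tu.
    rewrite expr0 mul1r (le_trans (f1 t st tu))// -expR0 ler_expR.
    by rewrite mulr_ge0 ?subr_ge0// mulr_ge0// ltW.
  apply: le_trans (fL t st tu) _.
  have H : L * int_oc (fun v => `|f v|) s t <=
      L * int_oc (fun v => (2^-1) ^+ n * expR (2 * L * (v - s))) s t.
    apply: (ler_wpM2l (ltW L0)); apply: le_trans (ler_norm _) _.
    apply: (@int_ocM _ _ _ _ (expR (2 * L * (t - s)))) => //.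
    - exact: (continuous_measurable_fun (@continuous_scale_exp _ _ _)).
    - exact: measurableT_comp.
    - move=> v sv vt; rewrite mulr_ge0 ?exprn_ge0 ?expR_ge0//=.
      rewrite -[leRHS]mul1r ler_pM ?exprn_ge0 ?expR_ge0//.
        by rewrite exprn_ile1// invf_le1// ler1n.
      by rewrite ler_expR ler_pM2l ?mulr_gt0// lerB.
    - move=> v sv vt; rewrite normr_id; apply: IH (ltW sv) (le_trans vt tu).
  apply: le_trans H _; rewrite int_oc_exp// exprSr.
  rewrite ler_wpM2l ?mulr_ge0 ?exprn_ge0//.
  by rewrite lerBlDr lerDl.
move=> t st tu; apply/eqP/negPn/negP => ft.
have f0 : 0 < `|f t| by rewrite normr_gt0.
pose C := expR (2 * L * (t - s)).
pose n := Num.truncn (C / `|f t|).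
have : C / `|f t| < n.+1%:R by exact: truncnS_gt.
rewrite ltNge => /negP; apply.
rewrite ler_pdivlMr//.
apply: (@le_trans _ _ (2 ^+ n.+1 * `|f t|)); first by rewrite ler_wpM2r// natr_le_expr2.
have := bound n.+1 t st tu; rewrite -/C exprVn.
rewrite -(ler_pM2l (x := 2 ^+ n.+1)) ?exprn_gt0// mulrA divff ?mul1r//.
Qed.

End gronwall.

Section occupation.
Context {R : realType}.
Notation T := (counting_path R).
Local Notation leb := (@lebesgue_measure R).
Implicit Types (w : T) (s t u : R) (x : int).
Variables (l : R -> int -> R) (L : R).
Hypothesis rl : regular l L.
Let l_gt0 t z : 0 < l t z. Proof. by case: rl => _ /(_ t z)/andP[]. Qed.
Let l_le t z : l t z <= L. Proof. by case: rl => _ /(_ t z)/andP[]. Qed.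
Let L_gt0 : 0 < L. Proof. exact: lt_le_trans (l_gt0 0 0) (l_le 0 0). Qed.
Variable (P : probability T R) (A : set T).
Hypothesis mA : measurable A.

(** Occupation probabilities on the event [A]. *)
Definition occ (z : int) (v : R) : R := fine (P (A `&` [set w | X v w = z])).

Let mAX (v : R) (B : set int) : measurable (A `&` [set w | B (X v w)]).
Proof. by apply: measurableI => //; exact: (@measurable_X_preimage R v B). Qed.

Lemma occE z v : P (A `&` [set w | X v w = z]) = (occ z v)%:E.
Proof. by rewrite /occ fineK// fin_num_measure//; exact: (mAX v [set z]). Qed.

Lemma occ_ge0 z v : 0 <= occ z v.
Proof. by rewrite /occ fine_ge0. Qed.

Lemma occ_le1 z v : occ z v <= 1.
Proof. by rewrite -lee_fin -occE; apply: probability_le1; exact: (mAX v [set z]). Qed.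

Lemma measurable_occ z : measurable_fun setT (occ z).
Proof.
pose h (v : R) w : \bar R := (\1_[set p : measurableTypeR R * T | A p.2 /\ X p.1 p.2 = z] (v, w))%:E.
have mB : measurable [set p : measurableTypeR R * T | A p.2 /\ X p.1 p.2 = z].
  apply: measurableI.
    have : measurable (@snd (measurableTypeR R) T @^-1` A).
      by rewrite -[X in measurable X]setTI; apply: measurable_snd.
    by [].
  by rewrite -[X in measurable X]setTI; exact: (measurable_X_joint measurableT (Y := [set z])).
have mh : measurable_fun setT (fun p : measurableTypeR R * T => h p.1 p.2).
  rewrite (_ : (fun p => _) =
      EFin \o \1_[set p : measurableTypeR R * T | A p.2 /\ X p.1 p.2 = z]).
    by apply/measurable_EFinP; exact: measurable_indic.
  by apply/funext => -[].
have := measurable_integral P mh (fun v w => _).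
move=> /(_ (fun _ _ => ler0n _ _)) mI.
rewrite (_ : occ z = fun v => fine (\int[P]_w h v w)%E).
  exact: measurableT_comp mI.
apply/funext => v; rewrite /occ; congr fine.
rewrite -[RHS]/(\int[P]_w (\1_(A `&` [set w | X v w = z]) w)%:E)%E.
by rewrite integral_indic ?setIT//; exact: (mAX v [set z]).
Qed.

Definition flux (z : int) (s t : R) : R := int_oc (fun v => l v z * occ z v) s t.

Lemma measurable_flux z : measurable_fun setT (fun v => l v z * occ z v).
Proof.
apply: measurable_funM; last exact: measurable_occ.
exact: continuous_measurable_fun (proj1 rl z).
Qed.

Lemma integrable_flux z (s t : R) :
  leb.-integrable `]s, t] (EFin \o (fun v => l v z * occ z v)).
Proof.
apply: (bounded_integrable (measurable_flux z) (M := L)) => v _ _.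
rewrite ger0_norm; last by rewrite mulr_ge0 ?occ_ge0// ltW.
by rewrite -[leRHS]mulr1 ler_pM ?occ_ge0 ?occ_le1// ltW.
Qed.

Hypothesis Pc : compensator_of l P.

(** The forward equation for an arbitrary solution of the problem: mass leaves
    level [z] at rate [l _ z] and arrives from level [z - 1]. *)
Lemma occ_evolution z s t : 0 <= s -> s <= t -> t <= 1 -> canonical_filtration s A ->
  occ z t = occ z s - flux z s t + flux (z - 1) s t.
Proof.
move=> s0 st t1 sA.
pose below y v := fine (P (A `&` [set w | X v w <= y])).
have belowE y v : P (A `&` [set w | X v w <= y]) = (below y v)%:E.
  by rewrite /below fineK// fin_num_measure//; exact: (mAX v [set k | k <= y]).
have occ_below y v : occ y v = below y v - below (y - 1) v.
  have U : P (A `&` [set w | X v w <= y]) =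
      P (A `&` [set w | X v w = y]) + P (A `&` [set w | X v w <= y - 1]).
    rewrite -measureU; [|exact: (mAX v [set y])|exact: (mAX v [set k | k <= y - 1])|].
      rewrite -setIUr; congr (P (A `&` _)); apply/seteqP; split => w /=; lia.
    by apply/seteqP; split => // w [[_ /= Xy] [_ /=]]; lia.
  by move: U; rewrite !belowE occE -EFinD => -[->]; lra.
have crossing y : below y t = below y s - flux y s t.
  have E : P (A `&` [set w | X s w <= y < X t w]) = (flux y s t)%:E.
    rewrite (level_crossing rl Pc)//.
    transitivity (\int[leb]_(v in `]s, t]) (l v y * occ y v)%:E)%E.
      by apply: eq_integral => v _; rewrite occE.
    rewrite /flux /int_oc /Rintegral fineK//; apply: integrable_fin_num => //.
    exact: integrable_flux.
  have mC : measurable (A `&` [set w | X s w <= y < X t w]).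
    rewrite (_ : _ `&` _ = (A `&` [set w | X s w <= y]) `&` (A `&` [set w | y < X t w])).
      by apply: measurableI; [exact: (mAX s [set k | k <= y])|exact: (mAX t [set k | y < k])].
    by apply/seteqP; split => w /=; [move=> [Aw /andP[]]|move=> [[? ->] [_ ->]]].
  have U : P (A `&` [set w | X s w <= y]) =
      P (A `&` [set w | X s w <= y < X t w]) + P (A `&` [set w | X t w <= y]).
    rewrite -measureU //; [|exact: (mAX t [set k | k <= y])|].
      rewrite -setIUr; congr (P (A `&` _)); apply/seteqP; split => w /=; have := X_homo w st; lia.
    by apply/seteqP; split => // w [[_ /= Xy] [_ /=]]; lia.
  by move: U; rewrite E !belowE -EFinD => -[->]; lra.
rewrite !occ_below !crossing; lra.
Qed.

Lemma occ_below_start x z v : 0 <= v -> P [set w | X 0 w = x] = 1%E -> z < x -> occ z v = 0.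
Proof.
clear rl l_gt0 l_le L_gt0; move=> v0 P0 zx; rewrite /occ (_ : P _ = 0)//.
apply/eqP; rewrite -measure_le0.
have m0 := @measurable_X_preimage R 0 [set x].
apply: (@le_trans _ _ (P (~` [set w | X 0 w = x]))).
  apply: le_measure; rewrite ?inE.
  - exact: (mAX v [set z]).
  - exact: measurableC m0.
  - move=> w [_ /= Xz] X0; have := X_homo w v0; rewrite Xz X0; lia.
by rewrite probability_setC// P0 subee.
Qed.

End occupation.

Section uniqueness.
Context {R : realType}.
Notation T := (counting_path R).
Local Notation leb := (@lebesgue_measure R).
Implicit Types (w : T) (s t u : R) (x : int).
Variables (l : R -> int -> R) (L : R).
Hypothesis rl : regular l L.
Let l_gt0 t z : 0 < l t z. Proof. by case: rl => _ /(_ t z)/andP[]. Qed.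
Let l_le t z : l t z <= L. Proof. by case: rl => _ /(_ t z)/andP[]. Qed.
Let L_gt0 : 0 < L. Proof. exact: lt_le_trans (l_gt0 0 0) (l_le 0 0). Qed.
Variables (P Q : probability T R) (x : int).
Hypotheses (P0 : P [set w | X 0 w = x] = 1%E) (Q0 : Q [set w | X 0 w = x] = 1%E).
Hypotheses (Pc : compensator_of l P) (Qc : compensator_of l Q).

(** Induction on the level, upwards from [x], below which both occupations vanish.
    Once the inflow from the lower level is the same for both laws, the difference
    of the occupations satisfies a linear Volterra equation without source term. *)
Lemma occ_unique (A : set T) s : 0 <= s -> s <= 1 -> canonical_filtration s A ->
  (forall z, occ P A z s = occ Q A z s) ->
  forall z t, s <= t -> t <= 1 -> occ P A z t = occ Q A z t.
Proof.
move=> s0 s1 sA PQs; have mA := filtration_measurable s1 sA.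
have low z t : s <= t -> z < x -> occ P A z t = occ Q A z t.
  by move=> st zx; rewrite (occ_below_start mA _ P0)// ?(occ_below_start mA _ Q0)//; exact: le_trans st.
suff up n t : s <= t -> t <= 1 -> occ P A (x - 1 + n%:Z) t = occ Q A (x - 1 + n%:Z) t.
  move=> z t st t1; have [zx|xz] := ltP z x; first exact: low.
  have [n ->] : exists n : nat, z = x - 1 + n%:Z.
    by exists (absz (z - (x - 1))%R); lia.
  exact: up.
elim: n t => [|n IH] t st t1; first by apply: low => //; lia.
pose z := x - 1 + n.+1%:Z.
have z1 : z - 1 = x - 1 + n%:Z by rewrite /z; lia.
pose f v := occ P A z v - occ Q A z v.
apply/eqP; rewrite -subr_eq0; apply/eqP; rewrite -/z -/(f t).
have mf : measurable_fun setT f by apply: measurable_funB; exact: measurable_occ.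
have f1 v : `|f v| <= 1.
  have := occ_ge0 P A z v; have := occ_ge0 Q A z v.
  have := occ_le1 P mA z v; have := occ_le1 Q mA z v.
  by rewrite /f ler_norml => *; apply/andP; split; lra.
apply: (@gronwall_eq0 _ f L s 1 L_gt0 mf) => // r sr r1.
have E : f r = int_oc (fun v => - (l v z * f v)) s r.
  rewrite /f (occ_evolution rl mA Pc z s0 sr r1 sA) (occ_evolution rl mA Qc z s0 sr r1 sA).
  rewrite PQs z1 (_ : flux l Q A (x - 1 + n%:Z) s r = flux l P A (x - 1 + n%:Z) s r); last first.
    by apply: eq_int_oc => v sv vr; rewrite IH// (ltW sv, le_trans vr r1)// ltW.
  transitivity (flux l Q A z s r - flux l P A z s r); first by lra.
  rewrite /flux /int_oc -RintegralB//; last 2 first.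
    exact: (integrable_flux rl Q mA z s r).
    exact: (integrable_flux rl P mA z s r).
  by apply: (@eq_int_oc _ _ _ s r) => v _ _; ring.
have mL : measurable_fun setT (fun v => L * `|f v|).
  by apply: measurable_funM => //; exact: measurableT_comp.
rewrite E; apply: le_trans (@int_ocM _ (fun v => L * `|f v|) _ s r L _ _ _ _ sr) _ => //.
- apply: measurableT_comp => //; apply: measurable_funM => //.
  exact: continuous_measurable_fun (proj1 rl z).
- move=> v _ _; rewrite (mulr_ge0 (ltW L_gt0) (normr_ge0 _)) /=.
  by rewrite -[leRHS]mulr1 (ler_pM2l L_gt0).
- by move=> v _ _; rewrite normrN normrM ler_wpM2r// ger0_norm ?l_le// ltW.
rewrite /int_oc RintegralZl//.
apply: (@bounded_integrable _ _ _ _ 1); first exact: measurableT_comp.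
by move=> v _ _; rewrite normr_id.
Qed.

Definition cylinder (c : seq (R * int)) : set T := [set w | all (fun p => X p.1 w == p.2) c].

Lemma cylinder_cons p c : cylinder (p :: c) = cylinder c `&` [set w | X p.1 w = p.2].
Proof.
apply/seteqP; split => w /=; first by move=> /andP[/eqP ? ?].
by move=> [cw /eqP pw]; rewrite /cylinder /= pw.
Qed.

Lemma cylinder_filtration s c : all (fun p => 0 <= p.1 <= s) c ->
  canonical_filtration s (cylinder c).
Proof.
elim: c => [_|p c IH /= /andP[ps cs]].
  rewrite (_ : cylinder [::] = setT); first exact: filtrationT.
  by apply/seteqP; split.
rewrite cylinder_cons; apply: sigma_algebraI; first exact: IH.
by apply: (@filtration_gen _ _ _ [set p.2]); rewrite in_itv.
Qed.

(** The latest constraint of the cylinder is added by [occ_unique], started at the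
    time of the previous one. *)
Lemma cylinder_sorted_unique c : sorted (fun p q : R * int => q.1 <= p.1) c ->
  all (fun p => 0 <= p.1 <= 1) c -> P (cylinder c) = Q (cylinder c).
Proof.
have mX t z : measurable [set w : T | X t w = z] := @measurable_X_preimage R t [set z].
elim: c => [_ _|p c IH pc /= /andP[/andP[p0 p1] c01]].
  rewrite (_ : cylinder [::] = setT); first by rewrite !probability_setT.
  by apply/seteqP; split.
have {}IH := IH (path_sorted pc) c01.
(* With no earlier constraint, start at time 0, where the law of X is
   the Dirac mass at x. *)
have : exists s, [/\ 0 <= s, s <= p.1, canonical_filtration s (cylinder c) &
    forall z, occ P (cylinder c) z s = occ Q (cylinder c) z s].
  case: c => [|q c] in IH pc c01 *.
    exists 0; split => //; first exact: cylinder_filtration.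
    move=> z; rewrite /occ (_ : cylinder [::] = setT); last by apply/seteqP; split.
    rewrite setTI; have [->|zx] := eqVneq z x; first by rewrite P0 Q0.
    have null (S : probability T R) : S [set w | X 0 w = x] = 1%E -> S [set w | X 0 w = z] = 0%E.
      move=> S0; apply/eqP; rewrite -measure_le0.
      apply: (@le_trans _ _ (S (~` [set w | X 0 w = x]))).
        apply: le_measure; rewrite ?inE//; first exact: measurableC.
        by move=> w /= -> /eqP; rewrite (negbTE zx).
      by rewrite probability_setC// S0 subee.
    by rewrite !null.
  move: pc => /= /andP[qp qc]; have /= /andP[/andP[q0 q1] c01'] := c01.
  exists q.1; split => //.
    apply: cylinder_filtration; rewrite /= q0 lexx /=.
    have tr : transitive (fun p q : R * int => q.1 <= p.1) by move=> a b d ab bd; exact: le_trans bd ab.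
    apply/allP => r rc; have /andP[-> _] := allP c01' r rc.
    by have /allP/(_ r rc) := order_path_min tr qc.
  move=> z; rewrite /occ; have [->|zq] := eqVneq z q.2.
    rewrite (_ : _ `&` _ = cylinder (q :: c)) ?IH//.
    by apply/seteqP; split => w /=; [case|move=> /andP[/eqP ? ?]; split; [apply/andP; split => //; apply/eqP|]].
  rewrite (_ : _ `&` _ = set0) ?measure0//; apply/seteqP; split => // w /= [/andP[/eqP -> _] /esym/eqP].
  by rewrite (negbTE zq).
move=> [s [s0 sp sc PQs]].
have := occ_unique s0 (le_trans sp p1) sc PQs p.2 sp p1.
have mc := filtration_measurable (le_trans sp p1) sc.
by rewrite cylinder_cons !(occE _ mc) => ->.
Qed.

Lemma counting_law_unique A : measurable A -> P A = Q A.
Proof.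
pose G : set (set T) := [set A | exists2 c, all (fun p => 0 <= p.1 <= 1) c & A = cylinder c].
have GT : G setT by exists [::] => //; apply/seteqP; split.
move=> mA; apply: (@g_sigma_algebra_measure_unique _ _ _ G _ (fun=> setT)).
- by move=> _ [c c01 ->]; apply: (filtration_measurable (lexx 1)); exact: cylinder_filtration.
- by move=> _.
- by rewrite bigcup_const//; exists 0%N.
- move=> _ _ [c c01 ->] [c' c01' ->]; exists (c ++ c'); first by rewrite all_cat c01.
  by apply/seteqP; split => w; rewrite /cylinder /= all_cat => /andP.
- move=> _ [c c01 ->].
  pose r := (fun p q : R * int => q.1 <= p.1).
  have rt : total r by move=> p q; exact: le_total.
  have <- : cylinder (sort r c) = cylinder c.
    by apply/seteqP; split => w; rewrite /cylinder /= all_sort.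
  by apply: cylinder_sorted_unique; [exact: sort_sorted|rewrite all_sort].
- by move=> _; apply: (le_lt_trans _ (ltry (1:R))); exact: probability_le1.
move: A mA; apply: smallest_sub; first exact: smallest_sigma_algebra.
move=> _ [s s01 [B _ <-]]; rewrite setTI.
rewrite (_ : _ @^-1` _ = \bigcup_(z in B) [set w | X s w = z]); last first.
  by apply/seteqP; split => w /=; [move=> Bw; exists (X s w)|move=> [z Bz ->]].
rewrite bigcup_mkcond.
apply: (@countable_bigcupT_measurable _ (g_sigma_algebraType G)) => // z.
case: ifPn => _; last exact: sigma_algebra0.
apply: sub_sigma_algebra; exists [:: (s, z)].
  by move: s01; rewrite /= in_itv/= andbT.
by rewrite cylinder_cons; apply/seteqP; split => w /=; [|case].
Qed.

End uniqueness.

(** * Derivatives on the unit interval, and continuation of intensities *)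

Section clamp.
Context {R : realType}.
Notation T := (counting_path R).
Local Notation leb := (@lebesgue_measure R).
Implicit Types (w : T) (s t u : R) (x : int) (l : R -> int -> R).

Definition clamp t : R := Num.max 0 (Num.min 1 t).

Lemma clamp01 t : 0 <= clamp t <= 1.
Proof. by rewrite /clamp le_max lexx ge_max ler01 ge_min lexx. Qed.

Lemma clamp_id t : 0 <= t -> t <= 1 -> clamp t = t.
Proof. by move=> t0 t1; rewrite /clamp min_r// max_r. Qed.

Lemma clamp_lip s t : `|clamp s - clamp t| <= `|s - t|.
Proof.
have := ler_norm (s - t); have := ler_norm (t - s); rewrite distrC ler_norml /clamp.
move: `|s - t| => n.
move=> h1 h2; case: (leP 1 s) => s1; case: (leP 1 t) => t1; rewrite ?(max_r ler01);
  case: (leP 0 s) => a; case: (leP 0 t) => b; apply/andP; split; lra.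
Qed.

(** Differentiability along [D] in the form of a first-order expansion; for the unit
    interval it is the convergence of difference quotients, for the whole line it is
    the usual derivative, and the two can thus be compared. *)
Definition linear_at (D : set R) (f : R -> R) (t a : R) : Prop :=
  forall e, 0 < e -> exists2 d, 0 < d &
    forall s, D s -> `|s - t| < d -> `|f s - f t - a * (s - t)| <= e * `|s - t|.

Lemma linear_quotient (f : R -> R) (t a s : R) : s != t ->
  f s - f t - a * (s - t) = (diff_quotient f t s - a) * (s - t).
Proof. by move=> st; rewrite mulrBl /diff_quotient divfK// subr_eq0. Qed.

Lemma diff_quotient_linear (f : R -> R) (t a : R) :
  diff_quotient f t @ within `[0, 1] t^' --> a <-> linear_at `[0, 1]%classic f t a.
Proof.
split=> [/cvgrPdist_le H e e0|H].
  have := H e e0; rewrite near_withinE near_withinE => -[d /= d0 Hd]; exists d => //.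
  move=> s s01 std; have [->|st] := eqVneq s t.
    by rewrite !subrr mulr0 subr0 normr0 mulr0.
  rewrite linear_quotient// normrM ler_wpM2r// distrC; apply: Hd => //.
  by rewrite /= distrC.
apply/cvgrPdist_le => e e0; have [d d0 Hd] := H e e0.
rewrite near_withinE near_withinE; exists d => // s /= std st s01.
rewrite distrC in std; have := Hd s s01 std.
rewrite linear_quotient// normrM ler_pM2r ?normr_gt0 ?subr_eq0//.
by rewrite distrC.
Qed.

Lemma is_derive_linear (f : R -> R) (t a : R) :
  is_derive t 1 f a <-> linear_at setT f t a.
Proof.
have E h : h != 0 -> h^-1 *: (f (h *: (1:R) + t) - f t) = diff_quotient f t (h + t).
  by move=> h0; rewrite /diff_quotient /GRing.scale /= mulr1 addrK mulrC.
split=> [[fd fE] e e0|H].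
  have /cvgrPdist_le/(_ e e0) : h^-1 *: (f (h *: (1:R) + t) - f t) @[h --> 0^'] --> a.
    by rewrite -fE; exact: fd.
  rewrite near_withinE => -[d /= d0 Hd]; exists d => // s _ std.
  have [->|st] := eqVneq s t; first by rewrite !subrr mulr0 subr0 normr0 mulr0.
  have st0 : s - t != 0 by rewrite subr_eq0.
  have := Hd (s - t); rewrite /= sub0r normrN => /(_ std st0).
  rewrite E// subrK linear_quotient// normrM distrC => ?.
  by rewrite ler_wpM2r.
have C : h^-1 *: (f (h *: (1:R) + t) - f t) @[h --> 0^'] --> a.
  apply/cvgrPdist_le => e e0; have [d d0 Hd] := H e e0.
  rewrite near_withinE; exists d => // h /=; rewrite sub0r normrN => hd h0.
  rewrite -[X in `|X| < d](addrK t) in hd; have := Hd (h + t) I hd.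
  have ht : h + t != t by rewrite -subr_eq0 addrK.
  rewrite linear_quotient// normrM ler_pM2r ?normr_gt0 ?addrK//.
  by rewrite E// distrC.
by apply: DeriveDef; [apply/cvg_ex; exists a|exact: cvg_lim C].
Qed.

(** A function differentiable at [t] within the unit interval is extended
    affinely outside of it, so that the ordinary rules of derivation apply. *)
Definition affine_ext (f : R -> R) (t a s : R) : R :=
  if 0 <= s <= 1 then f s else f t + a * (s - t).

Lemma affine_extE (f : R -> R) (t a s : R) : 0 <= s <= 1 -> affine_ext f t a s = f s.
Proof. by rewrite /affine_ext => ->. Qed.

Lemma is_derive_affine_ext (f : R -> R) (t a : R) : 0 <= t <= 1 ->
  linear_at `[0, 1]%classic f t a -> is_derive t 1 (affine_ext f t a) a.
Proof.
move=> t01 H; apply/is_derive_linear => e e0; have [d d0 Hd] := H e e0.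
exists d => // s _ std; rewrite (@affine_extE f t a t t01) /affine_ext.
case: ifPn => s01; first by apply: Hd => //=; rewrite in_itv.
by rewrite (addrC (f t)) addrK subrr normr0 mulr_ge0// ltW.
Qed.

Lemma is_derive_linear01 (f g : R -> R) (t a : R) : 0 <= t <= 1 ->
  (forall s, 0 <= s <= 1 -> f s = g s) -> is_derive t 1 g a ->
  linear_at `[0, 1]%classic f t a.
Proof.
move=> t01 fg /is_derive_linear H e e0; have [d d0 Hd] := H e e0.
exists d => // s; rewrite /= in_itv/= => s01 std.
by rewrite !fg//; exact: Hd.
Qed.

Lemma linear_continuous_clamp (f : R -> R) :
  (forall t, 0 <= t <= 1 -> exists a, linear_at `[0, 1]%classic f t a) ->
  continuous (f \o clamp).
Proof.
move=> H t; have c01 := clamp01 t; have [a /(_ 1 ltr01)[d d0 Hd]] := H _ c01.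
apply/cvgrPdist_le => e e0.
have M10 : 0 < `|a| + 1 by rewrite ltr_wpDl.
apply/nbhs_ballP; exists (Num.min d (e / (`|a| + 1))); first by rewrite /= lt_min d0 divr_gt0.
move=> s; rewrite /ball /= lt_min => /andP[std ste].
have cst := clamp_lip s t; rewrite [leRHS]distrC in cst.
have := Hd (clamp s); rewrite /= in_itv/= clamp01 => /(_ isT (le_lt_trans cst std)) B.
rewrite distrC; apply: (@le_trans _ _ ((`|a| + 1) * `|clamp s - clamp t|)).
  rewrite mulrDl -normrM mul1r -lerBlDl; apply: le_trans (lerB_dist _ _) _.
  by rewrite mul1r in B.
apply: (@le_trans _ _ ((`|a| + 1) * `|t - s|)); first by rewrite ler_wpM2l// ltW.
by rewrite mulrC -ler_pdivlMr// ltW.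
Qed.

Definition clamped l t z := l (clamp t) z.

(** Differentiability on the unit interval gives continuity there, and the
    continuation by constants is continuous on the line. *)
Lemma NMC_regular l : NMC l -> exists L, regular (clamped l) L.
Proof.
move=> [[L L0 lL] lC]; exists L; split; last first.
  by move=> t z; have [] := lL (clamp t) z; rewrite ?in_itv/= ?clamp01// => -> ->.
move=> z; apply: (@linear_continuous_clamp (l^~ z)) => t t01; have [dq _] := lC z.
exists (lim (diff_quotient (l^~ z) t @ within `[0, 1] t^')).
by apply/diff_quotient_linear; apply: dq; rewrite in_itv.
Qed.

Lemma compensated_clamped l t w : t <= 1 -> compensated (clamped l) t w = compensated l t w.
Proof.
move=> t1; rewrite /compensated; congr (_ - _).
apply: eq_Rintegral => s; rewrite inE/= in_itv/= => /andP[s0 st].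
by rewrite /clamped clamp_id// (le_trans st).
Qed.

Lemma eq_martingale (P : probability T R) (M N : R -> T -> R) :
  (forall t, t \in `[0, 1] -> M t = N t) ->
  martingale P (@canonical_filtration R) M -> martingale P (@canonical_filtration R) N.
Proof.
move=> MN [ad ig mg]; split => [t t01 B mB|t t01|s t s0 st t1 A sA].
- by rewrite -MN//; exact: ad.
- by rewrite -MN//; exact: ig.
have ti : t \in `[0, 1] by rewrite in_itv/= (le_trans s0 st) t1.
have si : s \in `[0, 1] by rewrite in_itv/= s0 (le_trans st t1).
by rewrite -(MN _ ti) -(MN _ si); exact: mg.
Qed.

Lemma eq_local_martingale (P : probability T R) (M N : R -> T -> R) :
  (forall t w, t \in `[0, 1] -> M t w = N t w) ->
  local_martingale P (@canonical_filtration R) M ->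
  local_martingale P (@canonical_filtration R) N.
Proof.
move=> MN [tau [tauS tauC tauM]]; exists tau; split => // n.
apply: eq_martingale (tauM n) => t; rewrite in_itv/= => /andP[t0 t1].
apply/funext => w; rewrite /stopped; apply: MN.
have [tau0 _] := tauS n.
have /andP[a b] := clock_bounds t0 (tau0 w).
by rewrite in_itv/= a (le_trans b).
Qed.

(** Times stay in the unit interval, also after stopping, and there the
    continued intensity is the original one. *)
Lemma is_counting_law_clamped l x : is_counting_law (clamped l) x = is_counting_law l x.
Proof.
have E t w : t \in `[0, 1] -> compensated (clamped l) t w = compensated l t w.
  by rewrite in_itv/= => /andP[_ t1]; exact: compensated_clamped.
apply/funext => P; apply/propext; apply: conj => -[P0 Ploc].
  exact: (conj P0 (eq_local_martingale E Ploc)).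
exact: (conj P0 (eq_local_martingale (fun t w t01 => esym (E t w t01)) Ploc)).
Qed.

(** Existence makes the chosen law a solution, uniqueness identifies it with the
    explicit one. *)
Lemma counting_lawE l L (rl : regular (clamped l) L) x A : measurable A ->
  counting_law l x A = law rl x A.
Proof.
move=> mA; rewrite /counting_law -is_counting_law_clamped.
have [C0 Cloc] : is_counting_law (clamped l) x (get (is_counting_law (clamped l) x)).
  by apply: getPex; exists (law rl x); exact: law_is_counting_law.
have [W0 Wloc] := law_is_counting_law rl x.
apply: (counting_law_unique rl C0 W0) mA.
  exact: local_martingale_compensator rl _ Cloc.
exact: law_compensator.
Qed.

End clamp.

(** * The reciprocal invariant as an integral identity *)

Section invariant.
Context {R : realType}.
Implicit Types (s t u : R) (f g : R -> R).

Lemma within01_proper t : 0 <= t <= 1 -> ProperFilter (within `[0, 1]%classic t^').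
Proof.
move=> /andP[t0 t1]; apply: Build_ProperFilter_ex => A.
move=> -[d /= d0 Hd].
have dm : 0 < Num.min (d / 2) 1 by rewrite lt_min ltr01 divr_gt0.
have dd : Num.min (d / 2) 1 < d.
  by rewrite gt_min; apply/orP; left; rewrite ltr_pdivrMr// mulr2n mulrDr mulr1 ltrDl.
have [th|th] := leP t (1 / 2).
  exists (t + Num.min (d / 2) 1 / 2); apply: Hd => /=.
  - rewrite opprD addNKr normrN ger0_norm; last by rewrite divr_ge0// ltW.
    by apply: le_lt_trans dd; rewrite ler_pdivrMr// ler_peMr ?ler1n// ltW.
  - by rewrite -subr_eq0 addrC addKr lt0r_neq0// divr_gt0.
  rewrite in_itv/= addr_ge0 ?divr_ge0 ?(ltW dm)//=.
  have : Num.min (d / 2) 1 <= 1 by rewrite ge_min lexx orbT.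
  by move: (Num.min _ _) dm {dd} => e; lra.
exists (t - Num.min (d / 2) 1 / 2); apply: Hd => /=.
- rewrite opprB addrC subrK ger0_norm; last by rewrite divr_ge0// ltW.
  by apply: le_lt_trans dd; rewrite ler_pdivrMr// ler_peMr ?ler1n// ltW.
- by rewrite -subr_eq0 addrC addKr oppr_eq0 lt0r_neq0// divr_gt0.
rewrite in_itv/=.
have : Num.min (d / 2) 1 <= 1 by rewrite ge_min lexx orbT.
by move: (Num.min _ _) dm {dd} => e *; apply/andP; split; lra.
Qed.

Lemma linear_derive01 f t a : 0 <= t <= 1 ->
  linear_at `[0, 1]%classic f t a -> derive01 f t = a.
Proof.
move=> t01 /diff_quotient_linear H; have pf := within01_proper t01.
exact: cvg_lim H.
Qed.

Lemma C1_linear f t : 0 <= t <= 1 -> C1_01 f ->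
  linear_at `[0, 1]%classic f t (derive01 f t).
Proof. by move=> t01 [H _]; apply/diff_quotient_linear; apply: H; rewrite in_itv. Qed.

Lemma linear_ln f t a : 0 <= t <= 1 -> (forall s, 0 <= s <= 1 -> 0 < f s) ->
  linear_at `[0, 1]%classic f t a -> linear_at `[0, 1]%classic (@ln R \o f) t ((f t)^-1 * a).
Proof.
move=> t01 f0 H; apply: (is_derive_linear01 (g := @ln R \o affine_ext f t a)) => //.
  by move=> s s01; rewrite /= affine_extE.
rewrite -[X in X^-1](@affine_extE _ f t a t t01).
apply: is_derive1_comp; last exact: is_derive_affine_ext.
by apply: is_derive1_ln; rewrite affine_extE// f0.
Qed.

Lemma linearB f g t a b : 0 <= t <= 1 -> linear_at `[0, 1]%classic f t a ->
  linear_at `[0, 1]%classic g t b ->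
  linear_at `[0, 1]%classic (fun s => f s - g s) t (a - b).
Proof.
move=> t01 Hf Hg.
apply: (is_derive_linear01 (g := fun s => affine_ext f t a s - affine_ext g t b s)) => //.
  by move=> s s01; rewrite !affine_extE.
exact: is_deriveB (is_derive_affine_ext t01 Hf) (is_derive_affine_ext t01 Hg).
Qed.

(** The mean value theorem on the open interval, for the function continued by
    constants. *)
Lemma linear_zero_cst f : (forall t, 0 <= t <= 1 -> linear_at `[0, 1]%classic f t 0) ->
  forall t, 0 <= t <= 1 -> f t = f 0.
Proof.
move=> H t /andP[t0 t1]; move: t0; rewrite le_eqVlt => /predU1P[<-//|t0].
have cf : continuous (f \o clamp).
  by apply: linear_continuous_clamp => s s01; exists 0; exact: H.
have dF (r : R) : r \in `]0, t[ -> is_derive r 1 (f \o clamp) 0.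
  rewrite in_itv/= => /andP[r0 rt]; have r1 := lt_le_trans rt t1.
  apply/is_derive_linear => e e0; have r01 : 0 <= r <= 1 by rewrite !ltW.
  have [d d0 Hd] := H r r01 e e0.
  exists (Num.min d (Num.min r (1 - r))); first by rewrite !lt_min d0 r0 subr_gt0.
  move=> s _; rewrite !lt_min => /and3P[srd sr0 sr1].
  have s01 : 0 <= s <= 1.
    by move: sr0 sr1; rewrite !ltr_norml => /andP[? ?] /andP[? ?]; apply/andP; split; lra.
  case/andP: (s01) => s0 s1; rewrite /= !clamp_id ?(ltW r0) ?(ltW r1)//.
  by apply: Hd; rewrite //= in_itv.
have [c _] := MVT t0 dF (continuous_subspaceT cf).
by rewrite mul0r /= !clamp_id// ?(ltW t0)// => /eqP; rewrite subr_eq0 => /eqP.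
Qed.

Variables (l k : R -> int -> R).
Hypotheses (hl : NMC l) (hk : NMC k).

Definition log_ratio (z : int) (s : R) : R := ln (l s z) - ln (k s z).
Definition gap (z : int) (s : R) : R := clamped l s z - clamped k s z.

Lemma continuous_gap z : continuous (gap z).
Proof.
have [L [rl _]] := NMC_regular hl; have [K [rk _]] := NMC_regular hk.
by move=> t; apply: cvgB; [exact: rl|exact: rk].
Qed.

Let gap_drift z s := gap z s - gap (z + 1) s.

Let continuous_gap_drift z : continuous (gap_drift z).
Proof. by move=> t; apply: cvgB; exact: continuous_gap. Qed.

Lemma linear_log_ratio z t : 0 <= t <= 1 ->
  linear_at `[0, 1]%classic (log_ratio z) t
    (derive01 (fun s => ln (l s z)) t - derive01 (fun s => ln (k s z)) t).
Proof.
have pos m : NMC m -> forall s, 0 <= s <= 1 -> 0 < m s z.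
  by move=> [[L L0 mL] _] s s01; have [] := mL s z; rewrite ?in_itv.
move=> t01; apply: linearB => //.
  have H := linear_ln t01 (pos l hl) (C1_linear t01 (proj2 hl z)).
  by rewrite (linear_derive01 t01 H).
have H := linear_ln t01 (pos k hk) (C1_linear t01 (proj2 hk z)).
by rewrite (linear_derive01 t01 H).
Qed.

(** Equality of the invariants, [d_z' = e_z - e_(z+1)], as an expansion of
    [log_ratio z] at the time [t]. *)
Lemma Xi_eq_linear z t : 0 <= t <= 1 ->
  Xi l t z = Xi k t z <-> linear_at `[0, 1]%classic (log_ratio z) t (gap_drift z t).
Proof.
move=> t01; have H := linear_log_ratio z t01; have /andP[t0 t1] := t01.
rewrite /gap_drift /gap /clamped !clamp_id// /Xi.
split=> [E|H'].
  move: E H; set a := derive01 _ _; set b := derive01 _ _ => E.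
  by have -> : a - b = l t z - k t z - (l t (z + 1) - k t (z + 1)) by lra.
have := etrans (esym (linear_derive01 t01 H)) (linear_derive01 t01 H').
lra.
Qed.

(** The integrated form of [Xi_eq_linear].  It is what the two bridges are compared
    through, in both directions. *)
Lemma Xi_eq_integral z :
  (forall t, 0 <= t <= 1 -> Xi l t z = Xi k t z) <->
  (forall t, 0 <= t <= 1 ->
     log_ratio z t - log_ratio z 0 = int_oc (gap z) 0 t - int_oc (gap (z + 1)) 0 t).
Proof.
have cg := @continuous_gap_drift z.
have IE t : 0 <= t -> int_oc (gap z) 0 t - int_oc (gap (z + 1)) 0 t =
    prim (gap_drift z) t - prim (gap_drift z) 0.
  move=> t0; rewrite -int_oc_prim// ?ltrN10//.
  have ci y : lebesgue_measure.-integrable `]0%R, t] (EFin \o gap y).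
    apply: (integrableS _ _ _ (@continuous_integrable_itv R (gap y) 0 t (@continuous_gap y))) => //.
    exact: subset_itv_oc_cc.
  by rewrite /int_oc -RintegralB.
split=> H t t01; have /andP[t0 t1] := t01.
  have : log_ratio z t - prim (gap_drift z) t = log_ratio z 0 - prim (gap_drift z) 0.
    apply: (linear_zero_cst (f := fun s => log_ratio z s - prim (gap_drift z) s)) => // s s01.
    have /andP[s0 _] := s01.
    have H1 : linear_at `[0, 1]%classic (log_ratio z) s (gap_drift z s).
      by apply/Xi_eq_linear => //; exact: H.
    suff H2 : linear_at `[0, 1]%classic (prim (gap_drift z)) s (gap_drift z s).
      by have := linearB s01 H1 H2; rewrite subrr.
    apply: (is_derive_linear01 (g := prim (gap_drift z))) => //.
    by apply: is_derive_prim => //; apply: lt_le_trans s0; rewrite ltrN10.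
  rewrite IE//; lra.
apply/Xi_eq_linear => //.
apply: (is_derive_linear01 (g := fun s => prim (gap_drift z) s + (log_ratio z 0 - prim (gap_drift z) 0))) => //.
  by move=> s s01; have := H s s01; rewrite IE; [lra|case/andP: s01].
rewrite -[X in is_derive _ _ _ X]addr0; apply: is_deriveD.
by apply: is_derive_prim => //; apply: lt_le_trans t0; rewrite ltrN10.
Qed.

End invariant.

(** * Equal invariants give equal bridges *)

Lemma cancel_factor (F : fieldType) (c a b : F) : c != 0 -> c * a / (c * b) = a / b.
Proof. by move=> c0; rewrite invfM mulrACA divff ?mul1r. Qed.

Lemma bridgeE {R : realType} (l : R -> int -> R) L (rl : regular (clamped l) L)
    x y (A : set (counting_path R)) : measurable A ->
  bridge l x y A = (fine (law rl x (A `&` [set w | X 1 w = y])) /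
    fine (law rl x [set w | X 1 w = y]))%:E.
Proof.
move=> mA; have mB : measurable [set w : counting_path R | X 1 w = y].
  exact: (@measurable_X_preimage R 1 [set y]).
have mAB := measurableI _ _ mA mB.
have E1 := congr1 fine (counting_lawE rl x mAB).
have E2 := congr1 fine (counting_lawE rl x mB).
exact: (congr1 EFin (congr2 (fun a b => a / b) E1 E2)).
Qed.

Section sufficiency.
Context {R : realType}.
Notation T := (counting_path R).
Local Notation leb := (@lebesgue_measure R).
Implicit Types (w : T) (s t u : R) (x y : int).
Variables (l k : R -> int -> R).
Variables (L K : R).
Hypotheses (rl : regular (clamped l) L) (rk : regular (clamped k) K).
Hypothesis log_ratio_gap : forall y t, 0 <= t <= 1 ->
  log_ratio l k y t - log_ratio l k y 0 =
  int_oc (gap l k y) 0 t - int_oc (gap l k (y + 1)) 0 t.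

(** A function of the level, zero at [x], with increments [log_ratio _ 0] above. *)
Definition initial_log_ratio x y : R :=
  \sum_(j < absz (y - x)%R) log_ratio l k (x + j%:Z) 0.

Lemma initial_log_ratioS x y : x <= y ->
  initial_log_ratio x (y + 1) - initial_log_ratio x y = log_ratio l k y 0.
Proof.
move=> xy; rewrite /initial_log_ratio.
have [n ->] : exists n : nat, y = x + n%:Z by exists (absz (y - x)%R); lia.
rewrite (_ : absz (x + n%:Z + 1 - x)%R = n.+1); last by lia.
rewrite (_ : absz (x + n%:Z - x)%R = n); last by lia.
by rewrite big_ord_recr /= addrAC subrr add0r.
Qed.

Let path_gap w s t : R := int_oc (fun v => clamped l v (Xleft v w)) s t -
  int_oc (fun v => clamped k v (Xleft v w)) s t.

Let potential y t : R := int_oc (gap l k y) 0 t.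

(** Apply [pathwise_increment] to [potential (X t) t - initial_log_ratio x (X t)]:
    between jumps it grows by the gap of the intensities along the path, and at a
    jump [u] from level [y] it decreases by [log_ratio y u]. *)
Lemma sum_log_ratio w :
  \sum_(u <- jumps w) log_ratio l k (Xleft u w) u =
  initial_log_ratio (X 0 w) (X 1 w) - potential (X 1 w) 1 + path_gap w 0 1.
Proof.
pose Y t := potential (X t w) t - initial_log_ratio (X 0 w) (X t w).
(* The left limit of Y, as the potential is continuous in time. *)
pose Yl t := potential (Xleft t w) t - initial_log_ratio (X 0 w) (Xleft t w).
have ci y a b : leb.-integrable `]a, b] (EFin \o clamped l ^~ y).
  apply: (integrableS _ _ _ (@continuous_integrable_itv R (clamped l ^~ y) a b (proj1 rl y))) => //.
  exact: subset_itv_oc_cc.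
have ck y a b : leb.-integrable `]a, b] (EFin \o clamped k ^~ y).
  apply: (integrableS _ _ _ (@continuous_integrable_itv R (clamped k ^~ y) a b (proj1 rk y))) => //.
  exact: subset_itv_oc_cc.
have potE y a b : int_oc (gap l k y) a b =
    int_oc (clamped l ^~ y) a b - int_oc (clamped k ^~ y) a b.
  by rewrite /int_oc -RintegralB.
have : Y 1 - Y 0 = path_gap w 0 1 + \sum_(u <- jumps w | 0 < u <= 1) (Y u - Yl u).
  apply: (@pathwise_increment R w Y Yl (path_gap w) 0 1 ler01).
  - move=> a b c _ ab bc _; rewrite /path_gap.
    rewrite (int_oc_add ab bc (integrable_intensity rl w a c)).
    by rewrite (int_oc_add ab bc (integrable_intensity rk w a c)); ring.
  - move=> a b a0 ab b1 nj.
    have XE v : a < v -> v <= b -> Xleft v w = X a w by move=> av vb; exact: (Xleft_between nj).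
    rewrite /Yl /Y XE// opprB addrA subrK /potential !potE.
    rewrite (int_oc_add a0 (ltW ab) (ci (X a w) 0 b)) (int_oc_add a0 (ltW ab) (ck (X a w) 0 b)).
    rewrite /path_gap.
    rewrite (@eq_int_oc _ (fun v => clamped l v (Xleft v w)) (clamped l ^~ (X a w))); last first.
      by move=> v av vb; rewrite XE.
    rewrite (@eq_int_oc _ (fun v => clamped k v (Xleft v w)) (clamped k ^~ (X a w))); last first.
      by move=> v av vb; rewrite XE.
    ring.
  - by rewrite /path_gap /int_oc set_itvoc0 !Rintegral_set0 subrr.
  - by move=> r rw; rewrite /Y /Yl X_Xleft (negbTE rw) addr0.
have S : \sum_(u <- jumps w | 0 < u <= 1) (Y u - Yl u) =
    - \sum_(u <- jumps w) log_ratio l k (Xleft u w) u.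
  rewrite -sumrN big_seq_cond [RHS]big_seq; apply: eq_big => u.
    have [uw|//] := boolP (u \in jumps w).
    by have /andP[-> /ltW ->] := jumps01 uw.
  move=> /andP[uw _]; have /andP[u0 u1] := jumps01 uw.
  have u01 : 0 <= u <= 1 by rewrite !ltW.
  have x0 : X 0 w <= Xleft u w.
    by rewrite X0_init /Xleft lerDl.
  rewrite /Y /Yl X_Xleft uw /=.
  have := initial_log_ratioS x0; have := log_ratio_gap (Xleft u w) u01.
  rewrite /potential; lra.
rewrite S /Y /potential {2}/int_oc set_itvoc0 Rintegral_set0.
rewrite /initial_log_ratio subrr big_ord0; lra.
Qed.

(** The ratio of the densities depends on the end points only. *)
Lemma density_ratio w :
  z (clamped l) 1 w =
  expR (initial_log_ratio (X 0 w) (X 1 w) - potential (X 1 w) 1) * z (clamped k) 1 w.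
Proof.
have pl t y : 0 < clamped l t y by case: rl => _ /(_ t y)/andP[].
have pk t y : 0 < clamped k t y by case: rk => _ /(_ t y)/andP[].
have E : \prod_(u <- jumps w | u <= 1) clamped l u (Xleft u w) =
    (\prod_(u <- jumps w | u <= 1) clamped k u (Xleft u w)) *
    expR (\sum_(u <- jumps w) log_ratio l k (Xleft u w) u).
  rewrite big_seq_cond [X in X * _]big_seq_cond [in X in _ * X]big_seq expR_sum.
  rewrite (eq_bigl (fun u => u \in jumps w)); last first.
    move=> u; have [uw|//] := boolP (u \in jumps w).
    by have /andP[_ /ltW ->] := jumps01 uw.
  rewrite [X in _ = X * _](eq_bigl (fun u => u \in jumps w)); last first.
    move=> u; have [uw|//] := boolP (u \in jumps w).
    by have /andP[_ /ltW ->] := jumps01 uw.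
  rewrite -big_split /=; apply: eq_bigr => u uw; have /andP[u0 u1] := jumps01 uw.
  have := pl u (Xleft u w); have := pk u (Xleft u w).
  rewrite /clamped clamp_id ?ltW// /log_ratio => k0 l0.
  by rewrite expRD expRN !lnK ?posrE// mulrCA divff ?mulr1// lt0r_neq0.
rewrite !zE E sum_log_ratio /path_gap -(cumul_oc rl) -(cumul_oc rk).
move: (\prod_(u <- _ | _) _) => p.
rewrite [RHS]mulrCA -mulrA -!expRD; congr (_ * expR _); ring.
Qed.

Definition bridge_factor x y : R :=
  expR (initial_log_ratio x y - potential y 1).

Lemma bridge_factor_gt0 x y : 0 < bridge_factor x y.
Proof. exact: expR_gt0. Qed.

(** The total masses of the two densities are equal, so the factor is that of
    [density_ratio]. *)
Lemma law_endpoint x y (A : set T) : measurable A ->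
  law rl x (A `&` [set w | X 1 w = y]) =
  ((bridge_factor x y)%:E * law rk x (A `&` [set w | X 1 w = y]))%E.
Proof.
move=> mA; pose B := A `&` [set w | X 1 w = y].
have mB : measurable B.
  by apply: measurableI => //; exact: (@measurable_X_preimage R 1 [set y]).
pose c := expR (initial_log_ratio x y - potential y 1).
have m1 : measurable_fun setT (fun w : T => (\1_B w * z (clamped l) 1 w)%:E).
  by apply/measurable_EFinP/measurable_funM; [exact: measurable_indic|exact: (measurable_z_at rl)].
have m2 : measurable_fun setT (fun w : T => (\1_B w * z (clamped k) 1 w)%:E).
  by apply/measurable_EFinP/measurable_funM; [exact: measurable_indic|exact: (measurable_z_at rk)].
have p1 w : (0 <= (\1_B w * z (clamped l) 1 w)%:E)%E.
  by rewrite lee_fin; apply: mulr_ge0; [rewrite indicE ler0n|exact: ltW (z_gt0 rl _ _)].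
have p2 w : (0 <= (\1_B w * z (clamped k) 1 w)%:E)%E.
  by rewrite lee_fin; apply: mulr_ge0; [rewrite indicE ler0n|exact: ltW (z_gt0 rk _ _)].
have c0 : (0 <= c%:E)%E by rewrite lee_fin expR_ge0.
have E : (\int[mu x]_(w in B) (z (clamped l) 1 w)%:E =
    c%:E * \int[mu x]_(w in B) (z (clamped k) 1 w)%:E)%E.
  apply: (etrans (integral_indicM (mu x) B _)).
  apply: (etrans _ (congr1 (fun I => c%:E * I)%E (esym (integral_indicM (mu x) B _)))).
  apply: (etrans _ (ge0_integralZl (mu x) measurableT m2 (fun w _ => p2 w) c0)).
  apply: (mu_ext m1 _ p1).
  - exact: (measurable_funeM (c%:E) m2).
  - by move=> w; exact: (mule_ge0 c0 (p2 w)).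
  move=> w wx; rewrite -EFinM indicE; have [|] := boolP (w \in B).
    rewrite inE => -[_ /= Xy]; rewrite !mul1r (density_ratio w) X0_init wx Xy.
    by [].
  by rewrite !mul0r mulr0.
apply: (etrans (lawE rl x B)).
apply: (etrans _ (congr1 (fun I => c%:E * I)%E (esym (lawE rk x B)))).
apply: (etrans (congr1 (fun I => I * _)%E E)).
exact: (esym (muleA _ _ _)).
Qed.

Lemma eq_bridge x y (A : set T) : measurable A -> bridge l x y A = bridge k x y A.
Proof.
move=> mA; have mB : measurable [set w : T | X 1 w = y] := @measurable_X_preimage R 1 [set y].
have mAB := measurableI _ _ mA mB.
have fin (S : set T) : measurable S -> law rk x S \is a fin_num.
  by move=> mS; rewrite fin_num_measure.
have E (S : set T) : measurable S -> fine (law rl x (S `&` [set w | X 1 w = y])) =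
    bridge_factor x y * fine (law rk x (S `&` [set w | X 1 w = y])).
  move=> mS; apply: (etrans (congr1 fine (law_endpoint x y mS))).
  exact: (fineM (isT : (bridge_factor x y)%:E \is a fin_num) (fin _ (measurableI _ _ mS mB))).
have EB := E setT measurableT; rewrite setTI in EB.
apply: (etrans (bridgeE rl x y mA)); apply: (etrans _ (esym (bridgeE rk x y mA))).
apply: (etrans (congr1 EFin (congr2 (fun a b => a / b) (E A mA) EB))).
have f0 : bridge_factor x y != 0 := lt0r_neq0 (bridge_factor_gt0 x y).
apply: (congr1 EFin); exact: (cancel_factor _ _ f0).
Qed.

End sufficiency.

Lemma Xi_reciprocal_class {R : realType} (l k : R -> int -> R) : NMC l -> NMC k ->
  (forall (t : R) (z : int), t \in `[0, 1] -> Xi l t z = Xi k t z) ->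
  reciprocal_class l = reciprocal_class k.
Proof.
move=> hl hk XiE; have [L rl] := NMC_regular hl; have [K rk] := NMC_regular hk.
have H y : forall t, 0 <= t <= 1 -> log_ratio l k y t - log_ratio l k y 0 =
    int_oc (gap l k y) 0 t - int_oc (gap l k (y + 1)) 0 t.
  by apply/(Xi_eq_integral hl hk y) => t t01; apply: XiE; rewrite in_itv.
have E (A : set (counting_path R)) : measurable A ->
    (fun p => bridge l p.1 p.2 A) = (fun p => bridge k p.1 p.2 A).
  by move=> mA; apply/funext => p; exact: (eq_bridge rl rk H p.1 p.2 mA).
apply/seteqP; split => Q HQ A mA; apply: (etrans (HQ A mA)).
  exact: (congr1 (fun f => integral _ _ f) (E A mA)).
exact: (congr1 (fun f => integral _ _ f) (esym (E A mA))).
Qed.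

(** * Bridges with a single jump *)

Section one_jump.
Context {R : realType}.
Notation T := (counting_path R).
Local Notation leb := (@lebesgue_measure R).
Implicit Types (w : T) (s t u : R) (x y : int).

Lemma insertable_no_jump u x : insertable u (no_jump x : T) = (0 < u < 1).
Proof. by rewrite /insertable andbT. Qed.

Lemma X_no_jump t x : X t (no_jump x : T) = x.
Proof. by rewrite /X /= addr0. Qed.

Lemma Xleft_no_jump t x : Xleft t (no_jump x : T) = x.
Proof. by rewrite /Xleft /= addr0. Qed.

(** Only the term with one jump contributes to the series defining [mu x]. *)
Lemma integral_mu_one_jump x (f : T -> \bar R) : measurable_fun setT f ->
  (forall w, 0 <= f w)%E ->
  (forall w, init w = x -> size (jumps w) != 1%N -> f w = 0%E) ->
  (\int[mu x]_w f w = \int[unif]_u f (ins u (no_jump x)))%E.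
Proof.
move=> mf f0 f1; rewrite integral_mu// (nneseriesD1 (n := 1%N))//; last first.
  move=> n _; apply: mule_ge0; first by rewrite lee_fin invr_ge0.
  by apply: integral_ge0 => w _; exact: f0.
rewrite factS fact0 muln1 invr1 mul1e eseries0 ?adde0; last first.
  move=> n _ /= n1; rewrite (nu_ext (g := cst 0%E))//.
    by rewrite integral0 mule0.
  by move=> w wx wn; apply: f1 => //; rewrite wn.
rewrite integral_nuS//= integral_dirac ?diracT ?mul1e//.
apply: (@measurable_integral _ _ _ T (measurableTypeR R) unif (fun w u => f (ins u w))).
  exact: (measurableT_comp mf (measurable_comp2 (h := fun u w => ins u w) (@measurable_ins R)
    measurable_snd measurable_fst)).
by move=> w u; exact: f0.
Qed.

Lemma size_X w x n : init w = x -> (X 1 w == x + n%:Z) = (size (jumps w) == n).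
Proof. by move=> <-; rewrite X1E (inj_eq (addrI _)). Qed.

End one_jump.

Section one_jump_density.
Context {R : realType}.
Notation T := (counting_path R).
Local Notation leb := (@lebesgue_measure R).
Implicit Types (w : T) (s t u : R).
Variables (l : R -> int -> R) (L : R) (x : int).
Hypothesis rl : regular (clamped l) L.
Let pl t y : 0 < clamped l t y. Proof. by case: rl => _ /(_ t y)/andP[]. Qed.

Lemma continuous_sub (f g : R -> R) : continuous f -> continuous g ->
  continuous (fun v => f v - g v).
Proof. by move=> cf cg v; apply: cvgB; [exact: cf|exact: cg]. Qed.

Lemma continuous_prim_clamp (c : R -> R) : continuous c -> continuous (prim c \o clamp).
Proof.
move=> cc; apply: linear_continuous_clamp => t t01; exists (c t).
apply: (is_derive_linear01 (g := prim c)) => //.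
apply: is_derive_prim => //; case/andP: t01 => t0 _.
by apply: lt_le_trans t0; rewrite ltrN10.
Qed.

(** The density [z] of a path from [x] to [x + 1], as a function of its jump time;
    it is continued by constants outside of the unit interval to be continuous on
    the line. *)
Definition jump_density u : R :=
  clamped l u x * expR (1 - (prim (clamped l ^~ x) (clamp u) - prim (clamped l ^~ x) 0) -
    (prim (clamped l ^~ (x + 1)) 1 - prim (clamped l ^~ (x + 1)) (clamp u))).

Lemma jump_density_gt0 u : 0 < jump_density u.
Proof. by rewrite mulr_gt0 ?expR_gt0. Qed.

Lemma continuous_jump_density : continuous jump_density.
Proof.
have cl y : continuous (clamped l ^~ y) by case: rl.
move=> u; apply: cvgM; first exact: cl.
have cp y : continuous (prim (clamped l ^~ y) \o clamp) := continuous_prim_clamp (cl y).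
have cc (a : R) : continuous (fun _ : R => a) by exact: cst_continuous.
have ce := continuous_sub (continuous_sub (cc 1) (continuous_sub (cp x)
  (cc (prim (clamped l ^~ x) 0)))) (continuous_sub (cc (prim (clamped l ^~ (x + 1)) 1)) (cp (x + 1))).
exact: (cvg_comp _ _ (ce u) (@continuous_expR R _)).
Qed.

Lemma ln_jump_density s : 0 <= s <= 1 -> ln (jump_density s) = ln (l s x) +
  (1 - (prim (clamped l ^~ x) s - prim (clamped l ^~ x) 0) -
    (prim (clamped l ^~ (x + 1)) 1 - prim (clamped l ^~ (x + 1)) s)).
Proof.
move=> /andP[s0 s1]; rewrite /jump_density lnM ?posrE ?expR_gt0// expRK.
by rewrite /clamped !clamp_id.
Qed.

Lemma z_one_jump u : 0 < u < 1 -> z (clamped l) 1 (ins u (no_jump x)) = jump_density u.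
Proof.
move=> u01; have iu : insertable u (no_jump x : T) by rewrite insertable_no_jump.
have /andP[u0 u1] := u01.
have cl y : continuous (clamped l ^~ y) by case: rl.
rewrite zE (perm_big _ (perm_ins iu)) /= big_cons big_nil (ltW u1) mulr1.
rewrite Xleft_ins// Xleft_no_jump ltxx addr0 (cumul_oc rl).
rewrite /jump_density clamp_id ?ltW//; congr (_ * expR _).
rewrite (int_oc_add (ltW u0) (ltW u1) (integrable_intensity rl _ 0 1)).
rewrite (@eq_int_oc _ _ (clamped l ^~ x) 0 u); last first.
  by move=> v _ vu; rewrite Xleft_ins// Xleft_no_jump ltNge vu addr0.
rewrite (@eq_int_oc _ _ (clamped l ^~ (x + 1)) u 1); last first.
  by move=> v uv _; rewrite Xleft_ins// Xleft_no_jump uv.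
rewrite !int_oc_prim ?ltrN10 ?(ltW u0) ?(ltW u1)// ?(lt_trans _ u0) ?ltrN10//.
by rewrite opprD addrA.
Qed.

Let up t : set T := [set w | X t w = x + 1].

Lemma integral_one_jump t : 0 <= t <= 1 ->
  (\int[mu x]_(w in up t `&` up 1) (z (clamped l) 1 w)%:E =
   (int_oc jump_density 0 t)%:E)%E.
Proof.
move=> /andP[t0 t1]; pose E : set T := up t `&` up 1.
have mE : measurable E.
  by apply: measurableI; [exact: (@measurable_X_preimage R t [set x + 1])
                         |exact: (@measurable_X_preimage R 1 [set x + 1])].
have md : measurable_fun setT jump_density := continuous_measurable_fun continuous_jump_density.
pose f w : \bar R := (\1_E w * z (clamped l) 1 w)%:E.
have mf : measurable_fun setT f.
  by apply/measurable_EFinP/measurable_funM; [exact: measurable_indic|exact: (measurable_z_at rl)].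
have f0 w : (0 <= f w)%E.
  by rewrite lee_fin; apply: mulr_ge0; [rewrite indicE ler0n|exact: ltW (z_gt0 rl _ _)].
have f1 w : init w = x -> size (jumps w) != 1%N -> f w = 0%E.
  move=> wx; rewrite -(size_X 1 wx) => /negP w1.
  by rewrite /f indicE memNset ?mul0r// => -[_ /= Xw]; apply: w1; rewrite Xw.
apply: (etrans (integral_indicM (mu x) E _)).
apply: (etrans (integral_mu_one_jump mf f0 f1)).
(* Among one-jump paths, X_t = x + 1 says that the jump is before t. *)
pose g u : \bar R := (\1_(`]0, t]%classic : set (measurableTypeR R)) u * jump_density u)%:E.
have mI : measurable (`]0, t]%classic : set (measurableTypeR R)) by [].
have mg : measurable_fun setT g.
  by apply/measurable_EFinP/measurable_funM => //; exact: measurable_indic.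
have g0 u : (0 <= g u)%E.
  by rewrite lee_fin; apply: mulr_ge0; [rewrite indicE ler0n|exact: ltW (jump_density_gt0 u)].
have mfi : measurable_fun setT (fun u : measurableTypeR R => f (ins u (no_jump x))).
  exact: (measurableT_comp mf (measurable_ins1 (no_jump x))).
rewrite (@unif_insertable _ (no_jump x) _ g mfi mg)//; last first.
  move=> u iu; rewrite insertable_no_jump in iu.
  rewrite /f /g (z_one_jump iu) !indicE; congr ((_ %:R * _)%:E); congr nat_of_bool.
  have iu' : insertable u (no_jump x : T) by rewrite insertable_no_jump.
  have /andP[u0 u1] := iu.
  apply/idP/idP; rewrite !inE /E /up /= in_itv/= u0 /= !X_ins// !X_no_jump.
    by move=> [+ _]; case: (u <= t) => //; lia.
  by move=> ->; rewrite (ltW u1).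
rewrite integral_unif// /g /int_oc /Rintegral fineK; last first.
  apply: integrable_fin_num => //.
  apply: (integrableS _ _ _ (@continuous_integrable_itv R jump_density 0 t continuous_jump_density)) => //.
  exact: subset_itv_oc_cc.
rewrite [LHS]integral_mkcond [RHS]integral_mkcond; apply: eq_integral => u _.
rewrite !patchE indicE; have [u0|u0] := boolP (u \in `]0, t]%classic).
  rewrite mul1r ifT//; move: u0; rewrite !inE/= !in_itv/= => /andP[u0 ut].
  by rewrite (ltW u0) (le_trans ut).
by rewrite mul0r; case: ifP.
Qed.

(** By the mean value theorem the integral is a value of the positive integrand. *)
Lemma int_jump_density_gt0 : 0 < int_oc jump_density 0 1.
Proof.
rewrite (int_oc_prim continuous_jump_density (ltrN10 R) ler01).
have d01 (r : R) : r \in `]0, 1[ -> is_derive r 1 (prim jump_density) (jump_density r).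
  rewrite in_itv/= => /andP[r0 _]; apply: (is_derive_prim continuous_jump_density).
  by apply: lt_trans r0; rewrite ltrN10.
have cp : {within `[0, 1], continuous (prim jump_density)}.
  apply: continuous_in_subspaceT => v; rewrite inE/= in_itv/= => /andP[v0 _].
  apply: is_derive_continuous (is_derive_prim continuous_jump_density _).
  by apply: lt_le_trans v0; rewrite ltrN10.
have [c _ ->] := MVT ltr01 d01 cp.
by rewrite subr0 mulr1; exact: jump_density_gt0.
Qed.

Lemma law_one_jump t : 0 <= t <= 1 ->
  law rl x (up t `&` up 1) = (int_oc jump_density 0 t / mass x)%:E.
Proof.
move=> t01; apply: (etrans (lawE rl x _)).
exact: (congr1 (fun I => I * _)%E (integral_one_jump t01)).
Qed.

Lemma law_one_jump1 : law rl x (up 1) = (int_oc jump_density 0 1 / mass x)%:E.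
Proof.
have H : 0 <= (1 : R) <= 1 by rewrite ler01 lexx.
by have := law_one_jump H; rewrite setIid.
Qed.

(** The distribution function of the jump time under the bridge from [x] to
    [x + 1]. *)
Lemma bridge_one_jump t : 0 <= t <= 1 ->
  bridge l x (x + 1) (up t) = (int_oc jump_density 0 t / int_oc jump_density 0 1)%:E.
Proof.
move=> t01; have mA : measurable (up t) := @measurable_X_preimage R t [set x + 1].
apply: (etrans (bridgeE rl x (x + 1) mA)).
apply: (etrans (congr1 EFin (congr2 (fun a b => fine a / fine b) (law_one_jump t01) law_one_jump1))).
apply: (congr1 EFin); have m0 := mass_gt0 (R := R) x.
rewrite /=; field.
by rewrite !lt0r_neq0// int_jump_density_gt0.
Qed.

End one_jump_density.

(** * Equal classes give equal invariants *)

Lemma measurable_int2 (S : set (int * int)) : measurable S.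
Proof.
have -> : S = \bigcup_p (if p \in S then [set p.1] `*` [set p.2] else set0).
  apply/seteqP; split => -[a b] /= H.
    by exists (a, b) => //=; rewrite mem_set.
  by case: H => -[c d] _ /=; case: ifPn => //; rewrite inE => cd [/= -> ->].
apply: countable_bigcupT_measurable => // p.
by case: ifP => // _; exact: measurableX.
Qed.

Section conditioned.
Context {R : realType}.
Notation T := (counting_path R).
Variables (l : R -> int -> R) (L : R) (x y : int).
Hypothesis rl : regular (clamped l) L.
Let B : set T := [set w | X 1 w = y].
Let mB : measurable B := @measurable_X_preimage R 1 [set y].
Hypothesis B0 : (0 < law rl x B)%E.

Lemma eq_law (A A' : set T) : measurable A -> measurable A' ->
  (forall w, init w = x -> A w <-> A' w) -> law rl x A = law rl x A'.
Proof.
move=> mA mA' AA'.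
have m (E : set T) : measurable E ->
    measurable_fun setT (fun w => (\1_E w * z (clamped l) 1 w)%:E).
  by move=> mE; apply/measurable_EFinP/measurable_funM; [exact: measurable_indic|exact: (measurable_z_at rl)].
have p (E : set T) w : (0 <= (\1_E w * z (clamped l) 1 w)%:E)%E.
  by rewrite lee_fin; apply: mulr_ge0; [rewrite indicE ler0n|exact: ltW (z_gt0 rl _ _)].
apply: (etrans (lawE rl x A)); apply: (etrans _ (esym (lawE rl x A'))).
apply: (congr1 (fun I => I * _)%E).
apply: (etrans (integral_indicM (mu x) A _)); apply: (etrans _ (esym (integral_indicM (mu x) A' _))).
apply: (mu_ext (m A mA) (m A' mA') (p A) (p A')) => w wx.
have E : (w \in A) = (w \in A') by apply/idP/idP; rewrite !inE; have [] := AA' w wx.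
by rewrite !indicE E.
Qed.

(** The counting law conditioned on the final value; its end point marginal is a
    Dirac mass, which isolates one bridge in the mixture defining the class. *)
Definition conditioned : probability T R := mnormalize (mrestr (law rl x) mB) \d_point.

Lemma conditioned_law (A : set T) :
  conditioned A = (law rl x (A `&` B) * (fine (law rl x B))^-1%:E)%E.
Proof.
have E : mrestr (law rl x) mB setT = law rl x B by rewrite /mrestr setTI.
have p0 : (0 < mrestr (law rl x) mB setT)%E by rewrite E.
have poo : (mrestr (law rl x) mB setT < +oo)%E.
  by rewrite E; apply: (le_lt_trans _ (ltry (1 : R))); exact: probability_le1.
apply: (etrans (mnormalizeE _ A p0 poo)).
exact: (congr1 (fun I => law rl x (A `&` B) * (fine I)^-1%:E)%E E).
Qed.

Lemma conditioned_bridge (A : set T) : measurable A -> conditioned A = bridge l x y A.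
Proof.
move=> mA; apply: (etrans (conditioned_law A)).
apply: (etrans _ (esym (bridgeE rl x y mA))).
have fin : law rl x (A `&` B) \is a fin_num by rewrite fin_num_measure//; exact: measurableI.
exact: (congr1 (fun I => I * _)%E (esym (fineK fin))).
Qed.

Lemma measurable_endpoints : measurable_fun setT (@endpoints R).
Proof. by apply: measurable_fun_pair; exact: measurable_X. Qed.

Lemma conditioned_endpoints (S : set (int * int)) :
  endpoint_marginal conditioned S = \d_(x, y) S.
Proof.
have mS : measurable (@endpoints R @^-1` S).
  by rewrite -[X in measurable X]setTI; apply: measurable_endpoints => //; exact: measurable_int2.
apply: (etrans (conditioned_law _)); rewrite diracE.
have fin : law rl x B \is a fin_num by rewrite fin_num_measure.
have f0 : fine (law rl x B) != 0 by rewrite lt0r_neq0// fine_gt0// B0 /= -ge0_fin_numE// ltW.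
have [xyS|xyS] := boolP ((x, y) \in S).
  have -> : law rl x (@endpoints R @^-1` S `&` B) = law rl x B.
    apply: eq_law => //; first exact: measurableI.
    move=> w wx; split => [[]//|Bw]; split => //.
    by rewrite /preimage /endpoints /= X0_init wx Bw; rewrite inE in xyS.
  by rewrite -[X in (X * _)%E](fineK fin) -EFinM divff.
have -> : law rl x (@endpoints R @^-1` S `&` B) = law rl x set0.
  apply: eq_law => //; first exact: measurableI.
  move=> w wx; split => // -[+ Bw]; rewrite /preimage /endpoints /= X0_init wx Bw => xyS'.
  by case/negP: xyS; rewrite inE.
by rewrite measure0 mul0e.
Qed.

Lemma integral_conditioned_endpoints (f : int * int -> \bar R) : x <= y ->
  (\int[endpoint_marginal conditioned]_(p in [set p | (p.1 <= p.2)%R]) f p = f (x, y))%E.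
Proof.
move=> xy.
have mf : measurable_fun [set p : int * int | (p.1 <= p.2)%R] f.
  by move=> _ S mS; exact: measurable_int2.
have H := @eq_measure_integral _ _ _ [set p : int * int | (p.1 <= p.2)%R] \d_(x, y)
  (measure_function_pushforward__canonical__measure_function_Measure conditioned measurable_endpoints)
  f (fun S _ _ => conditioned_endpoints S).
apply: (etrans H); apply: (etrans (integral_dirac (x, y) (measurable_int2 _) mf)).
by rewrite diracE mem_set// mul1e.
Qed.

(** The law [conditioned] belongs to the class of [l], hence to that of [k]; both
    memberships compute it, as the corresponding bridge. *)
Lemma bridge_of_class (k : R -> int -> R) : x <= y ->
  reciprocal_class l = reciprocal_class k ->
  forall A : set T, measurable A -> bridge l x y A = bridge k x y A.
Proof.
move=> xy lk.
have Ql : reciprocal_class l conditioned.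
  move=> A mA; apply: (etrans (conditioned_bridge mA)).
  exact/esym/(integral_conditioned_endpoints (fun p => bridge l p.1 p.2 A) xy).
have Qk : reciprocal_class k conditioned by rewrite -lk.
move=> A mA; apply: (etrans (esym (conditioned_bridge mA))); apply: (etrans (Qk A mA)).
exact: (integral_conditioned_endpoints (fun p => bridge k p.1 p.2 A) xy).
Qed.

End conditioned.

Lemma ln_ratio {R : realType} (g h a b : R) : 0 < g -> 0 < h -> 0 < a -> 0 < b ->
  g / a = h / b -> ln g - ln h = ln (a / b).
Proof.
move=> g0 h0 a0 b0 E; rewrite -ln_div ?posrE//; congr ln.
have -> : g = h / b * a by rewrite -E divfK// lt0r_neq0.
by field; rewrite !lt0r_neq0.
Qed.

(** The logarithms of the two jump densities at times [t] and [0], expanded. *)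
Lemma log_ratio_arith {R : realType} (gt ht g0 h0 lt kt l0 k0 pt p0 qt q0 q1 rt r0 st s0 s1 I J : R) :
  gt - ht = g0 - h0 ->
  gt = lt + (1 - (pt - p0) - (q1 - qt)) -> ht = kt + (1 - (rt - r0) - (s1 - st)) ->
  g0 = l0 + (1 - (p0 - p0) - (q1 - q0)) -> h0 = k0 + (1 - (r0 - r0) - (s1 - s0)) ->
  I = pt - p0 - (rt - r0) -> J = qt - q0 - (st - s0) ->
  lt - kt - (l0 - k0) = I - J.
Proof. lra. Qed.

Lemma int_oc_gap {R : realType} (l k : R -> int -> R) L K (rl : regular (clamped l) L)
    (rk : regular (clamped k) K) y s : 0 <= s ->
  int_oc (gap l k y) 0 s = prim (clamped l ^~ y) s - prim (clamped l ^~ y) 0 -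
    (prim (clamped k ^~ y) s - prim (clamped k ^~ y) 0).
Proof.
have cl : continuous (clamped l ^~ y) by case: rl.
have ck : continuous (clamped k ^~ y) by case: rk.
have ci (c : R -> R) : continuous c ->
    lebesgue_measure.-integrable `]0%R, s] (EFin \o c).
  move=> cc; apply: (integrableS _ _ _ (@continuous_integrable_itv R c 0 s cc)) => //.
  exact: subset_itv_oc_cc.
move=> s0; rewrite -(int_oc_prim cl (ltrN10 R) s0) -(int_oc_prim ck (ltrN10 R) s0).
by rewrite /int_oc -RintegralB//; [exact: ci cl|exact: ci ck].
Qed.

Lemma linear_int_oc {R : realType} (c f : R -> R) (a s : R) : 0 <= s <= 1 -> continuous c ->
  (forall r, 0 <= r <= 1 -> f r = int_oc c 0 r / a) ->
  linear_at `[0, 1]%classic f s (c s / a).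
Proof.
have N10 (r : R) : 0 <= r -> -1 < r by move=> r0; apply: lt_le_trans r0; rewrite ltrN10.
move=> s01 cc fE; have /andP[s0 s1] := s01.
apply: (is_derive_linear01 (g := fun r => a^-1 * (prim c r - prim c 0))) => //.
  by move=> r r01; have /andP[r0 _] := r01; rewrite fE// int_oc_prim ?N10// mulrC.
have D := is_deriveZ a^-1 (is_deriveB (is_derive_prim cc (N10 s s0)) (is_derive_cst (prim c 0) s 1)).
by apply: (is_derive_eq D); rewrite subr0 /GRing.scale /= mulrC.
Qed.

(** The jump times of the two bridges from [x] to [x + 1] have the same distribution
    function; differentiating, their densities are proportional on the closed unit
    interval, and the logarithm of this fact is the identity of [Xi_eq_integral]. *)
Lemma reciprocal_class_Xi {R : realType} (l k : R -> int -> R) : NMC l -> NMC k ->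
  reciprocal_class l = reciprocal_class k ->
  forall (t : R) (z : int), t \in `[0, 1] -> Xi l t z = Xi k t z.
Proof.
move=> hl hk lk t x; rewrite in_itv/=; move: t.
have [L rl] := NMC_regular hl; have [K rk] := NMC_regular hk.
apply/(Xi_eq_integral hl hk x) => t t01.
pose G := jump_density l x; pose H := jump_density k x.
pose IG := int_oc G 0 1; pose IH := int_oc H 0 1.
have IG0 : 0 < IG := int_jump_density_gt0 x rl.
have IH0 : 0 < IH := int_jump_density_gt0 x rk.
have IE s : 0 <= s <= 1 -> int_oc G 0 s / IG = int_oc H 0 s / IH.
  move=> s01; have mA := @measurable_X_preimage R s [set x + 1].
  have B0 : (0 < law rl x [set w | X 1 w = (x + 1)%R])%E.
    have p : 0 < IG / mass x by exact: (divr_gt0 IG0 (mass_gt0 x)).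
    exact: (eq_ind_r (fun I => (0 < I)%E) (p : (0 < (IG / mass x)%:E)%E) (law_one_jump1 x rl)).
  have xx : x <= x + 1 by rewrite lerDl.
  have E := etrans (esym (bridge_one_jump x rl s01))
    (etrans (bridge_of_class B0 xx lk mA) (bridge_one_jump x rk s01)).
  exact: (congr1 fine E).
have cG : continuous G := continuous_jump_density rl.
have cH : continuous H := continuous_jump_density rk.
have dE s : 0 <= s <= 1 -> G s / IG = H s / IH.
  move=> s01; have /andP[s0 s1] := s01.
  have E1 := linear_derive01 s01 (linear_int_oc s01 cG (fun r _ => erefl (int_oc G 0 r / IG))).
  have E2 := linear_derive01 s01 (linear_int_oc s01 cH IE).
  exact: etrans (esym E1) E2.
have lnE s : 0 <= s <= 1 -> ln (G s) - ln (H s) = ln (IG / IH).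
  move=> s01; exact: (ln_ratio (jump_density_gt0 x rl s) (jump_density_gt0 x rk s) IG0 IH0 (dE s s01)).
have z01 : 0 <= (0 : R) <= 1 by rewrite lexx ler01.
have /andP[t0 _] := t01.
exact: (log_ratio_arith (etrans (lnE t t01) (esym (lnE 0 z01)))
  (ln_jump_density x rl t01) (ln_jump_density x rk t01)
  (ln_jump_density x rl z01) (ln_jump_density x rk z01)
  (int_oc_gap rl rk x t0) (int_oc_gap rl rk (x + 1) t0)).
Qed.

Theorem theorem1p19 (R : realType) (l k : R -> int -> R)
    (hl : NMC l) (hk : NMC k) :
  reciprocal_class l = reciprocal_class k <->
  (forall (t : R) (z : int), t \in `[0, 1] -> Xi l t z = Xi k t z).
Proof.
split; first exact: (reciprocal_class_Xi hl hk).
exact: (Xi_reciprocal_class hl hk).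
Qed.
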